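(* Let $\mathcal A_\infty$ be the $A$-infinity DG-operad over a commutative ring $\Bbbk$. Its canonical strong cylinder is the DG-operad $I\mathcal A_\infty$ which is freely generated as a graded operad by $$i_0\mu_n,\; i_1\mu_n\in I\mathcal A_\infty(n)_{n-2},\qquad \sigma\mu_n\in I\mathcal A_\infty(n)_{n-1},\qquad n\ge 2,$$ with differential determined by the fact that $i_0,i_1\colon\mathcal A_\infty\to I\mathcal A_\infty$ are DG-operad maps and by the following formula for $n\ge2$: $$d(\sigma\mu_n)=i_0\mu_n-i_1\mu_n-\sum_{\substack{p+q=n+1\\1\le j\le p}}(-1)^{p-j+q(j-1)}\,\sigma\mu_p\circ_j i_1\mu_q$$ $$\qquad+\sum_{\substack{1\le s\le r\\ j_0+t_1+j_1+\cdots+t_s+j_s=n}}(-1)^{\sum_{k=1}^s(t_k-1)\left(j_0+\sum_{l=1}^{k-1}(t_l+j_l)\right)}\,i_0\mu_r(\underbrace{\dots}_{j_0},\sigma\mu_{t_1},\underbrace{\dots}_{j_1},\sigma\mu_{t_2},\dots,\sigma\mu_{t_s},\underbrace{\dots}_{j_s}).$$ Here $p,q,r,t_1,\dots,t_s\ge 2$, $j_0,\dots,j_s\ge0$, $r=s+j_0+\cdots+j_s$, and a brace with number $j$ under dots stands for $j$ operadic identities.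
   Context: Conventions. $\Bbbk$ is a commutative ring; graded modules are $\mathbb Z$-graded $\Bbbk$-modules, differentials have degree $-1$, and tensor products use the Koszul sign rule. The suspension $\Sigma X$ of a chain complex has $(\Sigma X)_n=X_{n-1}$, $d_{\Sigma X}=-d_X$, and $\sigma\colon X\to\Sigma X$ is the degree $+1$ map which is the identity degreewise. A ''sequence'' is a family indexed by arity $n\geq 0$; constructions and maps on sequences are aritywise. Operads. All operads are non-symmetric, with arities $n\ge 0$. A graded operad $\mathcal O=\{\mathcal O(n)\}_{n\geq0}$ has compositions $\circ_i\colon\mathcal O(p)\otimes\mathcal O(q)\to\mathcal O(p+q-1)$, $1\le i\le p$, and $\mathrm{id}\in\mathcal O(1)_0$, with $x\circ_i(y\circ_jz)=(x\circ_iy)\circ_{i+j-1}z$; $(x\circ_iy)\circ_jz=(-1)^{|y||z|}(x\circ_jz)\circ_{i+n-1}y$ for $j<i$, $z\in\mathcal O(n)$; $\mathrm{id}\circ_1x=x=x\circ_i\mathrm{id}$. Write $x_0(x_1,\dots,x_n)$ for the full composition obtained by inserting $x_1,\dots,x_n$ successively from left to right. A DG-operad moreover has a differential with $d(x\circ_iy)=d(x)\circ_iy+(-1)^{|x|}x\circ_id(y)$. The initial DG-operad is $\Bbbk\cdot\mathrm{id}$ in arity $1$. The $A$-infinity DG-operad. $\mathcal A_\infty$ is freely generated as a graded operad by $\mu_n\in\mathcal A_\infty(n)_{n-2}$, $n\ge2$, with $d(\mu_n)=\sum_{p+q=n+1,\,1\le i\le p}(-1)^{p-i+q(i-1)}\mu_p\circ_i\mu_q$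 ($p,q\ge2$). It is filtered by $\mathcal A_0=\mathcal A_1$ the initial DG-operad, and $\mathcal A_n=\mathcal A_{n-1}\amalg_{\partial_{n-1}}\mathcal F(\Bbbk\cdot\mu_n)$ for $n\ge2$ (the sub-DG-operad generated by $\mu_2,\dots,\mu_n$), where $\Bbbk\cdot\mu_n$ is free on $\mu_n$ with trivial differential and $\partial_{n-1}(\mu_n)=d(\mu_n)$; $\mathcal A_\infty=\bigcup_n\mathcal A_n$. Strong pseudo-cylinders. A strong pseudo-cylinder $(C,i_0,i_1,p,h)$ of a chain complex $X$ consists of chain maps $i_0,i_1\colon X\to C$, $p\colon C\to X$ and a degree $+1$ map $h\colon C\to C$ with $i_0p-1_C=dh+hd$, $pi_0=pi_1=1_X$, $ph=0$, $hi_0=0$, $h^2=0$. The canonical one is $IX=X\oplus\Sigma X\oplus X$, where $i_0,i_1$ are the inclusions of the first and third summands, $d(\sigma x)=i_0x-i_1x-\sigma d(x)$, $p(i_0x)=p(i_1x)=x$, $p(\sigma x)=0$, with homotopy $h_I(i_1x)=\sigma x$, $h_I(i_0x)=h_I(\sigma x)=0$. A strong pseudo-cylinder of a DG-operad $\mathcal O$ is a DG-operad $\mathcal P$ with DG-operad maps $i_0,i_1\colon\mathcal O\to\mathcal P$, $p\colon\mathcal P\to\mathcal O$ and a sequence of degree $+1$ maps $h_{\mathcal O}\colon\mathcal P\to\mathcal P$ which aritywise form a strong pseudo-cylinder of chain complexes. It is called a strong cylinder if $(i_0,i_1)\colon\mathcal O\amalg\mathcal O\to\mathcal P$ is a cofibration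 in the model structure on DG-operads transferred from the projective model structure on chain complexes (this is the case for the canonical strong pseudo-cylinder of $\mathcal A_\infty$ defined below). Trees and coproducts. A tree is a planted planar tree with leaves; its inner vertices (those other than the bottom vertex of the root edge and the top vertices of the leaves) are ordered by the path order: $v\le w$ if the path from the root to $v$ is contained in the path to $w$ or branches off to the left of it. Levels count distance from the bottom of the root edge, so the bottommost inner vertex has level $1$; a leaf has the level of its top vertex. The arity $\tilde v$ of an inner vertex $v$ is the number of edges adjacent from above. $\mathcal F(V)$ is the free operad on a sequence $V$. The coproduct of operads decomposes as $(\mathcal O\amalg\mathcal F(V))(n)=\bigoplus_T(\mathcal O,V)(T)$, over trees $T$ with $n$ leaves, all of even level, where $(\mathcal O,V)(T)$ is the tensor product, in the path order, of $\mathcal O(\tilde u)$ for $u$ inner of odd level and $V(\tilde v)$ for $v$ inner of even level; a tensor (labeled tree) corresponds to the iterated composition of its labels nested according to $T$ and written in the path order. If $(\mathcal P,i_0,i_1,p,h_{\mathcal O})$ is a strong pseudo-cylinder of $\mathcal O$, then $h_{\mathcal O,V}$ is the degree $+1$ self-map of $\mathcal P\amalg\mathcal F(IV)$ preserving each summand $(\mathcal P,IV)(T)$ and given there, on a tensor $y_1\otimes\cdots\otimes y_m$ of labels in path order, by $\sum_{k=1}^m(-1)^{|y_1|+\cdots+|y_{k-1}|}i_0p(y_1)\otimes\cdots\otimes i_0p(y_{k-1})\otimes h(y_k)\otimes y_{k+1}\otimes\cdots\otimes y_m$, where $h$ is $h_{\mathcal O}$ on labels in $\mathcal P$ and $h_I$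 on labels in $IV$. Twisted coproducts and induced cylinders. For a degree $-1$ map of sequences $\partial\colon V\to\mathcal O$ with $\partial d_V+d_{\mathcal O}\partial=0$, the twisted coproduct $\mathcal O\amalg_\partial\mathcal F(V)$ is $\mathcal O\amalg\mathcal F(V)$ as a graded operad, with differential extending $d_{\mathcal O}$ and equal to $d_V+\partial$ on $V$. The extension of $\partial$ to $\mathcal O\amalg\mathcal F(V)$ is the unique degree $-1$ self-map vanishing on $\mathcal O$, equal to $\partial$ on $V$, and satisfying the operadic Leibniz rule. Given a strong pseudo-cylinder $(\mathcal P,i_0,i_1,p,h_{\mathcal O})$ of $\mathcal O$, the canonical induced strong pseudo-cylinder of $\mathcal O\amalg_\partial\mathcal F(V)$ is $\mathcal P\amalg_{\partial_I}\mathcal F(IV)$ with $\partial_I(i_0x)=i_0\partial(x)$, $\partial_I(\sigma x)=-h_{\mathcal O}i_1\partial(x)$, $\partial_I(i_1x)=i_1\partial(x)$ for $x\in V$, structure maps $i_0\amalg\mathcal F(i_0)$, $i_1\amalg\mathcal F(i_1)$, $p\amalg\mathcal F(p)$, and homotopy $h_\partial=\sum_{n\ge0}(h_{\mathcal O,V}\partial_I)^nh_{\mathcal O,V}$ (a locally finite sum, with $\partial_I$ extended to $\mathcal P\amalg\mathcal F(IV)$). Canonical strong (pseudo-)cylinder $I\mathcal A_\infty$. Start with the trivial strong pseudo-cylinder of $\mathcal A_0=\mathcal A_1$ ($\mathcal P=\mathcal A_1$, $i_0=i_1=p=1$, $h=0$); inductively, for $n\ge 2$, take on $\mathcal A_n=\mathcal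 A_{n-1}\amalg_{\partial_{n-1}}\mathcal F(\Bbbk\cdot\mu_n)$ the canonical strong pseudo-cylinder $I\mathcal A_n$ induced by the one already defined on $\mathcal A_{n-1}$; finally $I\mathcal A_\infty=\bigcup_nI\mathcal A_n$, with structure maps and homotopy defined as the colimits. *)

(* Defs.v *)
From HB Require Import structures.
From mathcomp Require Import all_boot all_order all_algebra.
Set Implicit Arguments.
Unset Strict Implicit.
Unset Printing Implicit Defensive.
Import GRing.Theory.
Local Open Scope ring_scope.

(** * Sequences of graded modules

    A graded k-module is a family of k-modules indexed by its degrees, so only
    homogeneous elements occur.  A map of degree +1 or -1 takes its source and
    target degrees as independent arguments, together with a proof relating
    them (there is only one such proof): composites then typecheck without
    transporting elements along equations such as [a + 1 - 1 = a]. *)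

Definition gseq (k : comPzRingType) := nat -> int -> lmodType k.

Definition hmap (k : comPzRingType) (X Y : gseq k) :=
  forall n a, {linear X n a -> Y n a}.

Definition hup (k : comPzRingType) (X Y : gseq k) :=
  forall n (a c : int), c = a + 1 -> {linear X n a -> Y n c}.

Definition hdown (k : comPzRingType) (X Y : gseq k) :=
  forall n (a c : int), c = a + 1 -> {linear X n c -> Y n a}.

Identity Coercion gseq_funclass : gseq >-> Funclass.
Identity Coercion hmap_funclass : hmap >-> Funclass.
Identity Coercion hup_funclass : hup >-> Funclass.
Identity Coercion hdown_funclass : hdown >-> Funclass.

Definition sgn (k : comPzRingType) (a : int) : k := (-1) ^+ `|a|%N.

Record dgseq (k : comPzRingType) := DGSeq {
  ds_seq :> gseq k;
  ds_d : hdown ds_seq ds_seq;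
  ds_dd : forall n (a b c : int) (e : b = a + 1) (e' : c = b + 1)
    (x : ds_seq n c), ds_d n e (ds_d n e' x) = 0
}.

(** * Non-symmetric operads

    [op_comp p q r a b c _ _ i x y] is the composition of x, of arity p and
    degree a, with y, of arity q and degree b, at the i-th input.  It is only
    meaningful for 1 <= i <= p, and every requirement carries this bound. *)

Record operad (k : comPzRingType) := Operad {
  op_seq :> gseq k;
  op_id : op_seq 1%N 0;
  op_comp : forall (p q r : nat) (a b c : int), (p + q = r.+1)%N -> a + b = c ->
    nat -> op_seq p a -> op_seq q b -> op_seq r c;
  op_comp_linl : forall p q r a b c (e : (p + q = r.+1)%N) (f : a + b = c) i
    (u : k) (x x' : op_seq p a) (y : op_seq q b), (1 <= i <= p)%N ->
    op_comp e f i (u *: x + x') y = u *: op_comp e f i x y + op_comp e f i x' y;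
  op_comp_linr : forall p q r a b c (e : (p + q = r.+1)%N) (f : a + b = c) i
    (u : k) (x : op_seq p a) (y y' : op_seq q b), (1 <= i <= p)%N ->
    op_comp e f i x (u *: y + y') = u *: op_comp e f i x y + op_comp e f i x y';
  op_assoc : forall p q s qs pq r a b c bc ab abc
    (e1 : (q + s = qs.+1)%N) (f1 : b + c = bc)
    (e2 : (p + qs = r.+1)%N) (f2 : a + bc = abc)
    (e3 : (p + q = pq.+1)%N) (f3 : a + b = ab)
    (e4 : (pq + s = r.+1)%N) (f4 : ab + c = abc)
    i j (x : op_seq p a) (y : op_seq q b) (z : op_seq s c),
    (1 <= i <= p)%N -> (1 <= j <= q)%N ->
    op_comp e2 f2 i x (op_comp e1 f1 j y z) =
    op_comp e4 f4 (i + j - 1)%N (op_comp e3 f3 i x y) z;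
  op_exch : forall p q s pq ps r a b c ab ac abc
    (e1 : (p + q = pq.+1)%N) (f1 : a + b = ab)
    (e2 : (pq + s = r.+1)%N) (f2 : ab + c = abc)
    (e3 : (p + s = ps.+1)%N) (f3 : a + c = ac)
    (e4 : (ps + q = r.+1)%N) (f4 : ac + b = abc)
    i j (x : op_seq p a) (y : op_seq q b) (z : op_seq s c),
    (1 <= j < i)%N -> (i <= p)%N ->
    op_comp e2 f2 j (op_comp e1 f1 i x y) z =
    sgn k (b * c) *: op_comp e4 f4 (i + s - 1)%N (op_comp e3 f3 j x z) y;
  op_idl : forall n a (e : (1 + n = n.+1)%N) (f : 0 + a = a) (x : op_seq n a),
    op_comp e f 1%N op_id x = x;
  op_idr : forall n a (e : (n + 1 = n.+1)%N) (f : a + 0 = a) i (x : op_seq n a),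
    (1 <= i <= n)%N -> op_comp e f i x op_id = x
}.

Record op_map (k : comPzRingType) (O P : operad k) := OpMap {
  om_fun :> hmap O P;
  om_id : om_fun 1%N 0 (op_id O) = op_id P;
  om_comp : forall p q r a b c (e : (p + q = r.+1)%N) (f : a + b = c) i
    (x : O p a) (y : O q b), (1 <= i <= p)%N ->
    om_fun r c (op_comp e f i x y) =
    op_comp e f i (om_fun p a x) (om_fun q b y)
}.

Definition leibniz (k : comPzRingType) (O : operad k) (D : hdown O O) : Prop :=
  forall p q r (a a' b b' c c' : int) (e : (p + q = r.+1)%N)
    (ea : a' = a + 1) (eb : b' = b + 1) (ec : c' = c + 1)
    (f : a' + b' = c') (fl : a + b' = c) (fr : a' + b = c)
    i (x : O p a') (y : O q b'), (1 <= i <= p)%N ->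
  D r c c' ec (op_comp e f i x y) =
  op_comp e fl i (D p a a' ea x) y +
  sgn k a' *: op_comp e fr i x (D q b b' eb y).

Record dg_operad (k : comPzRingType) := DGOperad {
  dg_op :> operad k;
  dg_d : hdown dg_op dg_op;
  dg_dd : forall n (a b c : int) (e : b = a + 1) (e' : c = b + 1)
    (x : dg_op n c), dg_d n e (dg_d n e' x) = 0;
  dg_leibniz : leibniz dg_d
}.

Definition dg_seq (k : comPzRingType) (O : dg_operad k) : dgseq k :=
  DGSeq (@dg_dd k O).

Definition chain_map (k : comPzRingType) (X Y : dgseq k) (f : hmap X Y) : Prop :=
  forall n (a c : int) (e : c = a + 1) (x : X n c),
  f n a (ds_d X n e x) = ds_d Y n e (f n c x).

Record dg_map (k : comPzRingType) (O P : dg_operad k) := DGMap {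
  dm_op :> op_map O P;
  dm_d : chain_map (X := dg_seq O) (Y := dg_seq P) dm_op
}.

Definition is_initial (k : comPzRingType) (O : dg_operad k) : Prop :=
  forall P : dg_operad k, exists f : dg_map O P,
  forall (g : dg_map O P) n a (x : O n a), g n a x = f n a x.

(** * Homogeneous elements

    A homogeneous element packed with its arity and degree.  [hcomponent n a z]
    recovers the element of [X n a]; by convention it is 0 when z does not have
    arity n and degree a.  [hcomp] likewise has a junk value on elements of
    arity 0, which have no input. *)

Record helt (k : comPzRingType) (X : gseq k) := Helt {
  h_ar : nat;
  h_deg : int;
  h_val : X h_ar h_deg
}.
Arguments Helt {k X h_ar h_deg} h_val.

Definition hcomponent (k : comPzRingType) (X : gseq k) n a (z : helt X) : X n a :=
  match h_ar z =P n, h_deg z =P a with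
  | ReflectT e, ReflectT f =>
      ecast m (X m a) e (ecast b (X (h_ar z) b) f (h_val z))
  | _, _ => 0
  end.

Definition happly (k : comPzRingType) (X Y : gseq k) (f : hmap X Y) (z : helt X) :
  helt Y := Helt (f _ _ (h_val z)).

Definition happly_up (k : comPzRingType) (X Y : gseq k) (f : hup X Y)
  (z : helt X) : helt Y := Helt (f _ _ _ erefl (h_val z)).

Definition hid (k : comPzRingType) (O : operad k) : helt O := Helt (op_id O).

Definition hcomp (k : comPzRingType) (O : operad k) (x : helt O) (i : nat)
  (y : helt O) : helt O :=
  match x with
  | @Helt _ _ p a u =>
      match p return O p a -> helt O with
      | 0%N => fun=> x
      | p'.+1 => fun u => Helt
          (op_comp (erefl (p'.+1 + h_ar y)%N) (erefl (a + h_deg y)) i u (h_val y))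
      end u
  end.

(** The full composition x(y_1, ..., y_n): [hcomp_from i] inserts the given
    elements successively, the first one at the i-th input. *)
Fixpoint hcomp_from (k : comPzRingType) (O : operad k) (i : nat) (x : helt O)
  (ys : seq (helt O)) : helt O :=
  if ys is y :: ys' then hcomp_from (i + h_ar y)%N (hcomp x i y) ys' else x.

Definition hfull (k : comPzRingType) (O : operad k) (x : helt O)
  (ys : seq (helt O)) : helt O := hcomp_from 1%N x ys.

(** * Strong pseudo-cylinders *)

Record is_strong_pseudo_cylinder (k : comPzRingType) (X C : dgseq k)
    (i0 i1 : hmap X C) (p : hmap C X) (h : hup C C) : Prop := {
  spc_i0 : chain_map i0;
  spc_i1 : chain_map i1;
  spc_p : chain_map p;
  spc_homotopy : forall n (a b c : int) (eb : b = a + 1) (ec : c = b + 1)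
    (x : C n b),
    i0 n b (p n b x) - x = ds_d C n ec (h n b c ec x) + h n a b eb (ds_d C n eb x);
  spc_pi0 : forall n a (x : X n a), p n a (i0 n a x) = x;
  spc_pi1 : forall n a (x : X n a), p n a (i1 n a x) = x;
  spc_ph : forall n (a c : int) (e : c = a + 1) (x : C n a),
    p n c (h n a c e x) = 0;
  spc_hi0 : forall n (a c : int) (e : c = a + 1) (x : X n a),
    h n a c e (i0 n a x) = 0;
  spc_hh : forall n (a b c : int) (eb : b = a + 1) (ec : c = b + 1) (x : C n a),
    h n b c ec (h n a b eb x) = 0
}.

Record pseudo_cylinder (k : comPzRingType) (O : dg_operad k) := PseudoCylinder {
  pc_op :> dg_operad k;
  pc_i0 : dg_map O pc_op;
  pc_i1 : dg_map O pc_op;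
  pc_p : dg_map pc_op O;
  pc_h : hup pc_op pc_op;
  pc_spc : is_strong_pseudo_cylinder (X := dg_seq O) (C := dg_seq pc_op)
    pc_i0 pc_i1 pc_p pc_h
}.

Section TrivialCylinder.
Variables (k : comPzRingType) (O : dg_operad k).

Definition id_op_map : op_map O O :=
  @OpMap k O O (fun n a => GRing.Linear.clone _ _ _ _ idfun _) erefl
    (fun _ _ _ _ _ _ _ _ _ _ _ _ => erefl).

Definition id_dg_map : dg_map O O :=
  @DGMap k O O id_op_map (fun _ _ _ _ _ => erefl).

Definition zero_up : hup O O :=
  fun n a c _ => GRing.Linear.clone _ _ _ _ (\0 : O n a -> O n c) _.

Lemma trivial_spc : is_strong_pseudo_cylinder (X := dg_seq O) (C := dg_seq O)
  id_dg_map id_dg_map id_dg_map zero_up.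
Proof. by split=> //= n a b c eb ec x; rewrite subrr linear0 addr0. Qed.

Definition trivial_cylinder : pseudo_cylinder O := PseudoCylinder trivial_spc.

End TrivialCylinder.

(** The canonical strong pseudo-cylinder IX = X + Sigma X + X: its part of
    degree a is [X n a * X n (a - 1) * X n a]. *)

Section Interval.
Variables (k : comPzRingType) (X : dgseq k).

Definition dcast n (a b : int) (e : a = b) (x : X n a) : X n b :=
  ecast c (X n c) e x.

Fact dcast_linear n (a b : int) (e : a = b) : linear (@dcast n a b e).
Proof. by case: b / e. Qed.
HB.instance Definition _ n (a b : int) (e : a = b) :=
  GRing.isLinear.Build k (X n a) (X n b) *:%R (dcast e) (dcast_linear e).

Fact pred_eq (a c : int) : c = a + 1 -> c - 1 = a.
Proof. by move=> ->; rewrite addrK. Qed.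

Fact pred_succ (a c : int) : c = a + 1 -> c - 1 = a - 1 + 1.
Proof. by move=> ->; rewrite addrK subrK. Qed.

Definition int_seq : gseq k :=
  fun n a => (X n a * X n (a - 1) * X n a)%type.

Definition int_d_fun n (a c : int) (e : c = a + 1) (z : int_seq n c) :
    int_seq n a :=
  let: (u, w, v) := z in
  (ds_d X n e u + dcast (pred_eq e) w,
   - ds_d X n (pred_succ e) w,
   ds_d X n e v - dcast (pred_eq e) w).

Fact int_d_linear n (a c : int) (e : c = a + 1) : linear (@int_d_fun n a c e).
Proof.
move=> s [[u w] v] [[u' w'] v']; rewrite /int_d_fun /= !linearP.
congr (_, _, _) => /=; first by rewrite scalerDr addrACA.
by rewrite scalerN scalerBr addrACA.
Qed.
HB.instance Definition _ n (a c : int) (e : c = a + 1) :=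
  GRing.isLinear.Build k (int_seq n c) (int_seq n a) *:%R (@int_d_fun n a c e)
    (@int_d_linear n a c e).

Definition int_d : hdown int_seq int_seq := fun n a c e => @int_d_fun n a c e.

Lemma dcast_d n (a b a' b' : int) (e : b = a + 1) (e' : b' = a' + 1)
    (f : b = b') (g : a = a') (x : X n b) :
  ds_d X n e' (dcast f x) = dcast g (ds_d X n e x).
Proof.
case: b' / f e' => e'; case: a' / g e' => e'.
by rewrite /dcast /= (eq_irrelevance e' e).
Qed.

Fact int_dd n (a b c : int) (e : b = a + 1) (e' : c = b + 1)
  (x : int_seq n c) : int_d n e (int_d n e' x) = 0.
Proof.
case: x => [[u w] v]; rewrite /int_d /= /int_d_fun.
rewrite !(linearD, linearN) /= !ds_dd.
rewrite (dcast_d (pred_succ e') e (pred_eq e') (pred_eq e)).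
by congr (_, _, _); rewrite ?add0r ?sub0r ?subrr ?opprK ?addNr.
Qed.

Fact dcastK n (a b : int) (e : a = b) (x : X n b) : dcast e (dcast (esym e) x) = x.
Proof. by case: b / e x. Qed.

Fact dcastK' n (a b : int) (e : a = b) (x : X n a) : dcast (esym e) (dcast e x) = x.
Proof. by case: b / e. Qed.

Definition interval : dgseq k := DGSeq int_dd.

Definition int_i0_fun n a (x : X n a) : interval n a := (x, 0, 0).
Definition int_i1_fun n a (x : X n a) : interval n a := (0, 0, x).
Definition int_p_fun n a (z : interval n a) : X n a := z.1.1 + z.2.

Definition int_sigma_fun n (a c : int) (e : c = a + 1) (x : X n a) :
  interval n c := (0, dcast (esym (pred_eq e)) x, 0).

Definition int_h_fun n (a c : int) (e : c = a + 1) (z : interval n a) :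
  interval n c := int_sigma_fun e z.2.

Fact int_i0_linear n a : linear (@int_i0_fun n a).
Proof. by move=> s x y; congr (_, _, _); rewrite /= scaler0 addr0. Qed.
HB.instance Definition _ n a :=
  GRing.isLinear.Build k (X n a) (interval n a) *:%R (@int_i0_fun n a)
    (@int_i0_linear n a).

Fact int_i1_linear n a : linear (@int_i1_fun n a).
Proof. by move=> s x y; congr (_, _, _); rewrite /= scaler0 addr0. Qed.
HB.instance Definition _ n a :=
  GRing.isLinear.Build k (X n a) (interval n a) *:%R (@int_i1_fun n a)
    (@int_i1_linear n a).

Fact int_p_linear n a : linear (@int_p_fun n a).
Proof. by move=> s x y; rewrite /int_p_fun /= scalerDr addrACA. Qed.
HB.instance Definition _ n a :=
  GRing.isLinear.Build k (interval n a) (X n a) *:%R (@int_p_fun n a)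
    (@int_p_linear n a).

Fact int_sigma_linear n (a c : int) (e : c = a + 1) : linear (@int_sigma_fun n a c e).
Proof.
move=> s x y; congr (_, _, _); rewrite /= ?scaler0 ?addr0 //.
by rewrite linearP.
Qed.
HB.instance Definition _ n (a c : int) (e : c = a + 1) :=
  GRing.isLinear.Build k (X n a) (interval n c) *:%R (@int_sigma_fun n a c e)
    (@int_sigma_linear n a c e).

Fact int_h_linear n (a c : int) (e : c = a + 1) : linear (@int_h_fun n a c e).
Proof. by move=> s x y; rewrite /int_h_fun linearP. Qed.
HB.instance Definition _ n (a c : int) (e : c = a + 1) :=
  GRing.isLinear.Build k (interval n a) (interval n c) *:%R (@int_h_fun n a c e)
    (@int_h_linear n a c e).

Definition int_i0 : hmap X interval := fun n a => @int_i0_fun n a.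
Definition int_i1 : hmap X interval := fun n a => @int_i1_fun n a.
Definition int_p : hmap interval X := fun n a => @int_p_fun n a.
Definition int_sigma : hup X interval := fun n a c e => @int_sigma_fun n a c e.
Definition int_h : hup interval interval := fun n a c e => @int_h_fun n a c e.

Lemma interval_spc : is_strong_pseudo_cylinder int_i0 int_i1 int_p int_h.
Proof.
split=> //=.
- by move=> n a c e x; congr (_, _, _); rewrite /= !linear0 ?oppr0 ?addr0.
- by move=> n a c e x; congr (_, _, _); rewrite /= !linear0 ?oppr0 ?addr0.
- move=> n a c e [[u w] v]; rewrite /int_p_fun /= [RHS]linearD /=.
  by rewrite [LHS]addrACA subrr addr0.
- move=> n a b c eb ec [[u w] v]; congr (_, _, _); rewrite /= ?linear0 /=.
  + by rewrite /int_p_fun /= dcastK addr0 add0r addrAC subrr add0r.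
  + rewrite linearB /= dcastK' sub0r addrA.
    rewrite (dcast_d eb (pred_succ ec) (esym (pred_eq ec)) (esym (pred_eq eb))).
    by rewrite addNr add0r.
  + by rewrite dcastK !sub0r addr0.
- by move=> n a x; rewrite /int_p_fun /= addr0.
- by move=> n a x; rewrite /int_p_fun /= add0r.
- by move=> n a c e x; rewrite /int_p_fun /= addr0.
- by move=> n a c e x; congr (_, _, _); rewrite /= linear0.
- by move=> n a b c eb ec x; congr (_, _, _); rewrite /= linear0.
Qed.

End Interval.

(** * Twisted coproducts

    T = O * F(V) with the differential twisted by [del : V -> O], together with
    the canonical maps [j : O -> T] and [v : V -> T].  As a graded operad it is
    the coproduct of O and of the free operad on V, so that maps out of it are
    pairs of an operad map on O and a map of sequences on V. *)

Record is_twisted_coproduct (k : comPzRingType) (O : dg_operad k) (V : dgseq k)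
    (del : hdown V O) (T : dg_operad k) (j : dg_map O T) (v : hmap V T) : Prop := {
  tc_del : forall n (a b c : int) (eb : b = a + 1) (ec : c = b + 1) (x : V n c),
    del n a b eb (ds_d V n ec x) + dg_d O n eb (del n b c ec x) = 0;
  tc_exists : forall (Q : operad k) (f : op_map O Q) (g : hmap V Q),
    exists F : op_map T Q,
      (forall n a (x : O n a), F n a (j n a x) = f n a x) /\
      (forall n a (x : V n a), F n a (v n a x) = g n a x);
  tc_unique : forall (Q : operad k) (F G : op_map T Q),
    (forall n a (x : O n a), F n a (j n a x) = G n a (j n a x)) ->
    (forall n a (x : V n a), F n a (v n a x) = G n a (v n a x)) ->
    forall n a (x : T n a), F n a x = G n a x;
  tc_d : forall n (a c : int) (e : c = a + 1) (x : V n c),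
    dg_d T n e (v n c x) = v n a (ds_d V n e x) + j n a (del n a c e x)
}.

(** * Trees

    The inner vertices of a tree are listed in path order, that is, in
    depth-first order from left to right.  A labelling of a tree is the list of
    its labels in this order. *)

Inductive tree := Leaf | Node of seq tree.

(** The inner vertices, each given as the pair of its level and its arity, of a
    tree whose root edge has its top vertex at level l. *)
Fixpoint inner_vertices (l : nat) (t : tree) : seq (nat * nat) :=
  if t is Node ts then
    (l, size ts) :: flatten [seq inner_vertices l.+1 t' | t' <- ts]
  else [::].

Fixpoint leaf_levels (l : nat) (t : tree) : seq nat :=
  if t is Node ts then flatten [seq leaf_levels l.+1 t' | t' <- ts] else [:: l].

Definition even_leaves (t : tree) : bool :=
  all (fun l => ~~ odd l) (leaf_levels 1 t).

(** The composition of the labels ys nested according to t.  The second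
    component returns the labels left over by t. *)
Fixpoint tree_value_rest (k : comPzRingType) (O : operad k) (t : tree)
    (ys : seq (helt O)) : helt O * seq (helt O) :=
  match t, ys with
  | Node ts, y :: ys1 =>
      let fix children (us : seq tree) (zs : seq (helt O)) :=
        if us is u :: us' then
          let r := tree_value_rest u zs in
          let s := children us' r.2 in
          (r.1 :: s.1, s.2)
        else ([::], zs) in
      let s := children ts ys1 in
      (hfull y s.1, s.2)
  | _, _ => (hid O, ys)
  end.

Definition tree_value (k : comPzRingType) (O : operad k) (t : tree)
  (ys : seq (helt O)) : helt O := (tree_value_rest t ys).1.

(** * Induced cylinders

    In this section T is, as a graded operad, the coproduct of the cylinder C
    of O and of F(IV), with canonical maps j and v. *)

Section InducedCylinder.
Variables (k : comPzRingType) (O : dg_operad k) (V : dgseq k).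
Variables (C : pseudo_cylinder O) (T : dg_operad k).
Variables (j : dg_map C T) (v : hmap (interval V) T).

Definition label := (helt C + helt (interval V))%type.

Definition label_fits (w : nat * nat) (y : label) : bool :=
  match y with
  | inl x => odd w.1 && (h_ar x == w.2)
  | inr x => ~~ odd w.1 && (h_ar x == w.2)
  end.

Definition labelling (t : tree) (ys : seq label) : bool :=
  all2 label_fits (inner_vertices 1 t) ys.

Definition label_deg (y : label) : int :=
  match y with inl x => h_deg x | inr x => h_deg x end.

Definition label_val (y : label) : helt T :=
  match y with inl x => happly j x | inr x => happly v x end.

Definition label_i0p (y : label) : label :=
  match y with
  | inl x => inl (happly (pc_i0 C) (happly (pc_p C) x))
  | inr x => inr (happly (@int_i0 k V) (happly (@int_p k V) x))
  end.

Definition label_h (y : label) : label :=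
  match y with
  | inl x => inl (happly_up (pc_h C) x)
  | inr x => inr (happly_up (@int_h k V) x)
  end.

(** [coproduct_homotopy hV] says that hV is the map h_{O,V}: the tensors with
    labels ys over the trees t with leaves of even level, where the vertices of
    odd level have labels in C and those of even level have labels in IV, span
    the coproduct. *)
Definition coproduct_homotopy (hV : hup T T) : Prop :=
  forall (t : tree) (ys : seq label), even_leaves t -> labelling t ys ->
  let z := tree_value t (map label_val ys) in
  forall c (e : c = h_deg z + 1),
  hV (h_ar z) (h_deg z) c e (h_val z) =
  \sum_(i < size ys)
    if drop i ys is y :: ys' then
      sgn k (\sum_(x <- take i ys) label_deg x) *:
      hcomponent (h_ar z) c
        (tree_value t
          (map label_val (map label_i0p (take i ys) ++ label_h y :: ys')))
    else 0.

Definition del_interval_fun (del : hdown V O) n (a c : int) (e : c = a + 1)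
    (z : interval V n c) : C n a :=
  pc_i0 C n a (del n a c e z.1.1)
  - pc_h C n (esym (subrK 1 a))
      (pc_i1 C n (a - 1) (del n (a - 1) (c - 1) (pred_succ e) z.1.2))
  + pc_i1 C n a (del n a c e z.2).

Fact del_interval_linear (del : hdown V O) n (a c : int)
    (e : c = a + 1) :
  linear (@del_interval_fun del n a c e).
Proof.
move=> s x y; rewrite /del_interval_fun /= !linearP /= !scalerDr.
by rewrite [X in X + _]addrACA [LHS]addrACA.
Qed.
HB.instance Definition _ (del : hdown V O) n (a c : int)
    (e : c = a + 1) :=
  GRing.isLinear.Build k (interval V n c) (C n a) *:%R
    (@del_interval_fun del n a c e) (@del_interval_linear del n a c e).

(** This map sends i_0 x to i_0 (del x), sigma x to - h (i_1 (del x)), and i_1 x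
    to i_1 (del x). *)
Definition del_interval (del : hdown V O) : hdown (interval V) C :=
  fun n a c e => @del_interval_fun del n a c e.

Record del_extension (del : hdown V O) (D : hdown T T) : Prop := {
  de_j : forall n (a c : int) (e : c = a + 1) (x : C n c),
    D n a c e (j n c x) = 0;
  de_v : forall n (a c : int) (e : c = a + 1) (x : interval V n c),
    D n a c e (v n c x) = j n a (del_interval del n e x);
  de_leibniz : leibniz D
}.

(** h = sum over m of (hV D)^m hV, a locally finite sum. *)
Definition perturbed_homotopy (hV : hup T T) (D : hdown T T) (h : hup T T) : Prop :=
  forall n (a c : int) (e : c = a + 1) (x : T n a),
  let term m := iter m (fun y => hV n a c e (D n a c e y)) (hV n a c e x) in
  exists N, (forall m, (N <= m)%N -> term m = 0) /\
            h n a c e x = \sum_(m < N) term m.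

End InducedCylinder.

(** C' is the canonical strong pseudo-cylinder of the twisted coproduct T of O
    and F(V) induced by the strong pseudo-cylinder C of O. *)
Record is_induced_cylinder (k : comPzRingType) (O : dg_operad k) (V : dgseq k)
    (del : hdown V O) (T : dg_operad k) (j : dg_map O T) (v : hmap V T)
    (C : pseudo_cylinder O) (C' : pseudo_cylinder T)
    (jI : dg_map C C') (vI : hmap (interval V) C') : Prop := {
  ic_coproduct : is_twisted_coproduct (@del_interval k O V C del) jI vI;
  ic_i0_j : forall n a (x : O n a),
    pc_i0 C' n a (j n a x) = jI n a (pc_i0 C n a x);
  ic_i0_v : forall n a (x : V n a),
    pc_i0 C' n a (v n a x) = vI n a (@int_i0 k V n a x);
  ic_i1_j : forall n a (x : O n a),
    pc_i1 C' n a (j n a x) = jI n a (pc_i1 C n a x);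
  ic_i1_v : forall n a (x : V n a),
    pc_i1 C' n a (v n a x) = vI n a (@int_i1 k V n a x);
  ic_p_j : forall n a (x : C n a),
    pc_p C' n a (jI n a x) = j n a (pc_p C n a x);
  ic_p_v : forall n a (x : interval V n a),
    pc_p C' n a (vI n a x) = v n a (@int_p k V n a x);
  ic_h : exists (hV : hup C' C') (D : hdown C' C'),
    [/\ coproduct_homotopy jI vI hV, del_extension jI vI del D
      & perturbed_homotopy hV D (pc_h C')]
}.

(** * The A-infinity operad *)

Definition freely_generated (k : comPzRingType) (O : operad k) (I : Type)
    (P : pred I) (gen : I -> helt O) : Prop :=
  (forall (Q : operad k) (y : forall i, Q (h_ar (gen i)) (h_deg (gen i))),
     exists F : op_map O Q, forall i, P i -> F _ _ (h_val (gen i)) = y i) /\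
  (forall (Q : operad k) (F G : op_map O Q),
     (forall i, P i -> F _ _ (h_val (gen i)) = G _ _ (h_val (gen i))) ->
     forall n a (x : O n a), F n a x = G n a x).

(** The sum of (-1)^(p - i + q (i - 1)) x_p o_i y_q over p + q = n + 1, with
    p, q >= 2 and 1 <= i <= p. *)
Definition stasheff_sum (k : comPzRingType) (O : operad k) (x y : nat -> helt O)
    (n : nat) (a : int) : O n a :=
  \sum_(p < n.+1) \sum_(q < n.+1 | [&& 2 <= p, 2 <= q & p + q == n.+1]%N)
  \sum_(1 <= i < p.+1)
    (-1) ^+ (p - i + q * (i - 1))%N *: hcomponent n a (hcomp (x p) i (y q)).

(** The values of mu in arities 0 and 1 are irrelevant. *)
Record A_infinity (k : comPzRingType) := AInfinity {
  ai_op :> dg_operad k;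
  ai_mu : forall n : nat, ai_op n (n%:Z - 2);
  ai_free : freely_generated (leq 2) (fun n => Helt (ai_mu n));
  ai_d : forall (n : nat) (a : int) (e : n%:Z - 2 = a + 1), (2 <= n)%N ->
    dg_d ai_op n e (ai_mu n) =
    stasheff_sum (fun p => Helt (ai_mu p)) (fun q => Helt (ai_mu q)) n a
}.

(** The sequence freely spanned by one generator, of arity n and degree n - 2,
    with trivial differential: its module of arity m and degree a has rank 1 if
    m = n and a = n - 2, and rank 0 otherwise. *)

Section Generator.
Variables (k : comPzRingType) (n : nat).

Definition gen_seq : gseq k :=
  fun m a => 'rV[k]_((m == n) && (a == n%:Z - 2)).

Definition gen_d : hdown gen_seq gen_seq :=
  fun m a c _ => GRing.Linear.clone _ _ _ _ (\0 : gen_seq m c -> gen_seq m a) _.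

Definition gen_dgseq : dgseq k :=
  @DGSeq k gen_seq gen_d (fun _ _ _ _ _ _ _ => erefl).

Definition gen_elt : gen_dgseq n (n%:Z - 2) := const_mx 1.

End Generator.

(** The filtration of A by the DG-operads A_n, with A_n obtained from A_(n-1)
    by adjoining mu_n.  Since the maps to A are injective, [fl_del_mu] determines
    the attaching maps. *)
Record A_filtration (k : comPzRingType) (A : A_infinity k) := AFiltration {
  fl_A : nat -> dg_operad k;
  fl_inc : forall n, dg_map (fl_A n) (fl_A n.+1);
  fl_in : forall n, dg_map (fl_A n) A;
  fl_in_inc : forall n m a (x : fl_A n m a),
    fl_in n.+1 m a (fl_inc n m a x) = fl_in n m a x;
  fl_in_inj : forall n m a, injective (fl_in n m a);
  fl_union : forall m a (y : A m a), exists n, exists x : fl_A n m a,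
    fl_in n m a x = y;
  fl_initial0 : is_initial (fl_A 0);
  fl_initial1 : is_initial (fl_A 1);
  fl_del : forall n, hdown (gen_dgseq k n.+2) (fl_A n.+1);
  fl_gen : forall n, hmap (gen_dgseq k n.+2) (fl_A n.+2);
  fl_step : forall n,
    is_twisted_coproduct (fl_del n) (fl_inc n.+1) (fl_gen n);
  fl_gen_mu : forall n,
    fl_in n.+2 _ _ (fl_gen n _ _ (gen_elt k n.+2)) = ai_mu A n.+2;
  fl_del_mu : forall n (a : int) (e : n.+2%:Z - 2 = a + 1),
    fl_in n.+1 _ _ (fl_del n _ e (gen_elt k n.+2)) = dg_d A _ e (ai_mu A n.+2)
}.

(** The canonical strong pseudo-cylinders of the A_n, and their union [cy_lim]. *)
Record A_cylinder (k : comPzRingType) (A : A_infinity k) (F : A_filtration A) :=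
  ACylinder {
  cy_stage : forall n, pseudo_cylinder (fl_A F n);
  cy_stage0 : cy_stage 0 = trivial_cylinder (fl_A F 0);
  cy_stage1 : cy_stage 1 = trivial_cylinder (fl_A F 1);
  cy_inc : forall n, dg_map (cy_stage n) (cy_stage n.+1);
  cy_gen : forall n, hmap (interval (gen_dgseq k n.+2)) (cy_stage n.+2);
  cy_step : forall n, is_induced_cylinder (fl_del F n) (fl_inc F n.+1)
    (fl_gen F n) (cy_inc n.+1) (cy_gen n);
  cy_lim :> pseudo_cylinder A;
  cy_in : forall n, dg_map (cy_stage n) cy_lim;
  cy_in_inc : forall n m a (x : cy_stage n m a),
    cy_in n.+1 m a (cy_inc n m a x) = cy_in n m a x;
  cy_in_inj : forall n m a, injective (cy_in n m a);
  cy_union : forall m a (y : cy_lim m a), exists n, exists x : cy_stage n m a,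
    cy_in n m a x = y;
  cy_i0 : forall n m a (x : fl_A F n m a),
    pc_i0 cy_lim m a (fl_in F n m a x) = cy_in n m a (pc_i0 (cy_stage n) m a x);
  cy_i1 : forall n m a (x : fl_A F n m a),
    pc_i1 cy_lim m a (fl_in F n m a x) = cy_in n m a (pc_i1 (cy_stage n) m a x);
  cy_p : forall n m a (x : cy_stage n m a),
    pc_p cy_lim m a (cy_in n m a x) = fl_in F n m a (pc_p (cy_stage n) m a x);
  cy_h : forall n m (a c : int) (e : c = a + 1) (x : cy_stage n m a),
    pc_h cy_lim m e (cy_in n m a x) = cy_in n m c (pc_h (cy_stage n) m e x)
}.

Section CylinderGenerators.
Variables (k : comPzRingType) (A : A_infinity k) (F : A_filtration A).
Variable (I : A_cylinder F).

Fact sigma_deg (n : nat) : n%:Z - 1 = n%:Z - 2 + 1.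
Proof. by rewrite -addrA. Qed.

Definition i0_mu (n : nat) : I n (n%:Z - 2) := pc_i0 I n _ (ai_mu A n).
Definition i1_mu (n : nat) : I n (n%:Z - 2) := pc_i1 I n _ (ai_mu A n).

(** By convention it is 0 in arities 0 and 1. *)
Definition sigma_mu (n : nat) : I n (n%:Z - 1) :=
  if n is m.+2 return I n (n%:Z - 1) then
    cy_in I m.+2 _ _
      (cy_gen I m _ _ (@int_sigma k (gen_dgseq k m.+2) _ _ _ (sigma_deg m.+2) (gen_elt k m.+2)))
  else 0.

Inductive cyl_gen := Gen_i0 of nat | Gen_i1 of nat | Gen_sigma of nat.

Definition cyl_gen_arity (g : cyl_gen) : nat :=
  match g with Gen_i0 n | Gen_i1 n | Gen_sigma n => n end.

Definition cyl_gen_elt (g : cyl_gen) : helt I :=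
  match g with
  | Gen_i0 n => Helt (i0_mu n)
  | Gen_i1 n => Helt (i1_mu n)
  | Gen_sigma n => Helt (sigma_mu n)
  end.

(** The second sum of the formula for d(sigma mu_n).  The indices j_0, ..., j_s
    are the values of j, and t_1, ..., t_s those of t, shifted by one.  All of
    them are at most n. *)
Definition brace_sum (n : nat) : I n (n%:Z - 2) :=
  \sum_(1 <= s < n.+1)
  \sum_(j : {ffun 'I_s.+1 -> 'I_n.+1})
  \sum_(t : {ffun 'I_s -> 'I_n.+1} |
      [&& [forall i, 2 <= t i], 2 <= s + \sum_i j i
        & j ord0 + \sum_i (t i + j (lift ord0 i)) == n]%N)
    (-1) ^+ (\sum_(i < s) (t i - 1) *
        (j ord0 + \sum_(l < s | l < i) (t l + j (lift ord0 l))))%N *: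
    hcomponent n (n%:Z - 2)
      (hfull (Helt (i0_mu (s + \sum_i j i)%N))
        (nseq (j ord0) (hid I) ++
         flatten [seq Helt (sigma_mu (t i)) :: nseq (j (lift ord0 i)) (hid I)
                 | i <- enum 'I_s])).

Definition sigma_formula (D : hdown I I) : Prop :=
  forall (n : nat) (e : n%:Z - 1 = n%:Z - 2 + 1), (2 <= n)%N ->
  D n _ _ e (sigma_mu n) =
  i0_mu n - i1_mu n
  - stasheff_sum (fun p => Helt (sigma_mu p)) (fun q => Helt (i1_mu q)) n _
  + brace_sum n.

Definition cylinder_differential (D : hdown I I) : Prop :=
  [/\ leibniz D,
      (forall n (a c : int) (e : c = a + 1) (x : A n c),
         D n a c e (pc_i0 I n c x) = pc_i0 I n a (dg_d A n e x)),
      (forall n (a c : int) (e : c = a + 1) (x : A n c),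
         D n a c e (pc_i1 I n c x) = pc_i1 I n a (dg_d A n e x))
    & sigma_formula D].

End CylinderGenerators.

(* Main.v *)
(** By construction [d(sigma mu_n) = i0 mu_n - i1 mu_n - h i1 d mu_n], so everything
    amounts to computing [x = h i1 d mu_n].  Since [i0 p - 1 = d h + h d], an element y
    with [h y = 0], [p y = 0] and [d y = 0] vanishes; x itself is killed by h and p, and
    [d x = i0 d mu_n - i1 d mu_n].  Hence it suffices to check two properties of the
    claimed value w of x.

    First, h kills [sigma mu_p o_j i1 mu_q] and [i0 mu_r(..., sigma mu_t, ...)].  At the
    stage of the filtration where the largest generator involved appears, these are
    values of trees on which every summand of h_{O,V} has a label killed by h or by p,
    and [h_{O,V} z = 0] implies [h z = 0].

    Second, [d w = i0 d mu_n - i1 d mu_n].  After operadic suspension all the signs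
    disappear: with f_1 = id and f_n = sigma mu_n of degree 0, and a = i0 mu, b = i1 mu
    of degree -1, the formula reads d f = a(f, ..., f) - f{b}, and its right-hand side
    is a cycle because d a = a{a}, d b = b{b}, a{a}(f, ..., f) = a(f, ..., a(f, ..., f),
    ..., f), a(f, ..., f){b} = a(f, ..., f{b}, ..., f) and, b being odd, f{b}{b} = f{b{b}}. *)

(* The brace identities involve sums over all arities. They are truncated at a bound [N],
   harmlessly, because the components of arity 0 vanish: inserting operations of positive arity
   never lowers the arity, so only finitely many arities matter in arity n. The same remark allows
   an induction on n: since a_0 = a_1 = 0, only the d f_w with w < n enter the cycle condition. The
   delicate point of the first property is the shape of the trees. The map h_{O,V} of a stage is
   explicit only on trees with labels of the previous stage at odd levels and new generators at even
   levels. When the largest generator of i_0 mu_r(..., sigma mu_t, ...) is one of the sigma mu_t,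
   everything smaller has to be absorbed into the root label. This forces an induction on the stage,
   after a reordering of the insertions up to a scalar. Free generation and uniqueness of the
   differential are independent of the formula. Operad maps are glued along the stages, starting
   from the initial DG-operad, whose universal property concerns DG-maps only and has to be extended
   to arbitrary operad maps. Derivations become operad maps into dual numbers. *)
Require Import Defs.
From HB Require Import structures.
From mathcomp Require Import all_boot all_order all_algebra.
From mathcomp Require Import zify ring.
From Stdlib Require Import IndefiniteDescription.
Set Implicit Arguments.
Unset Strict Implicit.
Unset Printing Implicit Defensive.
Import GRing.Theory.
Local Open Scope ring_scope.

(** * Signs and total compositions *)

Section Signs.
Variable k : comPzRingType.
Implicit Types a b : int.

Lemma eq_sgn a b : odd (absz a) = odd (absz b) -> sgn k a = sgn k b.
Proof. by rewrite /sgn -signr_odd => ->; rewrite signr_odd. Qed.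

Lemma sgnD a b : sgn k (a + b) = sgn k a * sgn k b.
Proof.
rewrite /sgn -signr_odd -[X in _ = X * _]signr_odd -[X in _ = _ * X]signr_odd.
by rewrite -signr_addb; congr (_ ^+ nat_of_bool _); lia.
Qed.

Lemma sgnN a : sgn k (- a) = sgn k a.
Proof. by rewrite /sgn abszN. Qed.

Lemma sgn0 : sgn k 0 = 1.
Proof. by []. Qed.

Lemma sgn1 : sgn k 1 = - 1.
Proof. by rewrite /sgn expr1. Qed.

Lemma sgnN1 : sgn k (- 1) = - 1.
Proof. by rewrite sgnN sgn1. Qed.

Lemma sgn_sqr a : sgn k a * sgn k a = 1.
Proof. by rewrite -sgnD (@eq_sgn _ 0) //; lia. Qed.

Lemma sgn_nat (n : nat) : (-1) ^+ n = sgn k n%:Z.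
Proof. by []. Qed.

End Signs.

Section Components.
Variables (k : comPzRingType) (X : gseq k).

Lemma hcomponentE n a (x : X n a) : hcomponent n a (Helt x) = x.
Proof.
rewrite /hcomponent /=; case: (n =P n) => // e; case: (a =P a) => // f.
by rewrite (eq_irrelevance e erefl) (eq_irrelevance f erefl).
Qed.

Lemma hcomponent_out n a (z : helt X) :
  (h_ar z != n) || (h_deg z != a) -> hcomponent n a z = 0.
Proof.
by rewrite /hcomponent; case: (h_ar z =P n) => // ?; case: (h_deg z =P a).
Qed.

Lemma hcomponentP m b n a u (x y : X m b) :
  hcomponent n a (Helt (u *: x + y)) =
  u *: hcomponent n a (Helt x) + hcomponent n a (Helt y).
Proof.
have [e|ne] := eqVneq m n; last first.
  by rewrite !hcomponent_out ?ne //= scaler0 addr0.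
have [f|nf] := eqVneq b a; last first.
  by rewrite !hcomponent_out ?nf ?orbT //= scaler0 addr0.
by case: n / e; case: a / f; rewrite !hcomponentE.
Qed.

Lemma hcomponentZ m b n a u (x : X m b) :
  hcomponent n a (Helt (u *: x)) = u *: hcomponent n a (Helt x).
Proof.
have [e|ne] := eqVneq m n; last by rewrite !hcomponent_out ?ne //= scaler0.
have [f|nf] := eqVneq b a; last by rewrite !hcomponent_out ?nf ?orbT //= scaler0.
by case: n / e; case: a / f; rewrite !hcomponentE.
Qed.

End Components.

Section TotalComposition.
Variables (k : comPzRingType) (Q : operad k).

(** Zero whenever the composition is not defined, so that sums over arities and
    positions need no side conditions. *)
Definition tcomp p q a b c (f : a + b = c) n i (x : Q p a) (y : Q q b) : Q n c :=
  match (p + q)%N =P n.+1 with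
  | ReflectT e => if (1 <= i <= p)%N then op_comp e f i x y else 0
  | _ => 0
  end.

Lemma tcompE p q a b c (e : (p + q = c.+1)%N) d (f : a + b = d) i
  (x : Q p a) (y : Q q b) :
  (1 <= i <= p)%N -> tcomp f c i x y = op_comp e f i x y.
Proof.
rewrite /tcomp => hi; case: ((p + q)%N =P c.+1) => // e'.
by rewrite hi (eq_irrelevance e' e).
Qed.

Lemma tcomp_out p q a b c (f : a + b = c) n i (x : Q p a) (y : Q q b) :
  (p + q != n.+1)%N || ~~ (1 <= i <= p)%N -> tcomp f n i x y = 0.
Proof.
by rewrite /tcomp; case: ((p + q)%N =P n.+1) => //= _ /negbTE ->.
Qed.

Lemma tcompPl p q a b c (f : a + b = c) n i u (x x' : Q p a) (y : Q q b) :
  tcomp f n i (u *: x + x') y = u *: tcomp f n i x y + tcomp f n i x' y.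
Proof.
rewrite /tcomp; case: ((p + q)%N =P n.+1) => [e|_]; last by rewrite scaler0 addr0.
by case: ifP => hi; [rewrite op_comp_linl | rewrite scaler0 addr0].
Qed.

Lemma tcompPr p q a b c (f : a + b = c) n i u (x : Q p a) (y y' : Q q b) :
  tcomp f n i x (u *: y + y') = u *: tcomp f n i x y + tcomp f n i x y'.
Proof.
rewrite /tcomp; case: ((p + q)%N =P n.+1) => [e|_]; last by rewrite scaler0 addr0.
by case: ifP => hi; [rewrite op_comp_linr | rewrite scaler0 addr0].
Qed.

HB.instance Definition _ p q a b c (f : a + b = c) n i (x : Q p a) :=
  GRing.isLinear.Build k (Q q b) (Q n c) *:%R (tcomp f n i x)
    (fun u y y' => tcompPr f n i u x y y').

Definition tcompr p q a b c (f : a + b = c) n i (y : Q q b) (x : Q p a) :=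
  tcomp f n i x y.

HB.instance Definition _ p q a b c (f : a + b = c) n i (y : Q q b) :=
  GRing.isLinear.Build k (Q p a) (Q n c) *:%R (@tcompr p q a b c f n i y)
    (fun u x x' => tcompPl f n i u x x' y).

Lemma tcomprE p q a b c (f : a + b = c) n i (x : Q p a) (y : Q q b) :
  tcomp f n i x y = tcompr f n i y x.
Proof. by []. Qed.

Lemma tcomp0l p q a b c (f : a + b = c) n i (y : Q q b) :
  tcomp f n i (0 : Q p a) y = 0.
Proof. by rewrite tcomprE linear0. Qed.

Lemma tcompDl p q a b c (f : a + b = c) n i (x x' : Q p a) (y : Q q b) :
  tcomp f n i (x + x') y = tcomp f n i x y + tcomp f n i x' y.
Proof. by rewrite tcomprE linearD. Qed.

Lemma tcompZl p q a b c (f : a + b = c) n i u (x : Q p a) (y : Q q b) :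
  tcomp f n i (u *: x) y = u *: tcomp f n i x y.
Proof. by rewrite tcomprE linearZ. Qed.

Lemma tcomp_sumr p q a b c (f : a + b = c) n i (I : Type) (r : seq I) (P : pred I)
    (x : Q p a) (E : I -> Q q b) :
  tcomp f n i x (\sum_(l <- r | P l) E l) = \sum_(l <- r | P l) tcomp f n i x (E l).
Proof. exact: linear_sum. Qed.

Lemma tcomp_suml p q a b c (f : a + b = c) n i (I : Type) (r : seq I) (P : pred I)
    (E : I -> Q p a) (y : Q q b) :
  tcomp f n i (\sum_(l <- r | P l) E l) y = \sum_(l <- r | P l) tcomp f n i (E l) y.
Proof. exact: (linear_sum (tcompr f n i y)). Qed.

(** Only the intermediate arities and the inner position need hypotheses: if [i] is out of range or
    [n] is not the total arity, both sides are 0. *)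
Lemma tcomp_assoc p q s m l n a b c bc ab abc
  (f1 : b + c = bc) (f2 : a + bc = abc) (f3 : a + b = ab) (f4 : ab + c = abc)
  i j (x : Q p a) (y : Q q b) (z : Q s c) :
  (q + s = m.+1)%N -> (p + q = l.+1)%N -> (1 <= j <= q)%N ->
  tcomp f2 n i x (tcomp f1 m j y z) = tcomp f4 n (i + j - 1)%N (tcomp f3 l i x y) z.
Proof.
move=> e1 e3 hj; have [hi|hi] := boolP (1 <= i <= p)%N; last first.
  by rewrite tcomp_out ?hi ?orbT // [tcomp f3 _ _ _ _]tcomp_out ?hi ?orbT // tcomp0l.
have [e2|ne] := eqVneq (p + m)%N n.+1; last first.
  by rewrite tcomp_out ?ne // tcomp_out //; apply/orP; left; apply/eqP => h; case/eqP: ne; lia.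
have e4 : (l + s = n.+1)%N by lia.
rewrite (tcompE e1) // (tcompE e2) // (tcompE e3) // (tcompE e4); last by lia.
exact: op_assoc.
Qed.

Lemma tcomp_exch p q s l l' n a b c ab ac abc
  (f1 : a + b = ab) (f2 : ab + c = abc) (f3 : a + c = ac) (f4 : ac + b = abc)
  i j (x : Q p a) (y : Q q b) (z : Q s c) :
  (p + q = l.+1)%N -> (p + s = l'.+1)%N -> (1 <= j < i)%N ->
  tcomp f2 n j (tcomp f1 l i x y) z =
  sgn k (b * c) *: tcomp f4 n (i + s - 1)%N (tcomp f3 l' j x z) y.
Proof.
move=> e1 e3 hj; have [hi|hi] := leqP i p; last first.
  rewrite [tcomp f1 _ _ _ _]tcomp_out ?tcomp0l; last by apply/orP; right; lia.
  by rewrite tcomp_out ?scaler0 //; apply/orP; right; lia.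
have [e2|ne] := eqVneq (l + s)%N n.+1; last first.
  by rewrite tcomp_out ?ne // tcomp_out ?scaler0 //; apply/orP; left; apply/eqP => h; case/eqP: ne; lia.
have e4 : (l' + q = n.+1)%N by lia.
rewrite (tcompE e1) ?(tcompE e2) ?(tcompE e3) ?(tcompE e4); try lia.
by apply: op_exch.
Qed.

Lemma tcomp_idl p a (f : 0 + a = a) (x : Q p a) : tcomp f p 1 (op_id Q) x = x.
Proof. by rewrite (tcompE (erefl : (1 + p = p.+1)%N)) // op_idl. Qed.

Lemma op_compZl p q r a b c (e : (p + q = r.+1)%N) (f : a + b = c) i u
  (x : Q p a) (y : Q q b) :
  (1 <= i <= p)%N -> op_comp e f i (u *: x) y = u *: op_comp e f i x y.
Proof. by move=> hi; rewrite -!tcompE // tcompZl. Qed.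

Lemma op_compZr p q r a b c (e : (p + q = r.+1)%N) (f : a + b = c) i u
  (x : Q p a) (y : Q q b) :
  (1 <= i <= p)%N -> op_comp e f i x (u *: y) = u *: op_comp e f i x y.
Proof. by move=> hi; rewrite -!tcompE // linearZ. Qed.

(** The Leibniz rule applied to id = id o_1 id gives D id = D id + D id. *)
Lemma derivation_id (D : hdown Q Q) a (e : 0 = a + 1) :
  leibniz D -> D _ _ _ e (op_id Q) = 0.
Proof.
move=> hD; have := hD _ _ _ _ _ _ _ _ _ (erefl : (1 + 1 = 2)%N) e e e (addr0 0) (addr0 a)
  (add0r a) 1%N (op_id Q) (op_id Q) isT.
rewrite op_idl op_idr // op_idl sgn0 scale1r => h.
by apply: (addrI (D _ _ _ e (op_id Q))); rewrite addr0 -h.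
Qed.

End TotalComposition.

(** * Brace operations *)

Section Insertions.
Variables (k : comPzRingType) (Q : operad k) (N : nat) (F : forall n, Q n 0).
Hypothesis F0 : F 0%N = 0.

(** The part of arity n of the sum, over all [w_1, ..., w_r < N], of the
    insertions of [F w_1, ..., F w_r] into the r consecutive inputs of z that
    start at the i-th one. *)
Fixpoint ins d (r i n m : nat) (z : Q m d) : Q n d :=
  if r is r'.+1 then
    \sum_(w < N) ins r' (i + w)%N n (tcomp (addr0 d) (m + w).-1 i z (F w))
  else hcomponent n d (Helt z).

(** The same sum with one of the inserted elements taken from Y instead of F. *)
Fixpoint mins d e c (g : d + e = c) (Y : forall n, Q n e) (r i n m : nat)
    (z : Q m d) : Q n c :=
  if r is r'.+1 then
    \sum_(w < N) (ins r' (i + w)%N n (tcomp g (m + w).-1 i z (Y w)) +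
                  mins g Y r' (i + w)%N n (tcomp (addr0 d) (m + w).-1 i z (F w)))
  else 0.

Lemma insP d r i n m u (x y : Q m d) :
  ins r i n (u *: x + y) = u *: ins r i n x + ins r i n y.
Proof.
elim: r i m x y => [|r IH] i m x y /=; first exact: hcomponentP.
rewrite scaler_sumr -big_split /=; apply: eq_bigr => w _.
by rewrite tcompPl IH.
Qed.

HB.instance Definition _ d r i n m :=
  GRing.isLinear.Build k (Q m d) (Q n d) *:%R (@ins d r i n m)
    (fun u x y => insP r i n u x y).

Lemma minsP d e c (g : d + e = c) Y r i n m u (x y : Q m d) :
  mins g Y r i n (u *: x + y) = u *: mins g Y r i n x + mins g Y r i n y.
Proof.
elim: r i m x y => [|r IH] i m x y /=; first by rewrite scaler0 addr0.
rewrite scaler_sumr -big_split /=; apply: eq_bigr => w _.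
by rewrite !tcompPl IH linearP /= scalerDr addrACA.
Qed.

HB.instance Definition _ d e c (g : d + e = c) Y r i n m :=
  GRing.isLinear.Build k (Q m d) (Q n c) *:%R (@mins d e c g Y r i n m)
    (fun u x y => minsP g Y r i n u x y).

Lemma minsB d e c (g : d + e = c) Y Y' r i n m (z : Q m d) :
  mins g (fun t => Y t - Y' t) r i n z = mins g Y r i n z - mins g Y' r i n z.
Proof.
elim: r i m z => [|r IH] i m z /=; first by rewrite subr0.
rewrite -sumrB; apply: eq_bigr => w _.
by rewrite !linearB /= IH opprD addrACA.
Qed.

(** Since [F 0] vanishes, each insertion keeps or raises the arity. *)
Lemma ins_high d r i n m (z : Q m d) : (n < m)%N -> ins r i n z = 0.
Proof.
elim: r i m z => [|r IH] i m z h /=.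
  by rewrite hcomponent_out //=; apply/orP; left; lia.
rewrite big1 // => w _; case: (posnP w) => [w0|wp]; last by apply: IH; lia.
by rewrite w0 F0 !linear0.
Qed.

(** The insertions of [F] never lower the arity, so a component [Y w] contributes to arity n only if
    w + m <= n + 1. With m >= 2 this leaves w < n. *)
Lemma mins_high d e c (g : d + e = c) (Y : forall n, Q n e) r i n m (z : Q m d) :
  (forall w, (w + m <= n.+1)%N -> Y w = 0) -> mins g Y r i n z = 0.
Proof.
elim: r i m z => [|r IH] i m z h //=.
rewrite big1 // => w _; rewrite [X in X + _](_ : _ = 0) ?add0r.
  case: (posnP w) => [w0|wp]; first by rewrite w0 F0 !linear0.
  by apply: IH => t ht; apply: h; lia.
have [hw|hw] := leqP (w + m)%N n.+1; first by rewrite h // !linear0.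
by rewrite ins_high //; lia.
Qed.

Lemma mins_ext d e c (g : d + e = c) (Y Y' : forall n, Q n e) r i n m (z : Q m d) :
  (forall w, (w + m <= n.+1)%N -> Y w = Y' w) ->
  mins g Y r i n z = mins g Y' r i n z.
Proof.
move=> h; apply/eqP; rewrite -subr_eq0 -minsB mins_high // => w hw.
by rewrite h ?subrr.
Qed.

(** The position [pos] lies to the left of all insertions, so y can be inserted first; there is no
    sign because [F] has degree 0. At most one l contributes, the one with l + q = n + 1. *)
Lemma ins_tcomp d e c (g : d + e = c) r j n m q pos (x : Q m d) (y : Q q e) :
  (1 <= pos < j)%N -> (1 <= m)%N -> (n.+1 < N)%N ->
  \sum_(l < N) tcomp g n pos (ins r j l x) y =
  ins r (j + q - 1)%N n (tcomp g (m + q).-1 pos x y).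
Proof.
move=> hp + hN; elim: r j m x hp => [|r IH] j m x hp hm /=.
  have [e1|ne] := eqVneq (m + q)%N n.+1.
    have hmN : (m < N)%N by lia.
    rewrite (bigD1 (Ordinal hmN)) //= hcomponentE big1 ?addr0.
      by have -> : (m + q).-1 = n; [lia | rewrite hcomponentE].
    move=> l nl; rewrite hcomponent_out ?tcomp0l //=; apply/orP; left.
    by apply: contraNneq nl => h; apply/eqP/val_inj.
  rewrite big1.
    rewrite hcomponent_out //=; apply/orP; left; lia.
  move=> l _; have [hl|hl] := eqVneq (m : nat) l.
    by apply: tcomp_out; rewrite -hl ne.
  by rewrite hcomponent_out ?hl //= tcomp0l.
under eq_bigr do rewrite tcomp_suml.
rewrite exchange_big /=; apply: eq_bigr => w _.
case: (posnP w) => [w0|wp].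
  by rewrite w0 F0 !linear0 big1 // => l _; rewrite linear0 tcomp0l.
rewrite IH; try lia.
have -> : ((m + w).-1 + q).-1 = ((m + q).-1 + w).-1 by lia.
have -> : (j + w + q - 1)%N = (j + q - 1 + w)%N by lia.
rewrite (@tcomp_exch _ _ m w q _ (m + q).-1 _ d 0 e _ c _ _ _ g (addr0 c)) ?mul0r ?sgn0 ?scale1r //; lia.
Qed.

(** In the usual notation, [brace], [subst] and [msubst] are X{Y}, X(F, ..., F) and
    the sum of the X(F, ..., F, Y, F, ..., F), each with all arities summed. *)
Definition brace d e c (g : d + e = c) (X : forall n, Q n d) (Y : forall n, Q n e)
    n : Q n c :=
  \sum_(p < N) \sum_(q < N) \sum_(1 <= i < p.+1) tcomp g n i (X p) (Y q).

Definition subst d (X : forall n, Q n d) n : Q n d :=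
  \sum_(r < N) ins r 1 n (X r).

Definition msubst d e c (g : d + e = c) (X : forall n, Q n d)
    (Y : forall n, Q n e) n : Q n c :=
  \sum_(r < N) mins g Y r 1 n (X r).

(** By [m.+1 = i + r] the insertions fill all inputs of z from i on. Positions of b inside the first
    inserted [F w] give the term with F{b} there; the positions beyond it are handled by induction
    on r. *)
Lemma sum_tcomp_ins d e c (g : d + e = c) (b : forall n, Q n e) r i n m (z : Q m d) :
  b 0%N = 0 -> m.+1 = (i + r)%N -> (1 <= i)%N -> (n.+1 < N)%N ->
  \sum_(l < N) \sum_(q < N) \sum_(i <= pos < l.+1) tcomp g n pos (ins r i l z) (b q) =
  mins g (brace (add0r e) F b) r i n z.
Proof.
move=> b0 + + hN; elim: r i m z => [|r IH] i m z hm hi /=.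
  rewrite big1 // => l _; rewrite big1 // => q _; rewrite big_nat big1 // => p hp.
  by rewrite hcomponent_out ?tcomp0l //=; apply/orP; left; lia.
have split_sum (l q : 'I_N) :
  \sum_(i <= pos < l.+1)
     tcomp g n pos (\sum_(w < N) ins r (i + w)%N l (tcomp (addr0 d) (m + w).-1 i z (F w))) (b q) =
  \sum_(w < N)
    \sum_(i <= pos < i + w)
      tcomp g n pos (ins r (i + w)%N l (tcomp (addr0 d) (m + w).-1 i z (F w))) (b q) +
  \sum_(w < N)
    \sum_(i + w <= pos < l.+1)
      tcomp g n pos (ins r (i + w)%N l (tcomp (addr0 d) (m + w).-1 i z (F w))) (b q).
  under eq_bigr do rewrite tcomp_suml.
  rewrite exchange_big -big_split /=; apply: eq_bigr => w _.
  (* The range of positions splits at the end of the inserted [F w]. If l is too small for that, the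
     element composed with [b q] is already 0. *)
  have [hl|hl] := leqP (i + w) l.+1; first by rewrite -big_cat_nat //; lia.
  have -> : ins r (i + w)%N l (tcomp (addr0 d) (m + w).-1 i z (F w)) = 0.
    by apply: ins_high; lia.
  by rewrite !big1 ?addr0 // => pos _; rewrite tcomp0l.
under eq_bigr do (under eq_bigr do rewrite split_sum; rewrite big_split /=).
rewrite !big_split /=; congr (_ + _); last first.
  under eq_bigr do rewrite exchange_big /=.
  rewrite exchange_big /=; apply: eq_bigr => w _.
  have [w0|wp] := posnP w.
    rewrite w0 F0 !linear0 big1 // => l _; rewrite big1 // => q _.
    by rewrite big1 // => pos _; rewrite linear0 tcomp0l.
  by rewrite -IH //; lia.
rewrite /brace.
under eq_bigr do rewrite exchange_big /=.
rewrite exchange_big /=.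
under [RHS]eq_bigr do rewrite linear_sum linear_sum /=.
rewrite [RHS]exchange_big /=; apply: eq_bigr => w _.
under [RHS]eq_bigr do rewrite linear_sum linear_sum /=.
rewrite exchange_big [RHS]exchange_big /=; apply: eq_bigr => q _.
under [RHS]eq_bigr do rewrite linear_sum linear_sum /=.
have [w0|wp] := posnP w.
  rewrite w0 addn0 F0 !big1 // => [t _|l _]; last by rewrite big_geq.
  by rewrite big_geq.
have [q0|qp] := posnP q.
  rewrite q0 b0 !big1 // => [t _|l _]; first by rewrite big1 // => j _; rewrite !linear0.
  by rewrite big1 // => pos _; rewrite linear0.
(* Both sides reduce to this sum: on the left the arity l, on the right the arity t of F w o_j b_q,
   is forced, namely t = w + q - 1. *)
pose f j := ins r (i + (w + q).-1)%N n (tcomp g (m + (w + q).-1).-1 i z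
  (tcomp (add0r e) (w + q).-1 j (F w) (b q))).
transitivity (\sum_(1 <= j < w.+1) f j).
  rewrite exchange_big /= (_ : i = 1 + i.-1)%N; last by lia.
  rewrite big_addn (_ : (1 + i.-1 + w - i.-1 = w.+1)%N); last by lia.
  rewrite big_nat [RHS]big_nat; apply: eq_bigr => j hj.
  rewrite ins_tcomp; try lia.
  rewrite /f (@tcomp_assoc _ _ m w q _ (m + w).-1 _ d 0 e _ d _ _ _ (addr0 d) g); try lia.
  rewrite (_ : ((m + w).-1 + q).-1 = (m + (w + q).-1).-1); last by lia.
  have e1 : (1 + i.-1 = i)%N by lia.
  have e2 : (j + i.-1 = i + j - 1)%N by lia.
  have e3 : (i + w + q - 1 = i + (w + q).-1)%N by lia.
  rewrite e1.
  rewrite e2.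
  by rewrite e3.
have [ht|ht] := ltnP (w + q).-1 N.
  rewrite [RHS](bigD1 (Ordinal ht)) //= [X in _ = _ + X]big1 ?addr0 // => t nt.
  rewrite big1 // => j _; rewrite [tcomp (add0r e) _ _ _ _]tcomp_out ?linear0 ?linear0 //.
  apply/orP; left; apply: contraNneq nt => h; apply/eqP/val_inj => /=; lia.
rewrite !big1 // => [t _|j _].
  rewrite big1 // => j _; rewrite [tcomp (add0r e) _ _ _ _]tcomp_out ?linear0 ?linear0 //.
  by apply/orP; left; apply/eqP => h; have := ltn_ord t; lia.
by apply: ins_high; lia.
Qed.

(** By [u.+1 = l + q] the first q insertions exhaust the inputs of y, and the other r go to inputs
    of z to the right of y. Only sequential associativity is involved, hence no sign. *)
Lemma ins_ins d e c (g : d + e = c) q r i l n m u (z : Q m d) (y : Q u e) :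
  u.+1 = (l + q)%N -> (1 <= l)%N -> (1 <= i <= m)%N -> (n < N)%N ->
  ins (q + r) (i + l - 1)%N n (tcomp g (m + u).-1 i z y) =
  \sum_(t < N) ins r (i + t)%N n (tcomp g (m + t).-1 i z (ins q l t y)).
Proof.
move=> + + hi hN; elim: q l u y => [|q IH] l u y hu hl /=.
  have [hN'|hN'] := ltnP u N; last first.
    rewrite ins_high; last by lia.
    rewrite big1 // => t _; rewrite hcomponent_out ?linear0 ?linear0 //=.
    by apply/orP; left; apply/eqP => h; have := ltn_ord t; lia.
  rewrite (bigD1 (Ordinal hN')) //= hcomponentE big1 ?addr0.
    by rewrite (_ : i + l - 1 = i + u)%N //; lia.
  move=> t nt; rewrite hcomponent_out ?linear0 ?linear0 //=.
  by apply/orP; left; apply: contraNneq nt => h; apply/eqP/val_inj.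
under [RHS]eq_bigr do rewrite linear_sum linear_sum /=.
rewrite exchange_big /=; apply: eq_bigr => w _.
have [w0|wp] := posnP w.
  rewrite w0 F0 !linear0 big1 // => t _.
  by rewrite !linear0.
rewrite -IH; try lia.
rewrite (@tcomp_assoc _ _ m u w (u + w).-1 (m + u).-1 _ d e 0 e c c _ _ g (addr0 c)); try lia.
rewrite (_ : (m + (u + w).-1).-1 = ((m + u).-1 + w).-1); last by lia.
by rewrite (_ : i + (l + w) - 1 = i + l - 1 + w)%N //; lia.
Qed.

(** If b sits at the first of the r inputs, the insertions into b and those after it separate by
    [ins_ins]. Otherwise that input receives some [F w], which commutes with b without sign, and
    induction applies. *)
Lemma ins_brace d e c (g : d + e = c) (b : forall n, Q n e) r i n m (z : Q m d) :
  b 0%N = 0 -> m.+1 = (i + r)%N -> (1 <= i)%N -> (n < N)%N ->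
  \sum_(q < N) \sum_(i <= j < i + r)
     ins (r + q).-1 i n (tcomp g (m + q).-1 j z (b q)) =
  mins g (subst b) r i n z.
Proof.
move=> b0 + + hN; elim: r i m z => [|r IH] i m z hm hi /=.
  by rewrite big1 // => q _; rewrite addn0 big_geq.
under eq_bigr => q _ do rewrite big_ltn ?addnS ?ltnS ?leq_addr //.
rewrite !big_split /=; congr (_ + _).
  under [RHS]eq_bigr do rewrite linear_sum linear_sum /=.
  rewrite [RHS]exchange_big /=; apply: eq_bigr => q _.
  rewrite -ins_ins //; try lia.
  by rewrite addnC addnK.
transitivity (\sum_(q < N) \sum_(i.+1 <= j < (i + r).+1) \sum_(w < N)
   ins (r + q).-1 (i + w)%N n (tcomp g ((m + w).-1 + q).-1 (j + w - 1)
     (tcomp (addr0 d) (m + w).-1 i z (F w)) (b q))).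
  apply: eq_bigr => q _; rewrite big_nat [RHS]big_nat; apply: eq_bigr => j hj.
  rewrite (_ : (r + q)%N = (r + q).-1.+1); last by lia.
  rewrite /=; apply: eq_bigr => w _.
  have [w0|wp] := posnP w; first by rewrite w0 F0 !linear0 tcomp0l linear0.
  rewrite (@tcomp_exch _ _ m q w _ (m + w).-1 _ d e 0 c d c _ _ (addr0 d) g); try lia.
  rewrite mulr0 sgn0 scale1r.
  by rewrite (_ : ((m + q).-1 + w).-1 = ((m + w).-1 + q).-1) //; lia.
under [LHS]eq_bigr do rewrite exchange_big /=.
rewrite exchange_big /=; apply: eq_bigr => w _.
have [w0|wp] := posnP w.
  rewrite w0 F0 !linear0 big1 // => q _; rewrite big1 // => j _.
  by rewrite tcomp0l linear0.
rewrite -IH; try lia.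
apply: eq_bigr => q _.
(* Both ranges of j are shifted to start at 2, which is possible since i and w are positive. *)
have [v hv] : exists v, (i + w = 2 + v)%N by exists (i + w - 2)%N; lia.
rewrite hv (_ : i.+1 = 2 + i.-1)%N; last by lia.
rewrite !big_addn (_ : (i + r).+1 - i.-1 = 2 + v + r - v)%N; last by lia.
apply: eq_bigr => j _.
by have -> : (j + i.-1 + w - 1 = j + v)%N by lia.
Qed.

Lemma brace_subst d e c (g : d + e = c) (a : forall n, Q n d) (b : forall n, Q n e) n :
  a 0%N = 0 -> b 0%N = 0 -> (n < N)%N ->
  subst (brace g a b) n = msubst g a (subst b) n.
Proof.
move=> a0 b0 hN; rewrite /subst /msubst /brace.
under eq_bigr do rewrite linear_sum.
rewrite exchange_big /=; apply: eq_bigr => p _.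
have [p0|pp] := posnP p.
  rewrite p0 a0 linear0 big1 // => r _; rewrite big1 ?linear0 // => q _.
  by rewrite big_geq.
rewrite -[RHS]ins_brace //.
under eq_bigr do rewrite linear_sum.
rewrite exchange_big /=; apply: eq_bigr => q _.
have [hq|hq] := ltnP (p + q).-1 N; last first.
  rewrite !big1 // => [j _|r _]; first by rewrite ins_high //; lia.
  rewrite linear_sum big1 // => j _ /=; rewrite tcomp_out ?linear0 //.
  by apply/orP; left; apply/eqP => h; have := ltn_ord r; lia.
rewrite (bigD1 (Ordinal hq)) //= [X in _ + X]big1 ?addr0.
  by rewrite linear_sum add1n.
move=> r nr; rewrite linear_sum big1 // => j _ /=.
rewrite tcomp_out ?linear0 //; apply/orP; left.
by apply: contraNneq nr => h; apply/eqP/val_inj => /=; lia.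
Qed.

Lemma subst_brace d e c (g : d + e = c) (a : forall n, Q n d) (b : forall n, Q n e) n :
  b 0%N = 0 -> (n.+1 < N)%N ->
  brace g (subst a) b n = msubst g a (brace (add0r e) F b) n.
Proof.
move=> b0 hN; rewrite /brace /msubst /subst.
under [RHS]eq_bigr => r _ do rewrite -[mins _ _ _ _ _ _]sum_tcomp_ins //.
rewrite [RHS]exchange_big /=; apply: eq_bigr => l _.
rewrite [RHS]exchange_big /=; apply: eq_bigr => q _.
rewrite [RHS]exchange_big /=; apply: eq_bigr => pos _.
by rewrite tcomp_suml.
Qed.

End Insertions.

(** * Two successive insertions of an odd operation *)

Section BraceAssociativity.
Variables (k : comPzRingType) (Q : operad k) (N : nat).

Lemma sum_triangle (V : nmodType) (f : nat -> nat -> V) p :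
  \sum_(1 <= i < p.+1) \sum_(1 <= j < i) f i j =
  \sum_(1 <= i < p.+1) \sum_(i.+1 <= j < p.+1) f j i.
Proof.
transitivity (\sum_(1 <= i < p.+1) \sum_(1 <= j < p.+1) if (j < i)%N then f i j else 0).
  rewrite big_nat [RHS]big_nat; apply: eq_bigr => i hi.
  by rewrite -big_mkcond [LHS](big_nat_widen _ _ p.+1) //; lia.
rewrite exchange_big /= big_nat [RHS]big_nat; apply: eq_bigr => i hi.
by rewrite -big_mkcond [RHS](big_nat_widenl _ 1).
Qed.

(** Terms with the two copies of b at different inputs of X occur in both orders, with opposite
    signs since b is odd. They cancel in pairs, so 2 need not be invertible; the nested insertions
    remain. *)
Lemma brace_brace_odd d e c e2 c2 (g : d + e = c) (g2 : c + e = c2) (h : e + e = e2)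
    (g3 : d + e2 = c2) (X : forall n, Q n d) (b : forall n, Q n e) n :
  odd (absz e) -> X 0%N = 0 -> b 0%N = 0 -> (n.+1 < N)%N ->
  brace N g2 (brace N g X b) b n = brace N g3 X (brace N h b b) n.
Proof.
move=> he X0 b0 hN.
pose T p q s i pos := tcomp g2 n pos (tcomp g (p + q).-1 i (X p) (b q)) (b s).
have expand : brace N g2 (brace N g X b) b n = \sum_(p < N) \sum_(q < N) \sum_(s < N)
    \sum_(1 <= i < p.+1) \sum_(1 <= pos < (p + q).-1.+1) T p q s i pos.
  rewrite /brace.
  transitivity (\sum_(p < N) \sum_(q < N) \sum_(s < N) \sum_(1 <= i < p.+1)
      \sum_(l < N) \sum_(1 <= pos < l.+1)
        tcomp g2 n pos (tcomp g l i (X p) (b q)) (b s)).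
    under [LHS]eq_bigr => l _ do
      (under eq_bigr => s _ do
        (under eq_bigr => pos _ do
           (rewrite tcomp_suml;
            under eq_bigr => p _ do
             (rewrite tcomp_suml; under eq_bigr => q _ do rewrite tcomp_suml);
            idtac);
        rewrite exchange_big /=);
      rewrite exchange_big /=).
    rewrite exchange_big /=; apply: eq_bigr => p _.
    under [LHS]eq_bigr do under eq_bigr do rewrite exchange_big /=.
    under [LHS]eq_bigr do rewrite exchange_big /=.
    rewrite exchange_big /=; apply: eq_bigr => q _.
    rewrite exchange_big /=; apply: eq_bigr => s _.
    under [LHS]eq_bigr do rewrite exchange_big /=.
    by rewrite exchange_big.
  apply: eq_bigr => p _; apply: eq_bigr => q _; apply: eq_bigr => s _.
  rewrite big_nat [RHS]big_nat; apply: eq_bigr => i hi; rewrite /T.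
  have [hl|hl] := ltnP (p + q).-1 N.
    rewrite (bigD1 (Ordinal hl)) //= [X in _ + X]big1 ?addr0 // => l nl.
    rewrite big1 // => pos _.
    rewrite [tcomp g _ _ _ _]tcomp_out ?tcomp0l //; apply/orP; left.
    by apply: contraNneq nl => h'; apply/eqP/val_inj => /=; lia.
  rewrite !big1 // => [pos _|l _].
    by apply: tcomp_out; apply/orP; left; lia.
  rewrite big1 // => pos _; rewrite [tcomp g _ _ _ _]tcomp_out ?tcomp0l //.
  by apply/orP; left; apply/eqP => h'; have := ltn_ord l; lia.
(* [C] collects the terms whose second insertion is at an input of X to the right of the first.
   Second insertions to the left give [- C p s q] by the exchange law, so these two families cancel
   after summation over q and s. *)
pose C p q s := \sum_(1 <= i < p.+1) \sum_(i.+1 <= pos < p.+1) T p q s i (pos + q - 1)%N.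
have split3 (p q s : nat) : (0 < p)%N -> (0 < q)%N -> (0 < s)%N ->
    \sum_(1 <= i < p.+1) \sum_(1 <= pos < (p + q).-1.+1) T p q s i pos =
    - C p s q + C p q s +
    \sum_(1 <= i < p.+1) \sum_(1 <= j < q.+1)
      tcomp g3 n i (X p) (tcomp h (q + s).-1 j (b q) (b s)).
  move=> pp qp sp.
  have -> : - C p s q = \sum_(1 <= i < p.+1) \sum_(1 <= pos < i) T p q s i pos.
    rewrite /C.
    rewrite sum_triangle -sumrN big_nat [RHS]big_nat; apply: eq_bigr => i hi.
    rewrite -sumrN big_nat [RHS]big_nat; apply: eq_bigr => pos hp; rewrite /T.
    rewrite [RHS](@tcomp_exch _ _ p q s _ (p + s).-1 _ d e e c c c2 _ _ g g2); try lia.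
    rewrite (@eq_sgn k (e * e) 1) ?sgn1 ?scaleN1r //; last by rewrite abszM oddM he.
  rewrite /C -!big_split /= big_nat [RHS]big_nat; apply: eq_bigr => i hi.
  rewrite (big_cat_nat (n := i)) /=; try lia.
  rewrite (big_cat_nat (n := (i + q)%N) (m := i)) /=; try lia.
  rewrite -addrA; congr (_ + _); rewrite addrC; congr (_ + _).
    rewrite (_ : i + q = i.+1 + q.-1)%N; last by lia.
    rewrite big_addn (_ : (p + q).-1.+1 - q.-1 = p.+1)%N; last by lia.
    by rewrite big_nat [RHS]big_nat; apply: eq_bigr => pos hp; congr T; lia.
  rewrite -{1}(subnK (_ : 0 < i)%N); last by lia.
  rewrite (_ : i - 1 + 1 = 1 + i.-1)%N; last by lia.
  rewrite big_addn (_ : i + q - i.-1 = q.+1)%N; last by lia.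
  rewrite big_nat [RHS]big_nat; apply: eq_bigr => j hj; rewrite /T.
  rewrite (@tcomp_assoc _ _ p q s _ (p + q).-1 _ d e e e2 c c2 h g3 g g2); try lia.
  by rewrite (_ : j + i.-1 = i + j - 1)%N //; lia.
have T0 (p q s : nat) i pos : (p == 0)%N || (q == 0)%N || (s == 0)%N -> T p q s i pos = 0.
  by case/orP => [/orP[]|] /eqP h0; rewrite /T h0 ?X0 ?b0 ?tcomp0l ?linear0 ?tcomp0l.
(* The positivity hypotheses are removed: if an arity is 0, all terms vanish. *)
have {}split3 (p q s : nat) :
    \sum_(1 <= i < p.+1) \sum_(1 <= pos < (p + q).-1.+1) T p q s i pos =
    - C p s q + C p q s +
    \sum_(1 <= i < p.+1) \sum_(1 <= j < q.+1)
      tcomp g3 n i (X p) (tcomp h (q + s).-1 j (b q) (b s)).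
  have [h0|h0] := boolP ((p == 0) || (q == 0) || (s == 0))%N; last first.
    by rewrite -split3 //; move: h0; rewrite !negb_or; lia.
  rewrite /C ![\sum_(_ <= _ < _) \sum_(_ <= _ < _) T _ _ _ _ _]big1.
  - rewrite oppr0 !add0r big1 // => i _; rewrite big1 // => j _.
    by case/orP: h0 => [/orP[]|] /eqP h0; rewrite h0 ?X0 ?b0 ?tcomp0l ?linear0 ?linear0.
  - by move=> i _; rewrite big1 // => pos _; rewrite T0.
  - by move=> i _; rewrite big1 // => pos _; rewrite T0 // orbAC.
  - by move=> i _; rewrite big1 // => pos _; rewrite T0.
rewrite expand /brace; apply: eq_bigr => p _.
under eq_bigr do under eq_bigr do rewrite split3.
under eq_bigr do rewrite !big_split /=.
rewrite !big_split /= [X in X + _ + _]exchange_big /=.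
under eq_bigr do rewrite sumrN.
rewrite sumrN addNr add0r.
under [RHS]eq_bigr do under eq_bigr do rewrite tcomp_sumr.
under [RHS]eq_bigr do rewrite exchange_big /=.
rewrite [RHS]exchange_big /=; apply: eq_bigr => q _.
under [RHS]eq_bigr do under eq_bigr do rewrite tcomp_sumr.
under [RHS]eq_bigr do rewrite exchange_big /=.
rewrite [RHS]exchange_big /=; apply: eq_bigr => s _.
under [RHS]eq_bigr do under eq_bigr do rewrite tcomp_sumr.
rewrite [RHS]exchange_big /=; apply: eq_bigr => i _.
rewrite [RHS]exchange_big /=; apply: eq_bigr => j _.
have [p0|pp] := posnP p.
  by rewrite p0 X0 tcomp0l big1 // => t _; rewrite tcomp0l.
have [q0|qp] := posnP q.
  by rewrite q0 b0 tcomp0l linear0 big1 // => t _; rewrite tcomp0l linear0.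
have [ht|ht] := ltnP (q + s).-1 N.
  rewrite (bigD1 (Ordinal ht)) //= [X in _ + X]big1 ?addr0 // => t nt.
  rewrite [tcomp h _ _ _ _]tcomp_out ?linear0 //; apply/orP; left.
  by apply: contraNneq nt => h'; apply/eqP/val_inj => /=; lia.
rewrite big1 => [|t _]; first by apply: tcomp_out; apply/orP; left; lia.
rewrite [tcomp h _ _ _ _]tcomp_out ?linear0 //; apply/orP; left.
by apply/eqP => h'; have := ltn_ord t; lia.
Qed.

End BraceAssociativity.

(** * Differentials of insertions and the obstruction cycle *)

Section Leibniz.
Variables (k : comPzRingType) (Q : dg_operad k).

Lemma leibniz_tcomp (a a' b b' c c' : int)
    (ea : a' = a + 1) (eb : b' = b + 1) (ec : c' = c + 1)
    (f : a' + b' = c') (fl : a + b' = c) (fr : a' + b = c) p q n i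
    (x : Q p a') (y : Q q b') :
  dg_d Q n ec (tcomp f n i x y) =
  tcomp fl n i (dg_d Q p ea x) y + sgn k a' *: tcomp fr n i x (dg_d Q q eb y).
Proof.
have [hi|hi] := boolP (1 <= i <= p)%N; last first.
  by rewrite !tcomp_out ?hi ?orbT // linear0 scaler0 addr0.
have [e|ne] := eqVneq (p + q)%N n.+1; last first.
  by rewrite !tcomp_out ?ne // linear0 scaler0 addr0.
by rewrite !(tcompE e) // (dg_leibniz e ea eb ec f fl fr).
Qed.

Lemma d_hcomponent (d d' : int) (e : d' = d + 1) n m (x : Q m d') :
  dg_d Q n e (hcomponent n d' (Helt x)) = hcomponent n d (Helt (dg_d Q m e x)).
Proof.
have [h|ne] := eqVneq m n; last by rewrite !hcomponent_out ?ne // linear0.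
by case: n / h; rewrite !hcomponentE.
Qed.

Lemma leibniz_ins N (F : forall n, Q n 0) (d d' : int) (e : d' = d + 1)
    (e0 : 0 = - 1 + 1 :> int) (g : d' + - 1 = d) r i n m (z : Q m d') :
  dg_d Q n e (ins N F r i n z) =
  ins N F r i n (dg_d Q m e z) +
  sgn k d' *: mins N F g (fun w => dg_d Q w e0 (F w)) r i n z.
Proof.
elim: r i m z => [|r IH] i m z /=; first by rewrite scaler0 addr0 d_hcomponent.
rewrite linear_sum scaler_sumr -big_split /=; apply: eq_bigr => w _.
rewrite IH (leibniz_tcomp e e0 e (addr0 d') (addr0 d) g) linearD linearZ /=.
by rewrite -addrA scalerDr.
Qed.

(** Both a and b are A-infinity structures in suspended degrees, and F is the
    beginning of an infinity-morphism between them; the obstruction to extending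
    F is a cycle. *)
Lemma obstruction_cycle N (F : forall n, Q n 0) (a b : forall n, Q n (- 1))
    (e0 : 0 = - 1 + 1 :> int) (e1 : - 1 = - 2 + 1 :> int) (g : - 1 + - 1 = - 2 :> int) n :
  (n.+1 < N)%N -> F 0%N = 0 -> a 0%N = 0 -> a 1%N = 0 -> b 0%N = 0 -> b 1%N = 0 ->
  (forall m, (m.+1 < N)%N -> dg_d Q m e1 (a m) = brace N g a a m) ->
  (forall m, (m.+1 < N)%N -> dg_d Q m e1 (b m) = brace N g b b m) ->
  (forall m, (m < n)%N ->
     dg_d Q m e0 (F m) = subst N F a m - brace N (add0r (- 1)) F b m) ->
  dg_d Q n e1 (subst N F a n - brace N (add0r (- 1)) F b n) = 0.
Proof.
move=> hN F0 a0 a1 b0 b1 da db dF; set f0 := add0r (- 1).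
have f2 : 0 + - 2 = - 2 :> int by [].
pose dF' m := dg_d Q m e0 (F m); pose G m := subst N F a m - brace N f0 F b m.
have dsubst : dg_d Q n e1 (subst N F a n) = msubst N F g a (brace N f0 F b) n.
  transitivity (subst N F (brace N g a a) n - msubst N F g a dF' n).
    rewrite /subst /msubst linear_sum -sumrB; apply: eq_bigr => r _.
    rewrite (leibniz_ins _ _ e1 e0 g) sgnN1 scaleN1r; congr (_ - _).
    have [hr|hr] := ltnP r.+1 N; first by rewrite da.
    by rewrite !ins_high //; lia.
  (* Here a_0 = a_1 = 0 is essential: an operation of arity at least 2 receives some [dF' w] only
     with w < n, where the hypothesis on d F applies. *)
  have -> : msubst N F g a dF' n = msubst N F g a G n.
    apply: eq_bigr => -[[|[|r]] hr] _ //; first by rewrite a1 !linear0.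
    by apply: mins_ext => // w hw; apply: dF; move: hw => /=; lia.
  rewrite brace_subst //; last by lia.
  rewrite [X in _ - X](_ : _ = msubst N F g a (subst N F a) n -
     msubst N F g a (brace N f0 F b) n); first by rewrite opprB addrC subrK.
  by rewrite /msubst -sumrB; apply: eq_bigr => r _; rewrite -minsB.
have dbrace : dg_d Q n e1 (brace N f0 F b n) =
    brace N g (subst N F a) b n - brace N g (brace N f0 F b) b n +
    brace N f2 F (brace N g b b) n.
  rewrite -sumrB -big_split linear_sum; apply: eq_bigr => p _ /=.
  rewrite -sumrB -big_split linear_sum; apply: eq_bigr => q _ /=.
  rewrite -sumrB -big_split linear_sum; apply: eq_bigr => i _ /=.
  rewrite (leibniz_tcomp e0 e1 e1 f0 g f2) sgn0 scale1r; congr (_ + _); last first.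
    have [hq|hq] := ltnP q.+1 N; first by rewrite db.
    by rewrite !tcomp_out //; lia.
  have [hp|hp] := ltnP p n; first by rewrite dF // !tcomprE linearB.
  case: q => [[|[|q]] hq] /=; rewrite ?b0 ?b1 ?linear0 ?addr0 //.
  by rewrite !tcomp_out ?subrr //; apply/orP; left; lia.
rewrite linearB /= dsubst dbrace subst_brace // (brace_brace_odd f0 g g f2) //.
  by rewrite subrK subrr.
Qed.

End Leibniz.

(** * Operadic suspension *)

Section Suspension.
Variable k : comPzRingType.

(** In suspended degrees all mu_n have degree -1, and all sigma mu_n have degree 0, as does the
    identity. *)
Definition susp_seq (X : gseq k) : gseq k := fun n a => X n (a + n%:Z - 1).

(** The sign of the i-th composition of operations of arities p and q, the second
    one of suspended degree b. *)
Definition susp_sgn (p q : nat) (b : int) (i : nat) : k :=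
  sgn k ((p%:Z - 1) * b + (i%:Z - 1) * (q%:Z - 1)).

Lemma susp_deg_comp (p q r : nat) (a b c : int) : (p + q = r.+1)%N -> a + b = c ->
  (a + p%:Z - 1) + (b + q%:Z - 1) = c + r%:Z - 1.
Proof. by move=> e <-; lia. Qed.

Lemma susp_deg_d (n : nat) (a c : int) : c = a + 1 -> c + n%:Z - 1 = a + n%:Z - 1 + 1.
Proof. by move=> ->; lia. Qed.

Section Operad.
Variable O : operad k.

Definition susp_comp (p q r : nat) (a b c : int) (e : (p + q = r.+1)%N) (f : a + b = c)
    (i : nat) (x : susp_seq O p a) (y : susp_seq O q b) : susp_seq O r c :=
  susp_sgn p q b i *: op_comp e (susp_deg_comp e f) i x y.

Lemma susp_linl p q r a b c (e : (p + q = r.+1)%N) (f : a + b = c) i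
  (u : k) (x x' : susp_seq O p a) (y : susp_seq O q b) : (1 <= i <= p)%N ->
  susp_comp e f i (u *: x + x') y = u *: susp_comp e f i x y + susp_comp e f i x' y.
Proof.
by move=> hi; rewrite /susp_comp op_comp_linl // scalerDr !scalerA mulrC.
Qed.

Lemma susp_linr p q r a b c (e : (p + q = r.+1)%N) (f : a + b = c) i
  (u : k) (x : susp_seq O p a) (y y' : susp_seq O q b) : (1 <= i <= p)%N ->
  susp_comp e f i x (u *: y + y') = u *: susp_comp e f i x y + susp_comp e f i x y'.
Proof.
by move=> hi; rewrite /susp_comp op_comp_linr // scalerDr !scalerA mulrC.
Qed.

Lemma susp_assoc p q s qs pq r a b c bc ab abc
    (e1 : (q + s = qs.+1)%N) (f1 : b + c = bc)
    (e2 : (p + qs = r.+1)%N) (f2 : a + bc = abc)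
    (e3 : (p + q = pq.+1)%N) (f3 : a + b = ab)
    (e4 : (pq + s = r.+1)%N) (f4 : ab + c = abc)
    i j (x : susp_seq O p a) (y : susp_seq O q b) (z : susp_seq O s c) :
    (1 <= i <= p)%N -> (1 <= j <= q)%N ->
    susp_comp e2 f2 i x (susp_comp e1 f1 j y z) =
    susp_comp e4 f4 (i + j - 1)%N (susp_comp e3 f3 i x y) z.
Proof.
move=> hi hj; rewrite /susp_comp op_compZr // op_compZl; last by lia.
rewrite !scalerA (op_assoc _ _ _ _ e3 (susp_deg_comp e3 f3) e4 (susp_deg_comp e4 f4)) //.
congr (_ *: _); rewrite /susp_sgn -!sgnD; congr (sgn k _).
have -> : bc = b + c by [].
have -> : qs%:Z = q%:Z + s%:Z - 1 by lia.
have -> : pq%:Z = p%:Z + q%:Z - 1 by lia.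
have -> : (i + j - 1)%N%:Z = i%:Z + j%:Z - 1 by lia.
by ring.
Qed.

Lemma susp_exch p q s pq ps r a b c ab ac abc
    (e1 : (p + q = pq.+1)%N) (f1 : a + b = ab)
    (e2 : (pq + s = r.+1)%N) (f2 : ab + c = abc)
    (e3 : (p + s = ps.+1)%N) (f3 : a + c = ac)
    (e4 : (ps + q = r.+1)%N) (f4 : ac + b = abc)
    i j (x : susp_seq O p a) (y : susp_seq O q b) (z : susp_seq O s c) :
    (1 <= j < i)%N -> (i <= p)%N ->
    susp_comp e2 f2 j (susp_comp e1 f1 i x y) z =
    sgn k (b * c) *: susp_comp e4 f4 (i + s - 1)%N (susp_comp e3 f3 j x z) y.
Proof.
move=> hj hi; rewrite /susp_comp !op_compZl; try lia.
rewrite (op_exch _ _ _ _ e3 (susp_deg_comp e3 f3) e4 (susp_deg_comp e4 f4)) //.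
rewrite !scalerA; congr (_ *: _); rewrite /susp_sgn -!sgnD.
have -> : pq%:Z = p%:Z + q%:Z - 1 by lia.
have -> : ps%:Z = p%:Z + s%:Z - 1 by lia.
have -> : (i + s - 1)%N%:Z = i%:Z + s%:Z - 1 by lia.
set B := b * c.
rewrite (_ : (b + q%:Z - 1) * (c + s%:Z - 1) =
  B + (q%:Z - 1) * c + b * (s%:Z - 1) + (q%:Z - 1) * (s%:Z - 1)); last by rewrite /B; ring.
set E := (X in sgn k X = _); set E' := (X in _ = sgn k X).
(* The two exponents differ by twice an integer. *)
have -> : E = E' + ((q%:Z - 1) * c + (q%:Z - 1) * c) by rewrite /E /E'; ring.
by rewrite sgnD [sgn k (_ + _ *  _)]sgnD sgn_sqr mulr1.
Qed.

Lemma susp_idl n a (e : (1 + n = n.+1)%N) (f : 0 + a = a) (x : susp_seq O n a) :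
  susp_comp e f 1%N (op_id O : susp_seq O 1 0) x = x.
Proof.
have s1 : susp_sgn 1 n a 1 = 1 by rewrite /susp_sgn !subrr !mul0r addr0.
rewrite /susp_comp s1 scale1r.
exact: (op_idl e (susp_deg_comp e f : 0 + (a + n%:Z - 1) = a + n%:Z - 1) x).
Qed.

Lemma susp_idr n a (e : (n + 1 = n.+1)%N) (f : a + 0 = a) i (x : susp_seq O n a) :
  (1 <= i <= n)%N -> susp_comp e f i x (op_id O : susp_seq O 1 0) = x.
Proof.
have s1 : susp_sgn n 1 0 i = 1 by rewrite /susp_sgn subrr !mulr0 addr0.
move=> hi; rewrite /susp_comp s1 scale1r.
exact: (op_idr e (susp_deg_comp e f : a + n%:Z - 1 + 0 = a + n%:Z - 1) x hi).
Qed.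

Definition susp_operad : operad k :=
  Operad susp_linl susp_linr susp_assoc susp_exch susp_idl susp_idr.

End Operad.

Section DGOperad.
Variable O : dg_operad k.

Definition susp_d : hdown (susp_operad O) (susp_operad O) :=
  fun n a c e => dg_d O n (susp_deg_d n e).

Lemma susp_dd n (a b c : int) (e : b = a + 1) (e' : c = b + 1)
  (x : susp_operad O n c) : susp_d n e (susp_d n e' x) = 0.
Proof. exact: dg_dd. Qed.

Lemma susp_leibniz : leibniz susp_d.
Proof.
move=> p q r a a' b b' c c' e ea eb ec f fl fr i x y hi.
rewrite /susp_d /= /susp_comp linearZ /=.
rewrite (dg_leibniz e (susp_deg_d p ea) (susp_deg_d q eb) (susp_deg_d r ec)
  (susp_deg_comp e f) (susp_deg_comp e fl) (susp_deg_comp e fr)) //.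
rewrite scalerDr !scalerA; congr (_ + _ *: _).
rewrite /susp_sgn -!sgnD eb.
rewrite (_ : _ + (a' + _ - 1) = a' + ((p%:Z - 1) * b + (i%:Z - 1) * (q%:Z - 1)) +
  ((p%:Z - 1) + (p%:Z - 1))); last by ring.
by rewrite sgnD [sgn k (_ - 1 + _)]sgnD sgn_sqr mulr1.
Qed.

Definition susp_dg_operad : dg_operad k := DGOperad susp_dd susp_leibniz.

End DGOperad.
End Suspension.

(** * Composition of packed homogeneous elements *)

Section HomogeneousComposition.
Variables (k : comPzRingType) (O : operad k).
Implicit Types z y : helt O.

Lemma hcompE p q r a b c (e : (p + q = r.+1)%N) (f : a + b = c) i
  (x : O p a) (y : O q b) :
  (1 <= i <= p)%N -> hcomp (Helt x) i (Helt y) = Helt (op_comp e f i x y).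
Proof.
case: p x e => [|p] x e hi; first by lia.
have hr : r = (p + q)%N by move: e; rewrite addSn => -[].
subst r c; rewrite /hcomp /=; congr Helt; congr (op_comp _ _ _ _ _).
exact: eq_irrelevance.
Qed.

Lemma hcomp_ar z i y : (0 < h_ar z)%N -> h_ar (hcomp z i y) = (h_ar z + h_ar y).-1.
Proof. by case: z => -[|p]. Qed.

Lemma hcomp_deg z i y : (0 < h_ar z)%N -> h_deg (hcomp z i y) = h_deg z + h_deg y.
Proof. by case: z => -[|p]. Qed.

Lemma hcomp_idr z i : (1 <= i <= h_ar z)%N -> hcomp z i (hid O) = z.
Proof.
case: z => p a x hi.
by rewrite (hcompE (addn1 p) (addr0 a)) // op_idr.
Qed.

Lemma hcomp_idl z : hcomp (hid O) 1 z = z.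
Proof.
case: z => p a x.
by rewrite (hcompE (erefl : (1 + p = p.+1)%N) (add0r a)) // op_idl.
Qed.

Lemma hcomp_from_ids z i j ys :
  (1 <= i)%N -> (i + j <= (h_ar z).+1)%N ->
  hcomp_from i z (nseq j (hid O) ++ ys) = hcomp_from (i + j) z ys.
Proof.
elim: j i => [|j IH] i hi hj /=; first by rewrite addn0.
rewrite hcomp_idr; last by lia.
by rewrite IH ?addnS ?addSn ?addn0 //; lia.
Qed.

Lemma hfull_ids z : hfull z (nseq (h_ar z) (hid O)) = z.
Proof. by rewrite /hfull -[nseq _ _]cats0 hcomp_from_ids. Qed.

Lemma hcomp_from_ar z i ys : (1 <= i)%N -> (i + size ys <= (h_ar z).+1)%N ->
  (h_ar (hcomp_from i z ys) + size ys = h_ar z + sumn [seq h_ar y | y <- ys])%N.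
Proof.
elim: ys i z => [|y ys IH] i z hi hs //=; move: hs => /= hs.
have h0 : (0 < h_ar z)%N by lia.
have h1 := hcomp_ar i y h0.
have := IH (i + h_ar y)%N (hcomp z i y); rewrite h1 => h2.
by rewrite addnS h2; lia.
Qed.

Definition susp_component a n z : susp_operad O n a := hcomponent n (a + n%:Z - 1) z.

Lemma tcomp_susp_component a b c (f : a + b = c) n i m q z y :
  h_ar z = m -> h_ar y = q -> h_deg z = a + m%:Z - 1 -> h_deg y = b + q%:Z - 1 ->
  (1 <= i <= m)%N ->
  tcomp f n i (susp_component a m z) (susp_component b q y) =
  susp_sgn k m q b i *: susp_component c n (hcomp z i y).
Proof.
case: z => m' d x; case: y => q' d' y; rewrite [h_ar _]/= => em; rewrite [h_ar _]/= => eq.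
rewrite [h_deg _]/= => hd; rewrite [h_deg _]/= => hd' hi; subst d d' m' q'.
rewrite /susp_component !hcomponentE.
have [e|ne] := eqVneq (m + q)%N n.+1; last first.
  rewrite tcomp_out ?ne // hcomponent_out ?scaler0 //.
  apply/orP; left; apply: contraNneq ne => h; apply/eqP.
  by move: (@hcomp_ar (Helt x) i (Helt y)); rewrite h /=; lia.
rewrite (tcompE e) // (@hcompE _ _ _ _ _ _ e (susp_deg_comp e f) i x y) //.
by rewrite hcomponentE.
Qed.

End HomogeneousComposition.

(** * The brace sum as a sum over words *)

Section Words.

Fixpoint words (N r : nat) : seq (seq nat) :=
  if r is r'.+1 then [seq w :: u | w <- iota 1 N.-1, u <- words N r'] else [:: [::]].

Lemma mem_words N r u :
  (u \in words N r) = (size u == r) && all (fun w => 1 <= w < N)%N u.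
Proof.
elim: r u => [|r IH] u /=; first by rewrite inE; case: u.
apply/allpairsP/idP => [[[w v] /= [hw hv ->]]|].
  by move: hw hv; rewrite mem_iota IH /= eqSS => hw /andP[-> ->]; rewrite /= !andbT; lia.
case: u => // w u; rewrite eqSS /= => /and3P[hs hw ha].
by exists (w, u); split; rewrite ?mem_iota ?IH ?hs //=; lia.
Qed.

Lemma words_uniq N r : uniq (words N r).
Proof.
elim: r => [|r IH] //=; apply: allpairs_uniq; rewrite ?iota_uniq //.
by move=> [w u] [w' u'] _ _ /= [-> ->].
Qed.

(** The exponent of the sign of the composition of operations of arities u, of
    suspended degree 0, into consecutive inputs starting at the i-th one. *)
Fixpoint word_sgn (i : nat) (u : seq nat) : nat :=
  if u is w :: u' then ((w - 1) * (i - 1) + word_sgn (i + w) u')%N else 0%N.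

Lemma word_sgn_ones i j u : word_sgn i (nseq j 1%N ++ u) = word_sgn (i + j) u.
Proof.
elim: j i => [|j IH] i /=; first by rewrite addn0.
by rewrite subnn mul0n add0n IH addn1 addSnnS.
Qed.

(** The index (j_0, t_1, j_1, ..., t_s, j_s) of the brace sum is encoded as a word of
    arities in which the letter 1 stands for an identity. *)
Definition block_word (j0 : nat) (L : seq (nat * nat)) : seq nat :=
  nseq j0 1%N ++ flatten [seq p.1 :: nseq p.2 1%N | p <- L].

(** The letters that are at least 2 mark where the blocks begin, so they can be read off the
    word. *)
Lemma block_word_inj j0 j0' L L' :
  all (fun p => 2 <= p.1)%N L -> all (fun p => 2 <= p.1)%N L' ->
  block_word j0 L = block_word j0' L' -> j0 = j0' /\ L = L'.
Proof.
rewrite /block_word; elim: L L' j0 j0' => [|[t j] L IH] [|[t' j'] L'] /= j0 j0'.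
- by move=> _ _; rewrite !cats0 => /(congr1 size); rewrite !size_nseq.
- move=> _ /andP[ht _]; elim: j0 j0' => [|j0 IHj] [|j0'] //= [] //.
  + by move=> h; rewrite -h in ht.
  + by move=> h; have [] := IHj _ h.
- move=> /andP[ht _] _; elim: j0 j0' => [|j0 IHj] [|j0'] //= [] //.
  + by move=> h; rewrite h in ht.
  + by move=> h; have [] := IHj _ h.
- move=> /andP[ht hL] /andP[ht' hL']; elim: j0 j0' => [|j0 IHj] [|j0'] //= [].
  + by move=> <- /(IH _ _ _ hL hL') [-> ->].
  + by move=> h; rewrite h in ht.
  + by move=> h; rewrite -h in ht'.
  + by move=> h; have [-> ->] := IHj _ h.
Qed.

Lemma block_word_surj u : all (leq 1) u ->
  exists j0 L, all (fun p => 2 <= p.1)%N L /\ u = block_word j0 L.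
Proof.
elim: u => [|w u IH] /=; first by exists 0%N, [::].
case/andP=> hw /IH [j0 [L [hL ->]]].
have [->|w1] := eqVneq w 1%N; first by exists j0.+1, L.
by exists 0%N, ((w, j0) :: L); split=> //=; rewrite hL andbT; lia.
Qed.

Lemma sumn_block_word j0 L :
  sumn (block_word j0 L) = (j0 + sumn [seq p.1 + p.2 | p <- L])%N.
Proof.
rewrite /block_word sumn_cat sumn_nseq mul1n; congr addn.
by elim: L => [|p L IH] //=; rewrite sumn_cat sumn_nseq mul1n IH addnA.
Qed.

Lemma size_block_word j0 L :
  size (block_word j0 L) = (size L + (j0 + sumn [seq p.2 | p <- L]))%N.
Proof.
rewrite /block_word size_cat size_nseq addnCA; congr addn.
by elim: L => [|p L IH] //=; rewrite size_cat size_nseq IH; lia.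
Qed.

(** A letter 1 contributes 0 to the exponent, so only the t_x remain, each multiplied by the total
    arity that precedes it: this is the exponent of the stated formula. *)
Lemma word_sgn_blocks s (t j : 'I_s -> nat) i :
  (1 <= i)%N ->
  word_sgn i (flatten [seq t x :: nseq (j x) 1%N | x <- enum 'I_s]) =
  (\sum_(x < s) (t x - 1) * ((i - 1) + \sum_(l < s | l < x) (t l + j l)))%N.
Proof.
elim: s t j i => [|s IH] t j i hi; first by rewrite enum_ord0 big_ord0.
rewrite enum_ordSl /= word_sgn_ones -map_comp big_ord_recl /=.
congr addn; first by rewrite big_pred0 ?addn0.
have := IH (t \o lift ord0) (j \o lift ord0) (i + t ord0 + j ord0)%N.
rewrite /= => ->; last by lia.
apply: eq_bigr => x _; congr muln.
rewrite [in RHS]big_mkcond big_ord_recl /= -big_mkcond /=.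
by rewrite [in RHS](eq_bigl (fun l : 'I_s => (l < x)%N)) //; lia.
Qed.

End Words.

(** * Indices of the brace sum and words of arities *)

Section BlockSums.

Definition short_words (N : nat) : seq (seq nat) :=
  flatten [seq words N r | r <- iota 0 N].

Lemma mem_short_words N u :
  (u \in short_words N) = (size u < N)%N && all (fun w => 1 <= w < N)%N u.
Proof.
apply/flatten_mapP/idP => [[r hr]|/andP[hs ha]].
  by rewrite mem_words => /andP[/eqP -> ->]; rewrite andbT; move: hr; rewrite mem_iota.
by exists (size u); rewrite ?mem_iota // mem_words eqxx.
Qed.

Lemma short_words_uniq N : uniq (short_words N).
Proof.
rewrite /short_words.
have -> : flatten [seq words N r | r <- iota 0 N] =
    [seq u | r <- iota 0 N, u <- words N r].
  by congr flatten; apply: eq_map => r; rewrite map_id.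
(* The length of a word recovers r, so lists with different r do not overlap. *)
have tag_size p : p \in [seq existT (fun=> seq nat) r u | r <- iota 0 N, u <- words N r] ->
    tag p = size (tagged p).
  by case/allpairsPdep => r [u [_ hu ->]] /=; move: hu; rewrite mem_words => /andP[/eqP <-].
apply: allpairs_uniq_dep => [|r _|]; rewrite ?iota_uniq ?words_uniq //.
move=> [r u] [r' u'] /tag_size /= -> /tag_size /= -> h.
by rewrite [u]h.
Qed.

(** The types of j and t depend on s; one dependent sum of finite types turns the triple sum into a
    sum over a single index. *)
Definition block_index (n : nat) :=
  {s : 'I_n.+1 & ({ffun 'I_s.+1 -> 'I_n.+1} * {ffun 'I_s -> 'I_n.+1})%type}.

Definition block_cond n s (j : {ffun 'I_s.+1 -> 'I_n.+1}) (t : {ffun 'I_s -> 'I_n.+1}) :=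
  [&& [forall i, 2 <= t i], 2 <= s + \sum_i j i
    & j ord0 + \sum_i (t i + j (lift ord0 i)) == n]%N.

Definition block_list n s (j : {ffun 'I_s.+1 -> 'I_n.+1}) (t : {ffun 'I_s -> 'I_n.+1}) :
    seq (nat * nat) :=
  [seq (nat_of_ord (t i), nat_of_ord (j (lift ord0 i))) | i <- enum 'I_s].

Lemma size_block_list n s (j : {ffun 'I_s.+1 -> 'I_n.+1}) (t : {ffun 'I_s -> 'I_n.+1}) :
  size (block_list j t) = s.
Proof. by rewrite size_map size_enum_ord. Qed.

Definition ffun_word n s (j : {ffun 'I_s.+1 -> 'I_n.+1}) (t : {ffun 'I_s -> 'I_n.+1}) :=
  block_word (j ord0) (block_list j t).

Definition index_word n (x : block_index n) : seq nat :=
  ffun_word (tagged x).1 (tagged x).2.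

(** Excluding the word of ones amounts to s >= 1 in the brace sum; that word yields the linear term
    i_0 mu_n. *)
Definition mixed_word n u := [&& 2 <= size u, sumn u == n & u != nseq n 1]%N.

Lemma size_ffun_word n s (j : {ffun 'I_s.+1 -> 'I_n.+1}) (t : {ffun 'I_s -> 'I_n.+1}) :
  size (ffun_word j t) = (s + \sum_i j i)%N.
Proof.
rewrite size_block_word size_block_list -map_comp sumnE big_map big_enum /=.
by rewrite big_ord_recl.
Qed.

Lemma sumn_ffun_word n s (j : {ffun 'I_s.+1 -> 'I_n.+1}) (t : {ffun 'I_s -> 'I_n.+1}) :
  sumn (ffun_word j t) = (j ord0 + \sum_i (t i + j (lift ord0 i)))%N.
Proof. by rewrite sumn_block_word -map_comp sumnE big_map big_enum. Qed.

Lemma block_list_ge2 n s (j : {ffun 'I_s.+1 -> 'I_n.+1}) (t : {ffun 'I_s -> 'I_n.+1}) :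
  [forall i, 2 <= t i]%N -> all (fun p => 2 <= p.1)%N (block_list j t).
Proof. by move/forallP => h; apply/allP => p /mapP[i _ ->] /=. Qed.

Lemma index_word_inj n : {in [pred x : block_index n | block_cond (tagged x).1 (tagged x).2] &,
  injective (@index_word n)}.
Proof.
move=> [s [j t]] [s' [j' t']]; rewrite !inE /index_word /=.
move=> /and3P[/(@block_list_ge2 _ _ j) h _ _] /and3P[/(@block_list_ge2 _ _ j') h' _ _].
move=> /(block_word_inj h h') [/val_inj e0 eL].
have es : s = s' by move/(congr1 size): eL; rewrite !size_block_list; exact: val_inj.
subst s'; move/eq_in_map: eL => eL.
have -> : t = t'.
  by apply/ffunP => i; have /(_ (mem_enum _ i)) [/val_inj] := eL i.
suff -> : j = j' by [].
apply/ffunP => i; have [->|[i' ->]] : i = ord0 \/ exists i', i = lift ord0 i'.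
- by case: (unliftP ord0 i) => [i' ->|->]; [right; exists i' | left].
- exact: e0.
- by have /(_ (mem_enum _ i')) [_ /val_inj] := eL i'.
Qed.

Lemma leq_sumn (u : seq nat) w : w \in u -> (w <= sumn u)%N.
Proof.
elim: u => //= x u IH; rewrite inE => /predU1P[->|/IH h]; first exact: leq_addr.
exact: leq_trans h (leq_addl _ _).
Qed.

Lemma size_leq_sumn (u : seq nat) : all (leq 1) u -> (size u <= sumn u)%N.
Proof. by elim: u => //= x u IH /andP[hx /IH]; lia. Qed.

Lemma mixed_words_index n :
  perm_eq [seq index_word x | x <- enum [pred x : block_index n |
      (0 < tag x)%N && block_cond (tagged x).1 (tagged x).2]]
    [seq u <- short_words n.+2 | mixed_word n u].
Proof.
apply: uniq_perm.
- rewrite map_inj_in_uniq ?enum_uniq // => x y; rewrite !mem_enum !inE.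
  by move=> /andP[_ hx] /andP[_ hy]; exact: index_word_inj.
- exact/filter_uniq/short_words_uniq.
move=> u; rewrite mem_filter mem_short_words; apply/mapP/idP.
  move=> [[s [j t]]]; rewrite mem_enum inE /= => /andP[s0 /and3P[ht hs hn]] ->.
  rewrite /index_word /mixed_word /= size_ffun_word sumn_ffun_word hs hn /=.
  have all1 : all (leq 1) (ffun_word j t).
    rewrite /ffun_word /block_word all_cat all_nseq orbT /=; apply/allP => w.
    case/flatten_mapP => p /mapP[i _ ->] /=; rewrite inE mem_nseq.
    by case/orP => [/eqP ->|/andP[_ /eqP ->] //]; have := forallP ht i; lia.
  have hsum := size_leq_sumn all1.
  rewrite size_ffun_word sumn_ffun_word (eqP hn) in hsum.
  have -> : (s + \sum_i j i < n.+2)%N by exact: leq_trans hsum (leqnSn _).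
  apply/and3P; split=> //.
    (* Since s > 0, the word contains the letter t_1, which is at least 2. *)
    apply/eqP => e; have hi : (val (t (Ordinal s0))) \in ffun_word j t.
      rewrite /ffun_word /block_word mem_cat; apply/orP; right.
      apply/flatten_mapP; exists (val (t (Ordinal s0)), val (j (lift ord0 (Ordinal s0)))).
        by apply/mapP; exists (Ordinal s0) => //; rewrite mem_enum.
      by rewrite inE eqxx.
    move: hi; rewrite e mem_nseq => /andP[_ /eqP hi].
    by have := forallP ht (Ordinal s0); rewrite hi.
  apply/allP => w hw; rewrite (allP all1) //=.
  by have := leq_sumn hw; rewrite sumn_ffun_word (eqP hn); lia.
case/andP=> /and3P[h2 /eqP hn hne] /andP[_ ha].
have all1 : all (leq 1) u by apply: sub_all ha => w /andP[].
have [j0 [L [hL eu]]] := block_word_surj all1.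
have L0 : (0 < size L)%N.
  move: eu; case: (L) => // eu; case/eqP: hne; rewrite eu /block_word /= cats0.
  by congr nseq; rewrite -hn eu /block_word cats0 sumn_nseq mul1n.
have hsz : (size u <= n)%N by rewrite -hn; exact: size_leq_sumn.
have hs : (size L < n.+1)%N by move: hsz; rewrite eu size_block_word; lia.
have bnd : {in u, forall w, w <= n}%N by move=> w /leq_sumn; rewrite hn.
pose s := Ordinal hs.
(* All letters and block lengths are at most n because the word has sum n, so [inord] never takes
   its default value. *)
pose j := [ffun i : 'I_(size L).+1 => inord (nth 0%N (j0 :: unzip2 L) i) : 'I_n.+1].
pose t := [ffun i : 'I_(size L) => inord (nth 0%N (unzip1 L) i) : 'I_n.+1].
have hj0 : j ord0 = j0 :> nat.
  rewrite ffunE inordK //= ltnS -hn eu sumn_block_word; exact: leq_addr.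
have hjt : block_list j t = L.
  apply: (@eq_from_nth _ (0, 0)%N); rewrite size_block_list // => i hi.
  have hp : nth (0, 0)%N L i \in L by exact: mem_nth.
  have hb : ((nth (0, 0)%N L i).1 + (nth (0,0)%N L i).2 <= n)%N.
    rewrite -hn eu sumn_block_word; apply: leq_trans (leq_addl _ _); apply: leq_sumn.
    by apply/mapP; exists (nth (0, 0)%N L i).
  rewrite (nth_map (Ordinal hi)) ?size_enum_ord // !ffunE.
  rewrite lift0 /= nth_enum_ord //.
  rewrite /unzip1 /unzip2 !(nth_map (0, 0)%N) // !inordK; try lia.
  by case: (nth _ _ _).
exists (Tagged (fun s : 'I_n.+1 => ({ffun 'I_s.+1 -> 'I_n.+1} * {ffun 'I_s -> 'I_n.+1})%type)
  (i := s) (j, t)); last by rewrite /index_word /= /ffun_word hj0 hjt.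
have eu' : ffun_word j t = u by rewrite /ffun_word hj0 hjt.
rewrite mem_enum inE /=; apply/andP; split.
  exact: L0.
rewrite /block_cond -(size_ffun_word j t) -(sumn_ffun_word j t) eu' h2 hn eqxx !andbT.
apply/forallP => i; rewrite ffunE inordK.
  by rewrite /unzip1 (nth_map (0, 0)%N) //; apply: (allP hL); apply: mem_nth.
rewrite ltnS; apply: bnd; rewrite eu /block_word mem_cat; apply/orP; right.
apply/flatten_mapP; exists (nth (0, 0)%N L i); first exact: mem_nth.
by rewrite /unzip1 (nth_map (0, 0)%N) // inE eqxx.
Qed.

Lemma sum_blocks (V : nmodType) (G : seq nat -> V) n :
  \sum_(1 <= s < n.+1) \sum_(j : {ffun 'I_s.+1 -> 'I_n.+1})
     \sum_(t : {ffun 'I_s -> 'I_n.+1} | block_cond j t) G (ffun_word j t) =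
  \sum_(u <- short_words n.+2 | mixed_word n u) G u.
Proof.
rewrite -[RHS]big_filter -(perm_big _ (mixed_words_index n)) big_map big_enum /=.
rewrite (big_nat_widenl _ 0) // big_mkord.
under [LHS]eq_bigr do rewrite pair_big_dep /=.
by rewrite (sig_big_dep _ (fun s x => block_cond x.1 x.2)
  (fun s x => G (ffun_word x.1 x.2))).
Qed.

End BlockSums.

Lemma sum_iota_ord (V : nmodType) (G : nat -> V) N :
  \sum_(i <- iota 0 N) G i = \sum_(i < N) G i.
Proof. by rewrite -[in LHS](subn0 N) -/(index_iota 0 N) big_mkord. Qed.

(** * Substituting an infinity-morphism into an operation *)

Section WordSums.
Variables (k : comPzRingType) (O : operad k).
Variables (a : forall n, O n (n%:Z - 2)) (s : forall n, O n (n%:Z - 1)).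

(** The identity stands for the component of arity 1 of the infinity-morphism with
    higher components s. *)
Definition letter (w : nat) : helt O := if w == 1%N then hid O else Helt (s w).

Lemma letter_ar w : h_ar (letter w) = w.
Proof. by rewrite /letter; case: eqP. Qed.

Lemma letter_deg w : h_deg (letter w) = w%:Z - 1.
Proof. by rewrite /letter; case: eqP => [->|]. Qed.

Definition susp_letter (w : nat) : susp_operad O w 0 :=
  if (0 < w)%N then susp_component 0 w (letter w) else 0.

Lemma susp_sgn_letter m w i : (1 <= w)%N -> (1 <= i)%N ->
  susp_sgn k m w 0 i = (-1) ^+ ((w - 1) * (i - 1))%N.
Proof.
move=> hw hi; rewrite sgn_nat /susp_sgn mulr0 add0r; congr (sgn k _).
by rewrite PoszM mulrC; congr (_ * _); lia.
Qed.

(** The signs of the brace sum originate here: inserting a letter w, of suspended degree 0, at input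
    i costs (w - 1)(i - 1), and these exponents accumulate to [word_sgn]. *)
Lemma ins_words N r i n m d (z : helt O) :
  h_ar z = m -> h_deg z = d + m%:Z - 1 -> (1 <= i)%N -> (i + r <= m.+1)%N ->
  ins N susp_letter r i n (susp_component d m z) =
  \sum_(u <- words N r)
    (-1) ^+ word_sgn i u *: susp_component d n (hcomp_from i z (map letter u)).
Proof.
elim: r i m z => [|r IH] i m z hm hd hi hr /=.
  rewrite big_seq1 expr0 scale1r; case: z hm hd => m' d' x; rewrite /= => hm hd.
  subst m d'; rewrite /susp_component [in LHS]hcomponentE.
  have [e|ne] := eqVneq m' n; last by rewrite !hcomponent_out //= ne.
  by subst n; rewrite !hcomponentE.
rewrite big_allpairs_dep.
case: N IH => [|N] IH; first by rewrite big_ord0 big_nil.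
(* The term of arity 0 vanishes, which is why words only have positive letters. *)
rewrite big_ord_recl [susp_letter _]/= linear0 linear0 add0r.
rewrite (iotaDl 1 0 N) big_map sum_iota_ord.
apply: eq_bigr => w _; rewrite lift0 [susp_letter _]/=.
rewrite (@tcomp_susp_component _ _ _ _ _ (addr0 d) _ i m _ z _ hm (letter_ar _) hd);
  [|by rewrite letter_deg; lia|by lia].
rewrite linearZ susp_sgn_letter // /=.
rewrite IH ?letter_ar; try lia.
- rewrite scaler_sumr; apply: eq_bigr => u _.
  by rewrite scalerA -exprD add1n.
- by rewrite hcomp_ar ?hm ?letter_ar //; lia.
- rewrite hcomp_deg ?hm ?hd ?letter_deg; lia.
Qed.

Definition word_elt (u : seq nat) : helt O :=
  hfull (Helt (a (size u))) (map letter u).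

Lemma word_elt_ar u : all (leq 1) u -> h_ar (word_elt u) = sumn u.
Proof.
move=> hu; rewrite /word_elt /hfull.
have := @hcomp_from_ar _ O (Helt (a (size u))) 1 (map letter u) isT.
rewrite size_map /= -map_comp (eq_map letter_ar) map_id => /(_ (leqnn _)).
by rewrite addnC => /addnI.
Qed.

Definition susp_op (n : nat) : susp_operad O n (- 1) :=
  if (2 <= n)%N then susp_component (- 1) n (Helt (a n)) else 0.

(** This is [brace_sum] for [a = i0_mu] and [s = sigma_mu]. *)
Definition brace_gen (n : nat) : O n (n%:Z - 2) :=
  \sum_(1 <= r < n.+1)
  \sum_(j : {ffun 'I_r.+1 -> 'I_n.+1})
  \sum_(t : {ffun 'I_r -> 'I_n.+1} |
      [&& [forall i, 2 <= t i], 2 <= r + \sum_i j i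
        & j ord0 + \sum_i (t i + j (lift ord0 i)) == n]%N)
    (-1) ^+ (\sum_(i < r) (t i - 1) *
        (j ord0 + \sum_(l < r | l < i) (t l + j (lift ord0 l))))%N *:
    hcomponent n (n%:Z - 2)
      (hfull (Helt (a (r + \sum_i j i)%N))
        (nseq (j ord0) (hid O) ++
         flatten [seq Helt (s (t i)) :: nseq (j (lift ord0 i)) (hid O)
                 | i <- enum 'I_r])).

Lemma short_words_widen n N : (n.+2 <= N)%N ->
  perm_eq [seq u <- short_words N | mixed_word n u]
          [seq u <- short_words n.+2 | mixed_word n u].
Proof.
move=> hN; apply: uniq_perm; rewrite ?filter_uniq ?short_words_uniq // => u.
rewrite !mem_filter !mem_short_words; case hm: (mixed_word n u) => //=.
case/and3P: hm => _ /eqP hn _; apply/andP/andP => -[hs ha].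
  have all1 : all (leq 1) u by apply: sub_all ha => w /andP[].
  split; first by have := size_leq_sumn all1; rewrite hn; lia.
  apply/allP => w hw; have := leq_sumn hw; have := allP all1 w hw; rewrite hn; lia.
by split; [lia | apply: sub_all ha => w; lia].
Qed.

Lemma brace_gen_words n N : (n.+2 <= N)%N ->
  brace_gen n = \sum_(u <- short_words N | mixed_word n u)
    (-1) ^+ word_sgn 1 u *: hcomponent n (n%:Z - 2) (word_elt u).
Proof.
move=> hN; rewrite -[RHS]big_filter (perm_big _ (short_words_widen hN)) big_filter.
rewrite -sum_blocks; apply: eq_bigr => r _; apply: eq_bigr => j _.
apply: eq_bigr => t /and3P[/forallP ht _ _].
congr (_ ^+ _ *: hcomponent _ _ _).
  rewrite /ffun_word /block_word word_sgn_ones /block_list -map_comp.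
  rewrite (word_sgn_blocks (fun i => nat_of_ord (t i)) (fun i => nat_of_ord (j (lift ord0 i)))) //.
  by apply: eq_bigr => i _; rewrite addKn.
rewrite /word_elt size_ffun_word; congr hfull.
rewrite /ffun_word /block_word map_cat map_nseq map_flatten -!map_comp.
congr (_ ++ flatten _); apply: eq_map => i /=.
by rewrite map_nseq /letter [t i == 1%N :> nat]gtn_eqF //; exact: ht.
Qed.

Lemma word_elt_ones n : word_elt (nseq n 1%N) = Helt (a n).
Proof.
rewrite /word_elt map_nseq size_nseq.
exact: (hfull_ids (Helt (a n))).
Qed.

Lemma word_sgn_nseq1 i n : word_sgn i (nseq n 1%N) = 0%N.
Proof. by rewrite -[nseq n 1%N]cats0 word_sgn_ones. Qed.

(** Words whose sum is not n have the wrong arity. The word of n ones contributes [a n], and the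
    remaining words are the mixed ones. *)
Lemma subst_words n N : (2 <= n)%N -> (n.+2 <= N)%N ->
  subst N susp_letter susp_op n = susp_component (- 1) n (Helt (a n + brace_gen n)).
Proof.
move=> h2 hN; rewrite /subst.
pose G u : susp_operad O n (-1) :=
  (-1) ^+ word_sgn 1 u *: susp_component (- 1) n (word_elt u).
transitivity (\sum_(u <- short_words N | (2 <= size u)%N) G u).
  rewrite /short_words big_flatten big_map sum_iota_ord.
  apply: eq_bigr => r _; rewrite /susp_op; case: ifP => hr; last first.
    rewrite linear0 big_seq_cond big1 // => u /andP[].
    by rewrite mem_words => /andP[/eqP -> _]; rewrite hr.
  rewrite ins_words //; last by rewrite /=; lia.
  rewrite big_seq [RHS]big_seq_cond; apply: eq_big => u.
    by rewrite andbC; case: (boolP (u \in _)); rewrite ?andbF // mem_words => /andP[/eqP -> _]; rewrite hr.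
  by rewrite mem_words => /andP[/eqP hu _]; rewrite /G /word_elt hu.
rewrite (bigID (fun u => sumn u == n)) /= [X in _ + X]big1_seq ?addr0; last first.
  move=> u /andP[/andP[_ hs]]; rewrite mem_short_words => /andP[_ ha].
  rewrite /G /susp_component hcomponent_out ?scaler0 // word_elt_ar ?hs //.
  by apply: sub_all ha => w /andP[].
rewrite (bigID (pred1 (nseq n 1%N))) /=.
rewrite [X in X + _](_ : _ = G (nseq n 1%N)); last first.
  rewrite -big_filter (_ : filter _ _ = [:: nseq n 1%N]) ?big_seq1 //.
  apply: perm_small_eq => //; apply: uniq_perm; rewrite ?filter_uniq ?short_words_uniq //.
  move=> u; rewrite mem_filter inE; case: (u =P nseq n 1%N) => [->|_]; rewrite ?andbF //.
  rewrite mem_short_words size_nseq sumn_nseq mul1n eqxx h2 all_nseq /=; lia.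
rewrite (eq_bigl (mixed_word n)); last by move=> u; rewrite /mixed_word -andbA.
rewrite /G word_sgn_nseq1 expr0 scale1r word_elt_ones (brace_gen_words hN).
rewrite /susp_component -[in RHS](scale1r (a n)) hcomponentP scale1r; congr (_ + _).
(* The degrees n - 2 and -1 + n - 1 are equal but not convertible, so the degree is generalized. *)
have key (b : int) : n%:Z - 2 = b -> \sum_(u <- short_words N | mixed_word n u)
    (-1) ^+ word_sgn 1 u *: hcomponent n b (word_elt u) =
  hcomponent n b (Helt (\sum_(u <- short_words N | mixed_word n u)
    (-1) ^+ word_sgn 1 u *: hcomponent n (n%:Z - 2) (word_elt u))).
  by move=> <-; rewrite hcomponentE.
by apply: key; lia.
Qed.

End WordSums.

(** * Stasheff signs as suspension signs *)

Section StasheffSums.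
Variables (k : comPzRingType) (O : operad k).

(** For an inner operation of suspended degree -1 the exponent of the suspension is (i - 1)(q - 1) -
    (p - 1), which has the parity of p - i + q(i - 1). *)
Lemma brace_stasheff N (d e c : int) (g : d + e = c) (X Y : nat -> helt O) n :
  e = - 1 -> (n.+1 < N)%N ->
  (forall p, h_ar (X p) = p) -> (forall p, h_ar (Y p) = p) ->
  (forall p, h_deg (X p) = d + p%:Z - 1) -> (forall p, h_deg (Y p) = e + p%:Z - 1) ->
  brace (Q := susp_operad O) N g
    (fun p => if (2 <= p)%N then susp_component d p (X p) else 0)
    (fun q => if (2 <= q)%N then susp_component e q (Y q) else 0) n =
  stasheff_sum X Y n (c + n%:Z - 1).
Proof.
move=> he hN arX arY degX degY; subst e; rewrite /brace /stasheff_sum.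
have hN' : (n.+1 <= N)%N by lia.
rewrite [RHS](big_ord_widen _ (fun p => \sum_(q < n.+1 | [&& 2 <= p, 2 <= q & p + q == n.+1]%N)
  \sum_(1 <= i < p.+1)
    (-1) ^+ (p - i + q * (i - 1))%N *: hcomponent n (c + n%:Z - 1) (hcomp (X p) i (Y q))) hN').
rewrite [RHS]big_mkcond; apply: eq_bigr => p _ /=.
transitivity (\sum_(q < N | [&& 2 <= p, 2 <= q & p + q == n.+1]%N)
  \sum_(1 <= i < p.+1)
    (-1) ^+ (p - i + q * (i - 1))%N *: hcomponent n (c + n%:Z - 1) (hcomp (X p) i (Y q))).
  rewrite [RHS]big_mkcond; apply: eq_bigr => q _ /=.
  case: (boolP [&& 2 <= p, 2 <= q & p + q == n.+1]%N) => [/and3P[hp hq /eqP hpq]|h]; last first.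
    rewrite big1 // => i _; case: ifP => hp; last by rewrite tcomp0l.
    case: ifP => hq; last by rewrite linear0.
    by rewrite tcomp_out //; apply/orP; left; rewrite hp hq in h.
  rewrite hp hq big_nat [RHS]big_nat; apply: eq_bigr => i hi.
  rewrite (@tcomp_susp_component _ _ _ _ _ g _ i p q) //.
  congr (_ *: _); rewrite sgn_nat /susp_sgn.
  apply: eq_sgn.
  rewrite (_ : (p%:Z - 1) * - 1 + (i%:Z - 1) * (q%:Z - 1) =
    (p - i + q * (i - 1))%N%:Z - (p%:Z - 1) - (p%:Z - 1)); last first.
    rewrite PoszD PoszM (_ : (p - i)%N%:Z = p%:Z - i%:Z); last by lia.
    rewrite (_ : (i - 1)%N%:Z = i%:Z - 1); last by lia.
    by ring.
  by lia.
case: ifP => hp.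
  rewrite [RHS](big_ord_widen_cond _ (fun q => [&& 2 <= p, 2 <= q & p + q == n.+1]%N)
    (fun q => \sum_(1 <= i < p.+1) (-1) ^+ (p - i + q * (i - 1))%N *:
      hcomponent n (c + n%:Z - 1) (hcomp (X p) i (Y q))) hN').
  apply: eq_bigl => q; case: (boolP (_ == _)) => [/eqP h|]; rewrite ?andbF //= !andbT.
  by case: (ltnP 1 q) => hq; rewrite ?andbF //= andbT; case: (ltnP 1 p) => //= hp'; lia.
rewrite big_pred0 // => q; apply/negbTE/negP => /and3P[h1 h2 /eqP h3]; lia.
Qed.

End StasheffSums.

(** * The defect of the formula is a cycle *)

Section DefectCycle.
Variables (k : comPzRingType) (O : dg_operad k).

Lemma d_susp_component n (a c d d' : int) (e : c = a + 1) (e' : d' = d + 1) (x : O n d') :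
  d' = c + n%:Z - 1 ->
  dg_d (susp_dg_operad O) n e (susp_component c n (Helt x)) =
  susp_component a n (Helt (dg_d O n e' x)).
Proof.
move=> hd; have hd' : d = a + n%:Z - 1 by lia.
move: e' x; rewrite hd hd' => e' x.
rewrite /susp_component !hcomponentE /= /susp_d.
by rewrite (eq_irrelevance (susp_deg_d n e) e').
Qed.

Lemma susp_componentP a n d u (x y : O n d) :
  susp_component a n (Helt (u *: x + y)) =
  u *: susp_component a n (Helt x) + susp_component a n (Helt y).
Proof. by rewrite /susp_component (hcomponentP (X := O)). Qed.

Lemma susp_componentB a n d (x y : O n d) :
  susp_component a n (Helt (x - y)) =
  susp_component a n (Helt x) - susp_component a n (Helt y).
Proof.
have := susp_componentP a (-1) y x.
by rewrite !scaleN1r addrC => ->; rewrite addrC.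
Qed.

Lemma susp_componentD a n d (x y : O n d) :
  susp_component a n (Helt (x + y)) =
  susp_component a n (Helt x) + susp_component a n (Helt y).
Proof. by have := susp_componentP a 1 x y; rewrite !scale1r. Qed.

Lemma susp_component_eq0 a n d (x : O n d) : d = a + n%:Z - 1 ->
  susp_component a n (Helt x) = 0 -> x = 0.
Proof. by move=> h; subst d; rewrite /susp_component hcomponentE. Qed.

Lemma susp_component_stasheff (x y : nat -> helt O) n a d : d = a + n%:Z - 1 ->
  susp_component a n (Helt (stasheff_sum x y n d)) = stasheff_sum x y n (a + n%:Z - 1).
Proof. by move=> h; subst d; rewrite /susp_component hcomponentE. Qed.

Variables (a b : forall n, O n (n%:Z - 2)) (s : forall n, O n (n%:Z - 1)).

Lemma d_susp_op N (x : forall n, O n (n%:Z - 2)) (e1 : - 1 = - 2 + 1 :> int)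
    (g : - 1 + - 1 = - 2 :> int) m :
  (m.+1 < N)%N ->
  (forall m (d : int) (e : m%:Z - 2 = d + 1), (2 <= m)%N ->
     dg_d O m e (x m) = stasheff_sum (fun p => Helt (x p)) (fun q => Helt (x q)) m d) ->
  dg_d (susp_dg_operad O) m e1 (susp_op x m) =
  brace (Q := susp_operad O) N g (susp_op x) (susp_op x) m.
Proof.
move=> hN dx; rewrite /susp_op brace_stasheff //; try by move=> p /=; lia.
case: ifP => hm; last first.
  rewrite linear0 /stasheff_sum big1 // => p _; rewrite big_pred0 // => q.
  by apply/negbTE/negP => /and3P[h1 h2 /eqP h3]; lia.
have e : m%:Z - 2 = m%:Z - 3 + 1 by lia.
rewrite (d_susp_component e1 e) ?dx //; last by lia.
by rewrite susp_component_stasheff //; lia.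
Qed.

Lemma brace_letter N (f0 : 0 + - 1 = - 1 :> int) n : (n.+1 < N)%N -> (2 <= n)%N ->
  brace (Q := susp_operad O) N f0 (susp_letter s) (susp_op b) n =
  susp_component (- 1) n (Helt (b n +
    stasheff_sum (fun p => Helt (s p)) (fun q => Helt (b q)) n (n%:Z - 2))).
Proof.
move=> hN hn; rewrite susp_componentD susp_component_stasheff; last by lia.
rewrite -(@brace_stasheff _ _ N 0 (-1) (-1) f0) //; try by move=> p /=; lia.
have h1 : (1 < N)%N by lia.
have -> : susp_component (-1) n (Helt (b n)) = \sum_(q < N) \sum_(1 <= i < 2)
    tcomp (Q := susp_operad O) f0 n i (op_id (susp_operad O)) (susp_op b q).
  have hnN : (n < N)%N by lia.
  rewrite (bigD1 (Ordinal hnN)) //= big_nat1 tcomp_idl big1 ?addr0 /susp_op ?hn //.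
  move=> q nq; rewrite big_nat1 tcomp_out //; apply/orP; left.
  by rewrite add1n eqSS; apply: contraNneq nq => h; apply/eqP/val_inj.
rewrite /brace (bigD1 (Ordinal h1)) //= [X in _ = _ + X](bigD1 (Ordinal h1)) //=.
congr (_ + _).
  rewrite (_ : susp_letter s 1 = op_id (susp_operad O)) //.
  by rewrite /susp_letter /letter /susp_component /= (hcomponentE (X := O)).
rewrite [X in _ = X + _]big1 ?add0r.
  apply: eq_bigr => p hp; apply: eq_bigr => q _; apply: eq_bigr => i _.
  rewrite (_ : susp_letter s p = if (2 <= p)%N then susp_component 0 p (Helt (s p)) else 0) //.
  have p1 : (p : nat) != 1%N by apply: contraNneq hp => h; apply/eqP/val_inj.
  by rewrite /susp_letter /letter (negbTE p1) (_ : (0 < p) = (1 < p))%N //; lia.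
by move=> q _; rewrite big1 // => i _; rewrite tcomp0l.
Qed.

Lemma defect_cycle n : (2 <= n)%N ->
  (forall m (d : int) (e : m%:Z - 2 = d + 1), (2 <= m)%N ->
     dg_d O m e (a m) = stasheff_sum (fun p => Helt (a p)) (fun q => Helt (a q)) m d) ->
  (forall m (d : int) (e : m%:Z - 2 = d + 1), (2 <= m)%N ->
     dg_d O m e (b m) = stasheff_sum (fun p => Helt (b p)) (fun q => Helt (b q)) m d) ->
  (forall m (e : m%:Z - 1 = m%:Z - 2 + 1), (2 <= m < n)%N ->
     dg_d O m e (s m) = a m - b m
       - stasheff_sum (fun p => Helt (s p)) (fun q => Helt (b q)) m _ + brace_gen a s m) ->
  forall d (e : n%:Z - 2 = d + 1),
  dg_d O n e (a n - b n
    - stasheff_sum (fun p => Helt (s p)) (fun q => Helt (b q)) n _ + brace_gen a s n) = 0.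
Proof.
move=> hn da db ds d e.
have e0 : 0 = - 1 + 1 :> int by [].
have e1 : - 1 = - 2 + 1 :> int by [].
have g : - 1 + - 1 = - 2 :> int by [].
have defect m : (2 <= m <= n)%N ->
    subst n.+2 (susp_letter s) (susp_op a) m -
    brace (Q := susp_operad O) n.+2 (add0r (- 1)) (susp_letter s) (susp_op b) m =
    susp_component (- 1) m (Helt (a m - b m
    - stasheff_sum (fun p => Helt (s p)) (fun q => Helt (b q)) m _ + brace_gen a s m)).
  case/andP=> h2 hm; rewrite subst_words // brace_letter //; try lia.
  have E (V : zmodType) (x y z t : V) : x + y - (z + t) = x - z - t + y.
    by rewrite opprD !addrA [x - z - t + y]addrAC; congr (_ - _); rewrite addrAC.
  by rewrite -susp_componentB E.
apply: (@susp_component_eq0 (- 2)); first by lia.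
rewrite -(d_susp_component e1); last by lia.
rewrite -defect ?hn ?leqnn //.
apply: (@obstruction_cycle _ (susp_dg_operad O) n.+2 (susp_letter s) (susp_op a)
  (susp_op b) e0 e1 g n) => //.
- by move=> m hm; exact: d_susp_op.
- by move=> m hm; exact: d_susp_op.
- move=> m hm; have [h2|h2] := leqP 2 m.
    rewrite defect; last by lia.
    have e2 : m%:Z - 1 = m%:Z - 2 + 1 by lia.
    rewrite /susp_letter (ltnW h2) /letter gtn_eqF //.
    by rewrite (d_susp_component e0 e2) ?ds ?h2 //; lia.
  (* In arities 0 and 1 both sides vanish: a and b start in arity 2, f_0 = 0, and f_1 is the
     identity, a cycle. *)
  rewrite (_ : subst _ _ _ m = 0) ?sub0r; last first.
    rewrite /subst big1 // => r _; rewrite /susp_op; case: ifP => hr; last by rewrite linear0.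
    by apply: ins_high => //; lia.
  rewrite (_ : brace _ _ _ _ m = 0) ?oppr0; last first.
    rewrite /brace big1 // => p _; rewrite big1 // => q _; rewrite big1 // => i _.
    rewrite /susp_op; case: ifP => hq; last by rewrite linear0.
    have [p0|pp] := posnP p; first by rewrite p0 tcomp0l.
    by rewrite tcomp_out //; apply/orP; left; apply/eqP => h; lia.
  case: m hm h2 => [|[|m]] // _ _; first by rewrite linear0.
  rewrite /susp_letter /letter /susp_component /= (hcomponentE (X := O)) /susp_d.
  exact: (derivation_id _ (@dg_leibniz k O)).
Qed.

End DefectCycle.

(** * Trees whose labels are killed by the homotopy *)

(** Subtrees occur inside a list, so the induction hypothesis has to be stated for all members of
    that list. *)
Fixpoint tree_nested_ind (P : tree -> Prop) (hL : P Leaf)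
    (hN : forall ts, List.Forall P ts -> P (Node ts)) (t : tree) : P t :=
  if t is Node ts then
    hN ts ((fix all_P (us : seq tree) : List.Forall P us :=
      if us is u :: us' then List.Forall_cons _ (tree_nested_ind hL hN u) (all_P us')
      else List.Forall_nil _) ts)
  else hL.

Lemma all_flatten (A : Type) (a : pred A) (ss : seq (seq A)) :
  all a (flatten ss) = all (all a) ss.
Proof. by elim: ss => //= s ss IH; rewrite all_cat IH. Qed.

Lemma all2_flatten_map (A B D : Type) (r : A -> B -> bool) (f : D -> seq A)
    (g : D -> seq B) (cs : seq D) :
  (forall c, all2 r (f c) (g c)) -> all2 r (flatten (map f cs)) (flatten (map g cs)).
Proof.
by move=> h; elim: cs => //= c cs IH; elim: (f c) (g c) (h c) => [|x s IHs] [|y s'] //= /andP[-> /IHs].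
Qed.

Section ZeroLabels.
Variables (k : comPzRingType) (T : operad k).

Definition hzero (X : gseq k) (z : helt X) : bool := h_val z == 0.

Lemma hcomponent_zero (X : gseq k) n a (z : helt X) : hzero z -> hcomponent n a z = 0.
Proof.
case: z => m b x /eqP /= ->; have := hcomponentP n a 1 (0 : X m b) 0.
rewrite scaler0 addr0 scale1r => /eqP.
by rewrite -subr_eq0 opprD addrA subrr sub0r oppr_eq0 => /eqP.
Qed.

Lemma hcomp_zero (z y : helt T) i : (1 <= i <= h_ar z)%N ->
  hzero z || hzero y -> hzero (hcomp z i y).
Proof.
case: z y => [p a x] [q b y] hi; rewrite [h_ar _]/= in hi.
have [r e] : exists r, (p + q = r.+1)%N by exists (p + q).-1; lia.
rewrite (hcompE e (erefl (a + b))) // /hzero /= -(tcompE e) //.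
by case/orP => /eqP ->; rewrite ?tcomp0l ?linear0.
Qed.

Lemma hcomp_from_zero i (z : helt T) ys : (1 <= i)%N -> (i + size ys <= (h_ar z).+1)%N ->
  hzero z || has (@hzero T) ys -> hzero (hcomp_from i z ys).
Proof.
elim: ys i z => [|y ys IH] i z hi hs /=; first by rewrite orbF.
rewrite orbA => hz; apply: IH; move: hs => /= hs; try lia.
- by rewrite hcomp_ar; lia.
- by case/orP: hz => [h|->]; rewrite ?orbT // hcomp_zero //; lia.
Qed.

(** A name for the anonymous inner recursion of [tree_value_rest], to which it is convertible. *)
Fixpoint forest_rest (us : seq tree) (zs : seq (helt T)) :
    seq (helt T) * seq (helt T) :=
  if us is u :: us' then
    let r := tree_value_rest u zs in
    let s := forest_rest us' r.2 in (r.1 :: s.1, s.2)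
  else ([::], zs).

Lemma tree_value_rest_node ts y ys :
  tree_value_rest (Node ts) (y :: ys) =
  (hfull y (forest_rest ts ys).1, (forest_rest ts ys).2).
Proof. by []. Qed.

Definition tree_arities (l : nat) (t : tree) : seq nat :=
  [seq w.2 | w <- inner_vertices l t].

(** Composition is linear only at positions in range, whence the condition on arities. The suffix
    [rest] is what the siblings to the right consume. *)
Lemma tree_value_zero t : forall l ys rest, map (@h_ar _ T) ys = tree_arities l t ->
  (tree_value_rest t (ys ++ rest)).2 = rest /\
  (has (@hzero T) ys -> hzero (tree_value_rest t (ys ++ rest)).1).
Proof.
elim/tree_nested_ind: t => [|ts IH] l ys rest; first by case: ys.
case: ys => [|y ys] // [hy]; rewrite map_flatten -map_comp => hys.
rewrite cat_cons tree_value_rest_node.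
have [s1 s2 s3] : [/\ (forest_rest ts (ys ++ rest)).2 = rest,
    size (forest_rest ts (ys ++ rest)).1 = size ts
  & has (@hzero T) ys -> has (@hzero T) (forest_rest ts (ys ++ rest)).1].
  elim: IH ys hys {y hy} => [|u us hu _ IHus] ys /=; first by case: ys.
  move=> hys; set m := size (inner_vertices l.+1 u).
  have h1 : map (@h_ar _ T) (take m ys) = tree_arities l.+1 u.
    by rewrite map_take hys /= take_size_cat // size_map.
  have h2 : map (@h_ar _ T) (drop m ys) = flatten
     [seq ([eta map (fun w => w.2)] \o inner_vertices l.+1) i | i <- us].
    by rewrite map_drop hys /= drop_size_cat // size_map.
  rewrite -[ys in ys ++ rest](cat_take_drop m ys) -catA.
  have [-> hz] := hu l.+1 (take m ys) (drop m ys ++ rest) h1.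
  have [-> -> hz'] := IHus _ h2; split=> // /=.
  rewrite -[ys in has _ ys](cat_take_drop m ys) has_cat.
  by case/orP => [/hz ->|/hz' ->] //; rewrite orbT.
move: (forest_rest _ _) s1 s2 s3 => F /= s1 s2 s3.
split=> // hz; apply: hcomp_from_zero => //; first by rewrite s2 hy.
by case/orP: hz => [->|/s3 ->]; rewrite ?orbT.
Qed.

End ZeroLabels.

Section Evaluation.
Variables (k : comPzRingType) (T : operad k).

Lemma forest_rest_map (A : Type) (ch : A -> tree) (lab : A -> seq (helt T))
    (val : A -> helt T) (cs : seq A) rest :
  (forall x rest, tree_value_rest (ch x) (lab x ++ rest) = (val x, rest)) ->
  forest_rest (map ch cs) (flatten (map lab cs) ++ rest) = (map val cs, rest).
Proof. by move=> h; elim: cs => [|x cs IH] //=; rewrite -catA h IH. Qed.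

Lemma forest_rest1 t (zs : seq (helt T)) :
  forest_rest [:: t] zs = ([:: (tree_value_rest t zs).1], (tree_value_rest t zs).2).
Proof. by []. Qed.

Lemma forest_rest_leaves n (rest : seq (helt T)) :
  forest_rest (nseq n Leaf) rest = (nseq n (hid T), rest).
Proof. by elim: n => [|n IH] //=; rewrite IH. Qed.

Lemma corolla_value (y : helt T) rest :
  tree_value_rest (Node (nseq (h_ar y) Leaf)) (y :: rest) = (y, rest).
Proof. by rewrite tree_value_rest_node forest_rest_leaves /= hfull_ids. Qed.

Lemma forest_rest_ids n (rest : seq (helt T)) :
  forest_rest (nseq n (Node [:: Leaf])) (nseq n (hid T) ++ rest) = (nseq n (hid T), rest).
Proof.
elim: n => [|n IH] //.
rewrite -[LHS]/(let r := tree_value_rest (Node [:: Leaf]) (hid T :: (nseq n (hid T) ++ rest)) in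
  let s := forest_rest (nseq n (Node [:: Leaf])) r.2 in (r.1 :: s.1, s.2)).
by rewrite (corolla_value (hid T)) /= IH.
Qed.

(** A corolla at an even level: identities are grafted on all its inputs, since
    leaves have even level. *)
Definition even_corolla n : tree := Node (nseq n (Node [:: Leaf])).

Lemma even_corolla_value (y : helt T) rest :
  tree_value_rest (even_corolla (h_ar y)) (y :: nseq (h_ar y) (hid T) ++ rest) = (y, rest).
Proof. by rewrite tree_value_rest_node forest_rest_ids /= hfull_ids. Qed.

End Evaluation.

Definition killed_by (k : comPzRingType) (X : gseq k) (h : hup X X) (z : helt X) : Prop :=
  forall c (e : c = h_deg z + 1), h (h_ar z) (h_deg z) c e (h_val z) = 0.

(** * Elements killed by the homotopy of a coproduct *)

Section KilledTrees.
Variables (k : comPzRingType) (O : dg_operad k) (V : dgseq k).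
Variables (C : pseudo_cylinder O) (T : dg_operad k).
Variables (j : dg_map C T) (v : hmap (Defs.interval V) T) (hV : hup T T).
Hypothesis hVP : coproduct_homotopy j v hV.

Notation labels := (Defs.label V C).
Notation lval := (label_val j v).

Definition h_kills (y : labels) : bool := hzero (lval (label_h y)).
Definition p_kills (y : labels) : bool := hzero (lval (label_i0p y)).

(** All the summands of h_{O,V} on a tensor with these labels vanish. *)
Fixpoint labels_killed (ys : seq labels) : bool :=
  if ys is y :: ys' then h_kills y && (p_kills y || labels_killed ys') else true.

Lemma all_labels_killed ys : all h_kills ys -> labels_killed ys.
Proof. by elim: ys => [|y ys IH] //= /andP[-> /IH ->]; rewrite orbT. Qed.

Lemma labels_killed_summand ys i y ys' : labels_killed ys -> drop i ys = y :: ys' ->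
  has (@hzero k T) (map lval (map (@label_i0p k O V C) (take i ys) ++ label_h y :: ys')).
Proof.
elim: ys i => [|x ys IH] [|i] //= /andP[hx px].
  by move=> [<- _]; rewrite -/(h_kills x) hx.
move=> hd; case/orP: px => [px|hys]; first by rewrite -/(p_kills x) px.
by rewrite (IH i) ?orbT.
Qed.

Lemma labelling_arities t ys : labelling t ys ->
  map (@h_ar _ T) (map lval ys) = tree_arities 1 t.
Proof.
rewrite /labelling /tree_arities; elim: (inner_vertices 1 t) ys => [|w ws IH] [|y ys] //=.
by case/andP=> hy /IH ->; congr (_ :: _); case: y hy => x /andP[_ /eqP].
Qed.

Lemma killed_tree t ys : even_leaves t -> labelling t ys -> labels_killed ys ->
  killed_by hV (tree_value t (map lval ys)).
Proof.
move=> ht hl hk c e; rewrite hVP // big1 // => i _.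
case hd: (drop i ys) => [//|y ys'].
rewrite hcomponent_zero ?scaler0 // /tree_value.
set zs := map lval (_ ++ _).
have har : map (@h_ar _ T) zs = tree_arities 1 t.
  rewrite -(labelling_arities hl) -[ys in RHS](cat_take_drop i ys) hd /zs !map_cat -!map_comp /=.
  by congr (_ ++ _ :: _); [apply: eq_map; case | case: (y)].
have [_] := tree_value_zero [::] har; rewrite cats0; apply.
exact: labels_killed_summand hd.
Qed.

Definition id_label : labels := inl (hid C).

Lemma happly_id : happly j (hid C) = hid T.
Proof. by rewrite /happly /hid /= om_id. Qed.

Lemma id_label_killed : h_kills id_label.
Proof.
rewrite /h_kills /hzero /= -(om_id (pc_i0 C)) (spc_hi0 (pc_spc C)).
by rewrite linear0.
Qed.

Lemma even_corolla_leaves n l :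
  ~~ odd l -> all (fun l => ~~ odd l) (leaf_levels l (even_corolla n)).
Proof.
move=> hl; rewrite /= all_flatten map_nseq all_nseq /=.
by rewrite negbK hl orbT.
Qed.

Lemma even_corolla_fits (u : helt (Defs.interval V)) l : ~~ odd l ->
  all2 (@label_fits k O V C) (inner_vertices l (even_corolla (h_ar u)))
    (inr u :: nseq (h_ar u) id_label).
Proof.
move=> hl; rewrite /= hl size_nseq eqxx map_nseq /=.
by elim: (h_ar u) => //= n ->; rewrite hl.
Qed.

Lemma corolla_leaves n l :
  odd l -> all (fun l => ~~ odd l) (leaf_levels l (Node (nseq n Leaf))).
Proof. by move=> hl; rewrite /= all_flatten map_nseq all_nseq /= hl orbT. Qed.

Lemma corolla_fits (x : helt C) l : odd l ->
  all2 (@label_fits k O V C) (inner_vertices l (Node (nseq (h_ar x) Leaf))) [:: inl x].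
Proof.
move=> hl; rewrite /= hl size_nseq eqxx map_nseq /=.
by elim: (h_ar x).
Qed.

(** The tree has x at level 1. [None] is a leaf of level 2, and [Some u] is u at level 2 followed by
    identities at level 3. If p kills x, the labels above it are arbitrary, since h reaches them
    only in summands containing i_0 p(x). *)
Lemma killed_odd_root (x : helt C) (cs : seq (option (helt (Defs.interval V)))) :
  size cs = h_ar x -> h_kills (inl x) ->
  p_kills (inl x) || all (fun c => if c is Some u then h_kills (inr u) else true) cs ->
  killed_by hV (hfull (happly j x)
    (map (fun c => if c is Some u then happly v u else hid T) cs)).
Proof.
move=> hs hx hcs.
pose ch (c : option (helt (Defs.interval V))) :=
  if c is Some u then even_corolla (h_ar u) else Leaf.
pose lab (c : option (helt (Defs.interval V))) : seq labels :=
  if c is Some u then inr u :: nseq (h_ar u) id_label else [::].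
have -> : hfull (happly j x) (map (fun c => if c is Some u then happly v u else hid T) cs)
    = tree_value (Node (map ch cs)) (map lval (inl x :: flatten (map lab cs))).
  rewrite /tree_value map_cons tree_value_rest_node map_flatten -map_comp -[flatten _]cats0.
  rewrite (forest_rest_map (val := fun c => if c is Some u then happly v u else hid T)) //.
  case=> [u|] rest //; rewrite /= map_nseq /= happly_id.
  exact: (even_corolla_value (happly v u)).
apply: killed_tree.
- rewrite /even_leaves /= -map_comp all_flatten all_map.
  rewrite (eq_all (a2 := predT)) ?all_predT // => -[u|] //=.
  exact: (@even_corolla_leaves (h_ar u) 2).
- rewrite /labelling /= size_map hs eqxx -map_comp /=.
  by apply: all2_flatten_map => -[u|] //; exact: even_corolla_fits.
- rewrite /= hx /=; case/orP: hcs => [->//|hcs]; apply/orP; right.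
  apply: all_labels_killed; rewrite all_flatten all_map; apply: sub_all hcs.
  by case=> [u|] //= ->; rewrite all_nseq id_label_killed orbT.
Qed.

(** Labels in IV need even levels, so an identity is put at level 1 below u, and another one at
    level 3 below each child in IV. *)
Lemma killed_even_root (u : helt (Defs.interval V)) (cs : seq labels) :
  size cs = h_ar u -> h_kills (inr u) -> p_kills (inr u) || all h_kills cs ->
  killed_by hV (hfull (happly v u) (map lval cs)).
Proof.
move=> hs hu hcs.
pose ch (c : labels) := match c with
  | inl x => Node (nseq (h_ar x) Leaf)
  | inr w => Node [:: even_corolla (h_ar w)] end.
pose lab (c : labels) : seq labels := match c with
  | inl x => [:: inl x]
  | inr w => id_label :: inr w :: nseq (h_ar w) id_label end.
have -> : hfull (happly v u) (map lval cs) =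
    tree_value (Node [:: Node (map ch cs)])
      (map lval (id_label :: inr u :: flatten (map lab cs))).
  rewrite /tree_value !map_cons tree_value_rest_node map_flatten -map_comp -[flatten _]cats0.
  rewrite forest_rest1 tree_value_rest_node (forest_rest_map (val := lval)).
    rewrite (_ : lval id_label = hid T); last exact: happly_id.
    by rewrite -[RHS]/(hcomp (hid T) 1 (hfull (happly v u) (map lval cs))) hcomp_idl.
  case=> [x|w] rest; first exact: (corolla_value (happly j x)).
  rewrite /lab /comp !map_cons map_nseq (_ : lval id_label = hid T); last exact: happly_id.
  rewrite !cat_cons.
  rewrite tree_value_rest_node forest_rest1 (even_corolla_value (happly v w)).
  by rewrite -[LHS]/(hcomp (hid T) 1 (happly v w), rest) hcomp_idl.
apply: killed_tree.
- rewrite /even_leaves /= cats0 -map_comp all_flatten all_map.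
  rewrite (eq_all (a2 := predT)) ?all_predT // => -[x|w].
    exact: (@corolla_leaves (h_ar x) 3).
  by rewrite /= cats0; exact: (@even_corolla_leaves (h_ar w) 4).
- rewrite /labelling /= size_map hs eqxx cats0 -map_comp /=.
  apply: all2_flatten_map => -[x|w]; first exact: corolla_fits.
  by rewrite /= cats0; exact: (@even_corolla_fits w 4).
- rewrite /= id_label_killed hu /=; apply/orP; right.
  case/orP: hcs => [->//|hcs]; apply/orP; right.
  apply: all_labels_killed; rewrite all_flatten all_map; apply: sub_all hcs.
  by case=> [x|w] /= ->; rewrite // id_label_killed all_nseq id_label_killed orbT.
Qed.

End KilledTrees.

(** Every term of the perturbation series first applies [hV] to z. *)
Lemma perturbed_killed (k : comPzRingType) (T : dg_operad k) (hV : hup T T) (D : hdown T T)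
    (h : hup T T) (z : helt T) :
  perturbed_homotopy hV D h -> killed_by hV z -> killed_by h z.
Proof.
move=> hp hz c e; have [N [_ ->]] := hp _ _ _ e (h_val z).
rewrite big1 // => m _; rewrite hz.
by elim: (m : nat) => //= i ->; rewrite !linear0.
Qed.

Local Arguments hcomp : simpl never.
Local Arguments letter : simpl never.

Lemma hcomponent_happly (k : comPzRingType) (X Y : gseq k) (f : hmap X Y) n a (z : helt X) :
  hcomponent n a (happly f z) = f n a (hcomponent n a z).
Proof.
have [e|ne] := eqVneq (h_ar z) n; last by rewrite !hcomponent_out ?ne // linear0.
have [e'|ne] := eqVneq (h_deg z) a; last by rewrite !hcomponent_out ?ne ?orbT // linear0.
by case: z e e' => m b x /= e e'; subst; rewrite !hcomponentE.
Qed.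

(** * Operad maps and scalars on homogeneous elements *)

Section HomogeneousMorphisms.
Variables (k : comPzRingType) (O P : operad k) (f : op_map O P).

Lemma happly_hcomp z i y : (1 <= i <= h_ar z)%N ->
  happly f (hcomp z i y) = hcomp (happly f z) i (happly f y).
Proof.
case: z y => [p a x] [q b y] hi; rewrite [h_ar _]/= in hi.
have [r e] : exists r, (p + q = r.+1)%N by exists (p + q).-1; lia.
by rewrite (hcompE e (erefl (a + b))) // (hcompE e (erefl (a + b))) // /happly om_comp.
Qed.

Lemma happly_hcomp_from i z ys : (1 <= i)%N -> (i + size ys <= (h_ar z).+1)%N ->
  happly f (hcomp_from i z ys) = hcomp_from i (happly f z) (map (happly f) ys).
Proof.
elim: ys i z => [|y ys IH] i z hi //=; rewrite addnS ltnS => hs.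
by rewrite IH ?happly_hcomp ?hcomp_ar; try lia.
Qed.

Lemma happly_hfull z ys : size ys = h_ar z ->
  happly f (hfull z ys) = hfull (happly f z) (map (happly f) ys).
Proof. by move=> hs; rewrite /hfull happly_hcomp_from // hs. Qed.

Lemma happly_hid : happly f (hid O) = hid P.
Proof. by rewrite /happly /hid /= om_id. Qed.

End HomogeneousMorphisms.

Section Scaling.
Variables (k : comPzRingType) (O : operad k).
Implicit Types z y : helt O.

Definition hscale (u : k) z : helt O := Helt (u *: h_val z).

Lemma hscale1 z : hscale 1 z = z.
Proof. by case: z => n a x; rewrite /hscale /= scale1r. Qed.

Lemma hscaleA u u' z : hscale u (hscale u' z) = hscale (u * u') z.
Proof. by case: z => n a x; rewrite /hscale /= scalerA. Qed.

Lemma hscale_hcomp u z i y : (1 <= i <= h_ar z)%N ->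
  hcomp (hscale u z) i y = hscale u (hcomp z i y).
Proof.
case: z y => [p a x] [q b y] hi; rewrite [h_ar _]/= in hi.
have [r e] : exists r, (p + q = r.+1)%N by exists (p + q).-1; lia.
rewrite (hcompE e (erefl (a + b))) // /hscale (hcompE e (erefl (a + b))) //=.
by rewrite op_compZl.
Qed.

Lemma hscale_hcomp_from u z i ys : (1 <= i)%N -> (i + size ys <= (h_ar z).+1)%N ->
  hcomp_from i (hscale u z) ys = hscale u (hcomp_from i z ys).
Proof.
elim: ys i z => [|y ys IH] i z hi //=; rewrite addnS ltnS => hs.
by rewrite hscale_hcomp ?IH ?hcomp_ar; try lia.
Qed.

(** The scalar is a sign; it is left unspecified because being killed by h does not depend on it. *)
Lemma hcomp_exch z i j y y' : (1 <= i < j)%N -> (j <= h_ar z)%N -> exists u,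
  hcomp (hcomp z i y) (j + h_ar y - 1) y' = hscale u (hcomp (hcomp z j y') i y).
Proof.
case: z y y' => [p a x] [q b y] [s c y'] hij hj; rewrite [h_ar _]/= in hj; rewrite [h_ar _]/=.
have [r e] : exists r, (p + q + s = r.+2)%N by exists (p + q + s).-2; lia.
have e1 : (p + q = (p + q).-1.+1)%N by lia.
have e2 : ((p + q).-1 + s = r.+1)%N by lia.
have e3 : (p + s = (p + s).-1.+1)%N by lia.
have e4 : ((p + s).-1 + q = r.+1)%N by lia.
have f4 : a + c + b = a + b + c by rewrite addrAC.
rewrite (hcompE e1 (erefl (a + b))); last by lia.
rewrite (hcompE e2 (erefl (a + b + c))); last by lia.
rewrite (hcompE e3 (erefl (a + c))); last by lia.
rewrite (hcompE e4 f4); last by lia.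
exists (sgn k (c * b)); congr Helt.
rewrite (op_exch e3 (erefl (a + c)) e4 f4 e1 (erefl (a + b)) e2 (erefl (a + b + c))) //.
by rewrite scalerA sgn_sqr scale1r.
Qed.

(** This postpones the insertion of y past all the insertions to its right. *)
Lemma hcomp_from_exch z i l y ys : (1 <= i < l)%N -> (l + size ys <= (h_ar z).+1)%N ->
  exists u, hcomp_from (l + h_ar y - 1) (hcomp z i y) ys =
            hscale u (hcomp (hcomp_from l z ys) i y).
Proof.
elim: ys z l => [|y' ys IH] z l hi /=; first by exists 1; rewrite hscale1.
rewrite addnS ltnS => hs.
have hl : (l <= h_ar z)%N by lia.
have [u ->] := hcomp_exch y y' hi hl.
have hl' : (1 <= i < l + h_ar y')%N by lia.
have hs' : (l + h_ar y' + size ys <= (h_ar (hcomp z l y')).+1)%N.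
  by rewrite hcomp_ar; lia.
have [u' e] := IH (hcomp z l y') (l + h_ar y')%N hl' hs'.
exists (u * u'); rewrite -hscaleA -e hscale_hcomp_from; try lia.
- by rewrite (_ : l + h_ar y - 1 + h_ar y' = l + h_ar y' + h_ar y - 1)%N //; lia.
- by rewrite hcomp_ar ?hcomp_ar; lia.
Qed.

Lemma killed_hscale (h : hup O O) u z : killed_by h z -> killed_by h (hscale u z).
Proof. by move=> hz c e; rewrite linearZ /= hz scaler0. Qed.

Lemma killed_component (h : hup O O) n a c (e : c = a + 1) z :
  killed_by h z -> h n a c e (hcomponent n a z) = 0.
Proof.
move=> hz; have [e1|ne] := eqVneq (h_ar z) n; last by rewrite hcomponent_out ?ne // linear0.
have [e2|ne] := eqVneq (h_deg z) a; last by rewrite hcomponent_out ?ne ?orbT // linear0.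
by case: z hz e1 e2 => m b x hz /= e1 e2; subst m b; rewrite hcomponentE; exact: hz.
Qed.

End Scaling.

Section Reordering.
Variables (k : comPzRingType) (O : operad k) (s : forall n, O n (n%:Z - 1)).
Variable m : nat.
Hypothesis m2 : (2 <= m)%N.

Definition drop_letter (t : nat) : nat := if t == m then 1%N else t.

(** What remains to be inserted once each letter m has been replaced by an identity: the letter m on
    that single input, and identities on the t inputs of any other letter t. *)
Definition letter_block (t : nat) : seq (helt O) :=
  if t == m then [:: letter s m] else nseq t (hid O).

Lemma size_letter_blocks w :
  size (flatten (map letter_block w)) = sumn (map drop_letter w).
Proof.
elim: w => //= t w IH; rewrite size_cat IH /letter_block /drop_letter.
by case: eqP => //; rewrite size_nseq.
Qed.

Lemma hcomp_from_letters_ar i z w : (1 <= i)%N -> (i + size w <= (h_ar z).+1)%N ->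
  (h_ar (hcomp_from i z (map (letter s) w)) + size w = h_ar z + sumn w)%N.
Proof.
move=> hi hs; have := @hcomp_from_ar _ _ z i (map (letter s) w) hi.
by rewrite size_map -map_comp (eq_map (letter_ar s)) map_id; exact.
Qed.

(** Inserting the letters m last leaves a root label that belongs to the stage before
    m. *)
Lemma hcomp_from_reorder w i z : (1 <= i)%N -> (i + size w <= (h_ar z).+1)%N ->
  exists u, hcomp_from i z (map (letter s) w) =
    hscale u (hcomp_from i (hcomp_from i z (map (letter s) (map drop_letter w)))
      (flatten (map letter_block w))).
Proof.
elim: w i z => [|t w IH] i z hi /=; first by exists 1; rewrite hscale1.
rewrite addnS ltnS => hs; rewrite [letter_block t]/letter_block [drop_letter t]/drop_letter.
case: (t =P m) => [->|tm].
  have har : h_ar (letter s m) = m by exact: letter_ar.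
  have h1 : (i + m + size w <= (h_ar (hcomp z i (letter s m))).+1)%N.
    by rewrite hcomp_ar ?har; lia.
  have [u e] := IH (i + m)%N (hcomp z i (letter s m)) ltac:(lia) h1.
  rewrite har e {e}.
  have -> : letter s 1 = hid O by [].
  rewrite [h_ar (hid O)]/= hcomp_idr; last by lia.
  have h3 : (i + 1 + size (map (letter s) (map drop_letter w)) <= (h_ar z).+1)%N.
    by rewrite !size_map; lia.
  have [u' e'] := hcomp_from_exch (letter s m) (ltac:(lia) : (1 <= i < i + 1)%N) h3.
  rewrite har in e'.
  move: e'; rewrite (_ : i + 1 + m - 1 = i + m)%N => [->|]; last by lia.
  have h4 : (i + 1 + size (map drop_letter w) <= (h_ar z).+1)%N by rewrite size_map; lia.
  have har' := hcomp_from_letters_ar (ltac:(lia) : (1 <= i + 1)%N) h4.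
  rewrite size_map in har'.
  rewrite /= har hscale_hcomp_from; first by exists (u * u'); rewrite hscaleA.
    by lia.
  by rewrite size_letter_blocks hcomp_ar ?har; lia.
have h1 : (i + h_ar (letter s t) + size w <= (h_ar (hcomp z i (letter s t))).+1)%N.
  by rewrite hcomp_ar ?letter_ar; lia.
have [u ->] := IH (i + h_ar (letter s t))%N (hcomp z i (letter s t)) ltac:(lia) h1.
have h2 : (i + h_ar (letter s t) + size (map drop_letter w) <=
    (h_ar (hcomp z i (letter s t))).+1)%N by rewrite size_map.
have har' := hcomp_from_letters_ar (ltac:(lia) : (1 <= i + h_ar (letter s t))%N) h2.
have hz : (0 < h_ar z)%N by lia.
rewrite size_map (hcomp_ar _ _ hz) in har'.
have ht := letter_ar s t.
by exists u; rewrite hcomp_from_ids ?ht //; rewrite ht in har' *; lia.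
Qed.

End Reordering.

(** * The homotopy on the stages of the cylinder *)

Section CylinderHomotopy.
Variables (k : comPzRingType) (A : A_infinity k) (F : A_filtration A).
Variable (I : A_cylinder F).

Notation stage := (cy_stage I).
Notation hI := (pc_h I).

Definition gen_i0 n : helt (Defs.interval (gen_dgseq k n)) :=
  Helt (@int_i0 k (gen_dgseq k n) _ _ (gen_elt k n)).
Definition gen_i1 n : helt (Defs.interval (gen_dgseq k n)) :=
  Helt (@int_i1 k (gen_dgseq k n) _ _ (gen_elt k n)).
Definition gen_sigma n : helt (Defs.interval (gen_dgseq k n)) :=
  Helt (@int_sigma k (gen_dgseq k n) _ _ _ (sigma_deg n) (gen_elt k n)).

Definition gen_val n (u : helt (Defs.interval (gen_dgseq k n.+2))) : helt I :=
  happly (cy_in I n.+2) (happly (cy_gen I n) u).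

Lemma gen_val_i0 n : gen_val (gen_i0 n.+2) = Helt (i0_mu I n.+2).
Proof.
rewrite /gen_val /gen_i0 /happly /= /i0_mu; congr Helt.
by rewrite -(ic_i0_v (cy_step I n)) -cy_i0 fl_gen_mu.
Qed.

Lemma gen_val_i1 n : gen_val (gen_i1 n.+2) = Helt (i1_mu I n.+2).
Proof.
rewrite /gen_val /gen_i1 /happly /= /i1_mu; congr Helt.
by rewrite -(ic_i1_v (cy_step I n)) -cy_i1 fl_gen_mu.
Qed.

Lemma gen_val_sigma n : gen_val (gen_sigma n.+2) = Helt (sigma_mu I n.+2).
Proof. by []. Qed.

Lemma happly_cy_inc n (x : helt (stage n)) :
  happly (cy_in I n.+1) (happly (cy_inc I n) x) = happly (cy_in I n) x.
Proof. by rewrite /happly /= cy_in_inc. Qed.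

Definition in_stage m (z : helt I) : Prop :=
  exists x : helt (stage m), happly (cy_in I m) x = z.

Lemma in_stage_leq m m' z : (m <= m')%N -> in_stage m z -> in_stage m' z.
Proof.
move=> /subnK <-; elim: (m' - m)%N => // i IH /IH [x <-].
by exists (happly (cy_inc I (i + m)) x); exact: happly_cy_inc.
Qed.

Lemma in_stage_gen n m (u : helt (Defs.interval (gen_dgseq k n.+2))) :
  (n.+2 <= m)%N -> in_stage m (gen_val u).
Proof. by move=> hm; apply: in_stage_leq hm _; exists (happly (cy_gen I n) u). Qed.

Lemma in_stage_i0 n m : (2 <= n <= m)%N -> in_stage m (Helt (i0_mu I n)).
Proof. by case: n => [|[|n]] // hm; rewrite -gen_val_i0; exact: in_stage_gen. Qed.

Lemma in_stage_i1 n m : (2 <= n <= m)%N -> in_stage m (Helt (i1_mu I n)).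
Proof. by case: n => [|[|n]] // hm; rewrite -gen_val_i1; exact: in_stage_gen. Qed.

Lemma in_stage_sigma n m : (2 <= n <= m)%N -> in_stage m (Helt (sigma_mu I n)).
Proof. by case: n => [|[|n]] // hm; rewrite -gen_val_sigma; exact: in_stage_gen. Qed.

Lemma in_stage_hid m : in_stage m (hid I).
Proof. by exists (hid (stage m)); rewrite happly_hid. Qed.

Lemma in_stage_hcomp_from m i z ys : (1 <= i)%N -> (i + size ys <= (h_ar z).+1)%N ->
  in_stage m z -> List.Forall (in_stage m) ys -> in_stage m (hcomp_from i z ys).
Proof.
move=> hi hs [x hx] hys.
have {hys} [ys' hys'] : exists ys', map (happly (cy_in I m)) ys' = ys.
  elim: hys {hs} => [|_ ys0 [y <-] _ [ys' <-]]; first by exists [::].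
  by exists (y :: ys').
subst z ys; exists (hcomp_from i x ys').
by rewrite happly_hcomp_from //; move: hs; rewrite size_map.
Qed.

Lemma killed_stage m (x : helt (stage m)) :
  killed_by (pc_h (stage m)) x -> killed_by hI (happly (cy_in I m) x).
Proof. by move=> hx c e; rewrite /= cy_h hx linear0. Qed.

(** Vanishing in the union descends to the stage because the stage embeds in it. *)
Lemma killed_stageE m (x : helt (stage m)) :
  killed_by hI (happly (cy_in I m) x) -> killed_by (pc_h (stage m)) x.
Proof.
move=> hx c e; apply: (@cy_in_inj _ _ _ I m); rewrite linear0.
by rewrite -cy_h; exact: hx.
Qed.

Section Stage.
Variable n : nat.
Notation labels := (Defs.label (gen_dgseq k n.+2) (stage n.+1)).

Definition stage_label_val (y : labels) : helt I :=
  happly (cy_in I n.+2) (label_val (cy_inc I n.+1) (cy_gen I n) y).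

Lemma stage_label_val_inl x : stage_label_val (inl x) = happly (cy_in I n.+1) x.
Proof. exact: happly_cy_inc. Qed.

Lemma label_h_kills (x : helt (stage n.+1)) : killed_by hI (happly (cy_in I n.+1) x) ->
  h_kills (cy_inc I n.+1) (cy_gen I n) (inl x).
Proof. by move=> /killed_stageE hx; rewrite /h_kills /hzero /= hx linear0. Qed.

Lemma label_p_kills (x : helt (stage n.+1)) :
  hzero (happly (pc_p I) (happly (cy_in I n.+1) x)) ->
  p_kills (cy_inc I n.+1) (cy_gen I n) (inl x).
Proof.
rewrite /p_kills /hzero /= cy_p => /eqP h.
have -> : pc_p (stage n.+1) _ _ (h_val x) = 0.
  by apply: (@fl_in_inj _ _ F n.+1); rewrite h linear0.
by rewrite !linear0.
Qed.

Lemma gen_i0_h_kills : h_kills (cy_inc I n.+1) (cy_gen I n) (inr (gen_i0 n.+2)).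
Proof. by rewrite /h_kills /hzero /= (spc_hi0 (interval_spc _)) linear0. Qed.

Lemma gen_sigma_h_kills : h_kills (cy_inc I n.+1) (cy_gen I n) (inr (gen_sigma n.+2)).
Proof.
rewrite /h_kills /hzero /= [X in cy_gen I n _ _ X](_ : _ = 0) ?linear0 //.
by rewrite /int_h_fun /= linear0.
Qed.

Lemma gen_sigma_p_kills : p_kills (cy_inc I n.+1) (cy_gen I n) (inr (gen_sigma n.+2)).
Proof.
rewrite /p_kills /hzero /= [X in cy_gen I n _ _ X](_ : _ = 0) ?linear0 //.
by rewrite /int_p_fun /= addr0 linear0.
Qed.

Lemma killed_even_stage (u : helt (Defs.interval (gen_dgseq k n.+2))) (cs : seq labels) :
  size cs = h_ar u ->
  h_kills (cy_inc I n.+1) (cy_gen I n) (inr u) ->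
  p_kills (cy_inc I n.+1) (cy_gen I n) (inr u) ||
    all (h_kills (cy_inc I n.+1) (cy_gen I n)) cs ->
  killed_by hI (hfull (gen_val u) (map stage_label_val cs)).
Proof.
move=> hs hu hcs; have [hV [D [hVP _ hp]]] := ic_h (cy_step I n).
have hk := perturbed_killed hp (killed_even_root hVP hs hu hcs).
by move/killed_stage: hk; rewrite happly_hfull ?size_map // -map_comp.
Qed.

Lemma killed_odd_stage (x : helt (stage n.+1))
    (cs : seq (option (helt (Defs.interval (gen_dgseq k n.+2))))) :
  size cs = h_ar x -> killed_by hI (happly (cy_in I n.+1) x) ->
  hzero (happly (pc_p I) (happly (cy_in I n.+1) x)) ||
    all (fun c => if c is Some u then h_kills (cy_inc I n.+1) (cy_gen I n) (inr u) else true) cs ->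
  killed_by hI (hfull (happly (cy_in I n.+1) x)
    (map (fun c => if c is Some u then gen_val u else hid I) cs)).
Proof.
move=> hs hx hcs; have [hV [D [hVP _ hp]]] := ic_h (cy_step I n).
have hcs' : p_kills (cy_inc I n.+1) (cy_gen I n) (inl x) ||
    all (fun c => if c is Some u then h_kills (cy_inc I n.+1) (cy_gen I n) (inr u) else true) cs.
  by case/orP: hcs => [/label_p_kills -> //|->]; rewrite orbT.
have hk := perturbed_killed hp (killed_odd_root hVP hs (label_h_kills hx) hcs').
move/killed_stage: hk; rewrite happly_hfull ?size_map // -map_comp happly_cy_inc.
by rewrite (eq_map (g := fun c => if c is Some u then gen_val u else hid I)) // => -[u|] //=;
  rewrite happly_hid.
Qed.

End Stage.

(** With identities at all its inputs, sigma mu_n is a tree value whose only new label is killed by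
    both h and p. *)
Lemma killed_sigma n : (2 <= n)%N -> killed_by hI (Helt (sigma_mu I n)).
Proof.
case: n => [|[|n]] // _.
have := @killed_even_stage n (gen_sigma n.+2) (nseq n.+2 (id_label _ _)).
move/(_ (size_nseq _ _) (gen_sigma_h_kills n)); rewrite gen_sigma_p_kills => /(_ isT).
rewrite map_nseq stage_label_val_inl happly_hid gen_val_sigma.
by rewrite (hfull_ids (Helt (sigma_mu I n.+2))).
Qed.

Lemma p_sigma n : (2 <= n)%N -> hzero (happly (pc_p I) (Helt (sigma_mu I n))).
Proof.
case: n => [|[|n]] // _; rewrite -gen_val_sigma /hzero /= cy_p.
rewrite (ic_p_v (cy_step I n)) [X in fl_gen F n _ _ X](_ : _ = 0) ?linear0 //.
by rewrite /int_p /= /int_p_fun /= addr0.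
Qed.

End CylinderHomotopy.

Lemma hfull_single (k : comPzRingType) (O : operad k) (z y : helt O) i :
  (1 <= i <= h_ar z)%N ->
  hfull z (nseq (i - 1) (hid O) ++ y :: nseq (h_ar z - i) (hid O)) = hcomp z i y.
Proof.
move=> hi; rewrite /hfull hcomp_from_ids //; last by lia.
rewrite (_ : 1 + (i - 1) = i)%N /=; last by lia.
rewrite -[nseq _ _]cats0 hcomp_from_ids //; first by lia.
by rewrite hcomp_ar; lia.
Qed.

Lemma stasheff_sum_map (k : comPzRingType) (O P : operad k) (f : op_map O P)
    (x y : nat -> helt O) n a : (forall p, h_ar (x p) = p) ->
  f n a (stasheff_sum x y n a) =
  stasheff_sum (fun p => happly f (x p)) (fun q => happly f (y q)) n a.
Proof.
move=> hx; rewrite /stasheff_sum linear_sum; apply: eq_bigr => p _ /=.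
rewrite linear_sum; apply: eq_bigr => q _ /=.
rewrite linear_sum; apply: eq_big_nat => i hi.
by rewrite linearZ /= -hcomponent_happly happly_hcomp ?hx.
Qed.

(** * The differential of [sigma mu_n] *)

Section CylinderDifferential.
Variables (k : comPzRingType) (A : A_infinity k) (F : A_filtration A).
Variable (I : A_cylinder F).

Notation hI := (pc_h I).
Notation sigma := (sigma_mu I).

Lemma letter_label n t : (1 <= t <= n.+2)%N -> exists y,
  stage_label_val (I := I) (n := n) y = letter sigma t /\
  h_kills (cy_inc I n.+1) (cy_gen I n) y.
Proof.
move=> ht; have [t1|t1] := eqVneq t 1%N.
  exists (id_label _ _); rewrite id_label_killed t1; split=> //.
  by rewrite stage_label_val_inl happly_hid.
have hl : letter sigma t = Helt (sigma t) by rewrite /letter (negbTE t1).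
have [tn|tn] := eqVneq t n.+2.
  by exists (inr (gen_sigma k n.+2)); rewrite gen_sigma_h_kills hl tn.
have [x hx] : in_stage n.+1 (Helt (sigma t)) by apply: in_stage_sigma; lia.
exists (inl x); rewrite stage_label_val_inl hx hl; split=> //.
by apply: label_h_kills; rewrite hx; apply: killed_sigma; lia.
Qed.

Lemma in_stage_letter m t : (1 <= t <= m)%N -> in_stage m (letter sigma t).
Proof.
move=> ht; rewrite /letter; case: eqP => t1; first exact: in_stage_hid.
by apply: in_stage_sigma; lia.
Qed.

(** Induction on the bound m of all arities. If the root is i_0 mu_m, it is a new generator and
    every letter is a label killed by h. Otherwise the root with the letters below m forms a single
    label of the previous stage, killed by the induction hypothesis, on which the sigma mu_m are
    grafted. *)
Lemma killed_word m u : all (fun w => 1 <= w <= m)%N u -> (2 <= size u <= m)%N ->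
  killed_by hI (word_elt (i0_mu I) sigma u).
Proof.
elim: m u => [|[|n] IH] u hu hs; try by lia.
have [su|su] := eqVneq (size u) n.+2.
  have [cs [hcs kcs]] : exists cs, map (@stage_label_val _ _ _ I n) cs = map (letter sigma) u /\
      all (h_kills (cy_inc I n.+1) (cy_gen I n)) cs.
    elim: (u) hu => [|t w IHw] /=; first by exists [::].
    case/andP=> /letter_label[y [hy ky]] /IHw[cs [<- kcs]].
    by exists (y :: cs); rewrite /= ky kcs hy.
  rewrite /word_elt su -gen_val_i0 -hcs; apply: killed_even_stage.
  - by rewrite -(size_map (@stage_label_val _ _ _ I n)) hcs size_map.
  - exact: gen_i0_h_kills.
  - by rewrite kcs orbT.
pose w := map (drop_letter n.+2) u.
have hw : all (fun t => 1 <= t <= n.+1)%N w.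
  rewrite all_map; apply: sub_all hu => t; rewrite /drop_letter /=.
  by case: eqP => //; lia.
have sw : size w = size u by rewrite size_map.
have kw : killed_by hI (word_elt (i0_mu I) sigma w) by apply: IH => //; lia.
have [x hx] : in_stage n.+1 (word_elt (i0_mu I) sigma w).
  apply: in_stage_hcomp_from => //; first by rewrite size_map.
    by apply: in_stage_i0; lia.
  elim: (w) hw => [|t w' IHw] /=; first by constructor.
  by case/andP=> ht /IHw hw; constructor => //; exact: in_stage_letter.
(* The inputs of the absorbed root label: each letter n + 2 provides one input, carrying the new
   generator, and any other letter t provides t leaves. *)
pose blk t := if t == n.+2 then [:: Some (gen_sigma k n.+2)] else nseq t None.
have hcs : map (fun c => if c is Some u then gen_val I u else hid I) (flatten (map blk u)) =
    flatten (map (letter_block sigma n.+2) u).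
  rewrite map_flatten -map_comp; congr flatten; apply: eq_map => t /=.
  by rewrite /blk /letter_block; case: eqP => //=; rewrite map_nseq.
have war : h_ar (word_elt (i0_mu I) sigma w) = sumn w.
  by apply: word_elt_ar; apply: sub_all hw => t /andP[].
have hfu : killed_by hI (hfull (word_elt (i0_mu I) sigma w)
    (flatten (map (letter_block sigma n.+2) u))).
  rewrite -hcs -hx; apply: killed_odd_stage.
  - rewrite -[h_ar x]/(h_ar (happly (cy_in I n.+1) x)) hx war.
    by rewrite -(size_letter_blocks sigma) -hcs size_map.
  - by rewrite hx.
  - apply/orP; right; rewrite all_flatten all_map; apply/allP => t _ /=.
    by rewrite /blk; case: eqP => _ /=; rewrite ?gen_sigma_h_kills // all_nseq orbT.
have hs' : (1 + size u <= (h_ar (Helt (i0_mu I (size u)))).+1)%N by [].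
have [c e] := hcomp_from_reorder sigma (isT : 2 <= n.+2)%N (isT : 1 <= 1)%N hs'.
rewrite /word_elt /hfull e; apply: killed_hscale.
by rewrite -/w -sw; exact: hfu.
Qed.

(** The label i_1 mu_q need not be killed by h, but sigma mu_p precedes it in the path order and is
    killed by both h and p. The larger of p and q decides whether the root is a new generator or a
    label of the previous stage. *)
Lemma killed_sigma_i1 p q i : (2 <= p)%N -> (2 <= q)%N -> (1 <= i <= p)%N ->
  killed_by hI (hcomp (Helt (sigma p)) i (Helt (i1_mu I q))).
Proof.
move=> hp hq hi; rewrite -hfull_single //=.
have [qp|pq] := leqP q p.
  case: p hp hi qp => [|[|n]] // _ hi qp.
  have [y hy] : exists y, @stage_label_val _ _ _ I n y = Helt (i1_mu I q).
    have [->|nq] := eqVneq q n.+2; first by exists (inr (gen_i1 k n.+2)); rewrite -gen_val_i1.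
    have [x hx] : in_stage n.+1 (Helt (i1_mu I q)) by apply: in_stage_i1; lia.
    by exists (inl x); rewrite stage_label_val_inl.
  have := @killed_even_stage _ _ _ I n (gen_sigma k n.+2)
    (nseq (i - 1) (id_label _ _) ++ y :: nseq (n.+2 - i) (id_label _ _)).
  rewrite gen_sigma_p_kills gen_sigma_h_kills map_cat /= !map_nseq hy.
  rewrite !stage_label_val_inl happly_hid size_cat /= !size_nseq; apply=> //.
  by lia.
case: q hq pq => [|[|n]] // _ pq.
have [x hx] : in_stage n.+1 (Helt (sigma p)) by apply: in_stage_sigma; lia.
have := @killed_odd_stage _ _ _ I n x
  (nseq (i - 1) None ++ Some (gen_i1 k n.+2) :: nseq (p - i) None).
rewrite hx map_cat /= !map_nseq gen_val_i1; apply.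
- rewrite size_cat /= !size_nseq -[h_ar x]/(h_ar (happly (cy_in I n.+1) x)) hx /=; lia.
- exact: killed_sigma.
- by rewrite p_sigma.
Qed.

Lemma p_word u : all (leq 1) u -> (2 <= size u)%N -> u != nseq (size u) 1%N ->
  hzero (happly (pc_p I) (word_elt (i0_mu I) sigma u)).
Proof.
move=> hu hs hne; rewrite /word_elt happly_hfull ?size_map //.
apply: hcomp_from_zero; rewrite ?size_map //; apply/orP; right.
rewrite -map_comp has_map.
have : has (leq 2) u.
  apply: contraR hne; rewrite -all_predC => h; apply/eqP/all_pred1P.
  by apply: sub_all (_ : all (predI (leq 1) (predC (leq 2))) u) => [t /=|]; [lia | rewrite all_predI hu].
apply: sub_has => t ht; rewrite /= /letter gtn_eqF //; exact: p_sigma.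
Qed.

Lemma d_sigma n d (e : n%:Z - 1 = n%:Z - 2 + 1) (e1 : n%:Z - 2 = d + 1) : (2 <= n)%N ->
  dg_d I n e (sigma n) = i0_mu I n - i1_mu I n
    - pc_h I n e1 (pc_i1 I n d (dg_d A n e1 (ai_mu A n))).
Proof.
case: n e e1 => [|[|n]] // e e1 _.
set x := gen_elt k n.+2.
pose sx := @int_sigma k (gen_dgseq k n.+2) _ _ _ (sigma_deg n.+2) x.
have hd := dm_d (cy_in I n.+2) e (cy_gen I n _ _ sx).
rewrite -[LHS]hd /= (tc_d (ic_coproduct (cy_step I n)) e sx) linearD /=.
rewrite cy_in_inc.
(* Only the middle component of sigma x is nonzero, so of the three terms of the twisting map only -
   h i_1 del x survives. *)
have del0 b c (f : c = b + 1) : fl_del F n n.+2 f 0 = 0 by exact: linear0.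
rewrite /del_interval /= /del_interval_fun /= del0 !linear0 add0r addr0 linearN /=.
rewrite -cy_h -cy_i1.
rewrite (eq_irrelevance (pred_eq e) (pred_eq (sigma_deg n.+2))) dcastK.
have del_mu c b (f : n.+2%:Z - 2 = c) (f1 : c = b + 1) (f2 : n.+2%:Z - 2 = b + 1) :
    fl_in F n.+1 _ _ (fl_del F n _ f1 (dcast f x)) = dg_d A _ f2 (ai_mu A n.+2).
  by case: c / f f1 => f1; rewrite (eq_irrelevance f2 f1) fl_del_mu.
have hdd : d = n.+2%:Z - 2 - 1 by lia.
subst d; rewrite (del_mu _ _ _ _ e1) (eq_irrelevance (esym _) e1); congr (_ - _).
have -> : ((0 + x, 0, 0 - x) : Defs.interval (gen_dgseq k n.+2) n.+2 (n.+2%:Z - 2)) =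
    h_val (gen_i0 k n.+2) - h_val (gen_i1 k n.+2).
  by rewrite /= /int_i0 /int_i1 /= /int_i0_fun /int_i1_fun; congr (_, _, _); rewrite /= ?subr0 ?add0r.
rewrite !linearB /=; congr (_ - _).
- have := gen_val_i0 I n; rewrite /gen_val /happly /=.
  by move/(congr1 (hcomponent n.+2 (n.+2%:Z - 2))); rewrite !hcomponentE.
- have := gen_val_i1 I n; rewrite /gen_val /happly /=.
  by move/(congr1 (hcomponent n.+2 (n.+2%:Z - 2))); rewrite !hcomponentE.
Qed.

Lemma d_i0_mu m d (e : m%:Z - 2 = d + 1) : (2 <= m)%N ->
  dg_d I m e (i0_mu I m) =
  stasheff_sum (fun p => Helt (i0_mu I p)) (fun q => Helt (i0_mu I q)) m d.
Proof.
move=> hm; rewrite -[LHS](dm_d (pc_i0 I) e (ai_mu A m)) /= ai_d //.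
exact: stasheff_sum_map.
Qed.

Lemma d_i1_mu m d (e : m%:Z - 2 = d + 1) : (2 <= m)%N ->
  dg_d I m e (i1_mu I m) =
  stasheff_sum (fun p => Helt (i1_mu I p)) (fun q => Helt (i1_mu I q)) m d.
Proof.
move=> hm; rewrite -[LHS](dm_d (pc_i1 I) e (ai_mu A m)) /= ai_d //.
exact: stasheff_sum_map.
Qed.

Lemma h_stasheff n c (e : c = n%:Z - 2 + 1) :
  pc_h I n e (stasheff_sum (fun p => Helt (sigma p)) (fun q => Helt (i1_mu I q)) n (n%:Z - 2)) = 0.
Proof.
rewrite /stasheff_sum linear_sum big1 // => p _ /=; rewrite linear_sum big1 // => q /and3P[hp hq _] /=.
rewrite linear_sum big_nat big1 // => i hi /=; rewrite linearZ /= killed_component ?scaler0 //.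
exact: killed_sigma_i1.
Qed.

Lemma p_stasheff n a :
  pc_p I n a (stasheff_sum (fun p => Helt (sigma p)) (fun q => Helt (i1_mu I q)) n a) = 0.
Proof.
rewrite stasheff_sum_map // /stasheff_sum big1 // => p _; rewrite big1 // => q /and3P[hp hq _].
rewrite big_nat big1 // => i hi; rewrite hcomponent_zero ?scaler0 //.
by apply: hcomp_zero => //; rewrite p_sigma.
Qed.

Lemma brace_sum_words n : brace_sum I n =
  \sum_(u <- short_words n.+2 | mixed_word n u)
    (-1) ^+ word_sgn 1 u *: hcomponent n (n%:Z - 2) (word_elt (i0_mu I) sigma u).
Proof. exact: (brace_gen_words (i0_mu I) sigma (leqnn n.+2)). Qed.

Lemma short_mixed_word n u : u \in short_words n.+2 -> mixed_word n u ->
  [/\ all (fun w => 1 <= w <= n)%N u, (2 <= size u <= n)%N & u != nseq (size u) 1%N].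
Proof.
rewrite mem_short_words => /andP[_ ha] /and3P[hs /eqP hn hne].
have all1 : all (leq 1) u by apply: sub_all ha => w /andP[].
split.
- apply/allP => w hw; rewrite (allP all1) //=; rewrite -hn; exact: leq_sumn.
- by rewrite hs -hn size_leq_sumn.
- apply: contraNneq hne => hu; rewrite hu; apply/eqP; congr nseq.
  by rewrite -hn [in RHS]hu sumn_nseq mul1n.
Qed.

Lemma h_brace n c (e : c = n%:Z - 2 + 1) : pc_h I n e (brace_sum I n) = 0.
Proof.
rewrite brace_sum_words linear_sum big_seq_cond big1 // => u /andP[hu hm] /=.
have [ha hs _] := short_mixed_word hu hm.
by rewrite linearZ /= killed_component ?scaler0 //; exact: killed_word ha hs.
Qed.

Lemma p_brace n : pc_p I n _ (brace_sum I n) = 0.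
Proof.
rewrite brace_sum_words linear_sum big_seq_cond big1 // => u /andP[hu hm] /=.
have [ha /andP[hs _] hne] := short_mixed_word hu hm.
rewrite linearZ /= -hcomponent_happly hcomponent_zero ?scaler0 //.
by apply: p_word => //; apply: sub_all ha => w /andP[].
Qed.

(** The claimed value of [h i1 d mu_n] is killed by h and p and has the same
    differential; by [i0 p - 1 = d h + h d] such an element is unique. *)
Lemma sigma_formula_cylinder : sigma_formula (I := I) (dg_d I).
Proof.
move=> n; elim/ltn_ind: n => n IH e hn.
set S := stasheff_sum _ _ n _; set B := brace_sum I n.
have e1 : n%:Z - 2 = (n%:Z - 2 - 1) + 1 by rewrite subrK.
have e2 : n%:Z - 2 - 1 = (n%:Z - 2 - 1 - 1) + 1 by rewrite subrK.
rewrite (d_sigma e e1 hn).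
pose z := pc_i1 I n _ (dg_d A n e1 (ai_mu A n)); set x := pc_h I n e1 _.
have spc := pc_spc I.
have dz : dg_d I n e2 z = 0.
  by rewrite -[LHS](dm_d (pc_i1 I) e2 _) /= dg_dd linear0.
have pz : pc_p I n _ z = dg_d A n e1 (ai_mu A n) by exact: (spc_pi1 spc).
have dx : dg_d I n e1 x = dg_d I n e1 (i0_mu I n) - dg_d I n e1 (i1_mu I n).
  have := spc_homotopy spc e2 e1 z; rewrite pz /= dz linear0 addr0 => <-.
  by rewrite -[X in _ = X - _](dm_d (pc_i0 I) e1 _) -[X in _ = _ - X](dm_d (pc_i1 I) e1 _).
(* This is the only place where the formula in smaller arities is needed. *)
have dB : dg_d I n e1 (i0_mu I n - i1_mu I n - S + B) = 0.
  apply: (@defect_cycle _ _ (i0_mu I) (i1_mu I) sigma n hn) => [m d f hm|m d f hm|m f].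
  - exact: d_i0_mu.
  - exact: d_i1_mu.
  - by case/andP=> hm hmn; exact: IH.
pose y := S - B - x.
suff y0 : y = 0.
  have -> : x = S - B by apply/eqP; rewrite -subr_eq0 -oppr_eq0 opprB; apply/eqP.
  by rewrite opprB addrA addrAC.
have dy : dg_d I n e1 y = 0.
  rewrite /y linearB /= dx -linearB /= -linearB /=.
  have E (V : zmodType) (a b s t : V) : s - t - (a - b) = - (a - b - s + t).
    by rewrite [RHS]opprD [X in _ = X - _]opprB addrAC.
  by rewrite E linearN /= dB oppr0.
have hy : pc_h I n e y = 0.
  by rewrite /y !linearB /= h_stasheff h_brace (spc_hh spc) !subr0.
have py : pc_p I n _ y = 0.
  by rewrite /y !linearB /= p_stasheff p_brace (spc_ph spc) !subr0.
have := spc_homotopy spc e1 e y; rewrite py hy /= dy !linear0 addr0 sub0r.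
by move/eqP; rewrite oppr_eq0 => /eqP.
Qed.

End CylinderDifferential.

(** * Free generation *)

Definition comp_op_map (k : comPzRingType) (O P Q : operad k) (g : op_map P Q)
    (f : op_map O P) : op_map O Q.
Proof.
refine (@OpMap k O Q (fun n a => GRing.Linear.clone _ _ _ _ (g n a \o f n a) _) _ _).
- by rewrite /= !om_id.
- by move=> p q r a b c e h i x y hi; rewrite /= !om_comp.
Defined.

Section ZeroDifferential.
Variables (k : comPzRingType) (O : operad k).

Definition zero_d : hdown O O :=
  fun n a c _ => GRing.Linear.clone _ _ _ _ (\0 : O n c -> O n a) _.

Lemma zero_leibniz : leibniz zero_d.
Proof.
move=> p q r a a' b b' c c' e ea eb ec f fl fr i x y hi /=.
by rewrite -!tcompE // linear0 tcomp0l scaler0 addr0.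
Qed.

Definition zero_dg_operad : dg_operad k :=
  @DGOperad k O zero_d (fun _ _ _ _ _ _ _ => erefl) zero_leibniz.

End ZeroDifferential.

(** * The initial DG-operad *)

Section UnitOperad.
Variable k : comPzRingType.

Definition unit_seq : gseq k := fun n a => 'rV[k]_((n == 1%N) && (a == 0)).

(** There is at most one entry, so the sum is the coordinate of u, and 0 in the zero modules,
    without a cast on the dimension. *)
Definition coef n a (u : unit_seq n a) : k :=
  \sum_i (u : 'rV[k]_((n == 1%N) && (a == 0))) 0 i.

Definition scalar n a (c : k) : unit_seq n a := const_mx c.

Lemma coef_scalar n a c : coef (scalar n a c) = if (n == 1%N) && (a == 0) then c else 0.
Proof.
rewrite /coef /scalar.
by case: (_ && _); rewrite ?big_ord1 ?big_ord0 ?mxE.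
Qed.

Lemma eq_coef n a (u v : unit_seq n a) : coef u = coef v -> u = v.
Proof.
rewrite /coef /unit_seq in u v *; case: (_ && _) u v => u v; last by rewrite [u]thinmx0 [v]thinmx0.
by rewrite !big_ord1 => h; apply/rowP => i; rewrite ord1.
Qed.

Lemma coefP n a s (u v : unit_seq n a) : coef (s *: u + v) = s * coef u + coef v.
Proof. by rewrite /coef mulr_sumr -big_split; apply: eq_bigr => i _; rewrite !mxE. Qed.

Lemma coef0 n a : coef (0 : unit_seq n a) = 0.
Proof. by rewrite /coef big1 // => l _; rewrite mxE. Qed.

Lemma coef_out n a (u : unit_seq n a) : ~~ ((n == 1%N) && (a == 0)) -> coef u = 0.
Proof. by rewrite /coef /unit_seq in u *; case: (_ && _) u => // u _; rewrite big_ord0. Qed.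

Definition unit_comp (p q r : nat) (a b c : int) (_ : (p + q = r.+1)%N) (_ : a + b = c)
    (_ : nat) (x : unit_seq p a) (y : unit_seq q b) : unit_seq r c :=
  scalar r c (coef x * coef y).

Lemma coef_unit_comp p q r a b c (e : (p + q = r.+1)%N) (f : a + b = c) i
    (x : unit_seq p a) (y : unit_seq q b) :
  coef (unit_comp e f i x y) = coef x * coef y.
Proof.
rewrite /unit_comp coef_scalar; case: ifP => // hr.
have [/andP[/eqP p1 /eqP a0]|hp] := boolP ((p == 1%N) && (a == 0)); last first.
  by rewrite (coef_out x hp) mul0r.
have [/andP[/eqP q1 /eqP b0]|hq] := boolP ((q == 1%N) && (b == 0)); last first.
  by rewrite (coef_out y hq) mulr0.
suff h : (r == 1%N) && (c == 0) by rewrite h in hr.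
by rewrite -f [in a + _]a0 [in 0 + _]b0 addr0 eqxx andbT; move: e; rewrite p1 q1 => -[<-].
Qed.

Lemma sgn_coef b c p q (y : unit_seq p b) (z : unit_seq q c) :
  sgn k (b * c) * (coef y * coef z) = coef y * coef z.
Proof.
have [/andP[_ /eqP b0]|hp] := boolP ((p == 1%N) && (b == 0)); last first.
  by rewrite (coef_out y hp) mul0r mulr0.
by rewrite [in sgn _ _]b0 mul0r sgn0 mul1r.
Qed.

Definition unit_operad : operad k.
Proof.
refine (@Operad k unit_seq (scalar 1 0 1) unit_comp _ _ _ _ _ _).
- move=> p q r a b c e f i u x x' y _; apply: eq_coef.
  by rewrite coefP !coef_unit_comp coefP mulrDl mulrA.
- move=> p q r a b c e f i u x y y' _; apply: eq_coef.
  by rewrite coefP !coef_unit_comp coefP mulrDr mulrCA.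
- move=> *; apply: eq_coef; rewrite !coef_unit_comp mulrA //.
- move=> p q s pq ps r a b c ab ac abc e1 f1 e2 f2 e3 f3 e4 f4 i j x y z _ _.
  apply: eq_coef; rewrite -[_ *: _]addr0 coefP !coef_unit_comp.
  rewrite coef0 addr0 -[coef x * coef z * _]mulrA [coef z * _]mulrC [sgn k _ * _]mulrCA.
  by rewrite sgn_coef mulrA.
- by move=> n a e f x; apply: eq_coef; rewrite coef_unit_comp coef_scalar mul1r.
- by move=> n a e f i x _; apply: eq_coef; rewrite coef_unit_comp coef_scalar mulr1.
Defined.

Definition unit_dg_operad : dg_operad k := zero_dg_operad unit_operad.

Variable O : dg_operad k.

Definition unit_fun n a (u : unit_seq n a) : O n a :=
  hcomponent n a (Helt (coef u *: op_id O)).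

Fact unit_fun_linear n a : linear (@unit_fun n a).
Proof.
by move=> s u v; rewrite /unit_fun coefP scalerDl -scalerA hcomponentP.
Qed.
HB.instance Definition _ n a :=
  GRing.isLinear.Build k (unit_seq n a) (O n a) *:%R (@unit_fun n a) (@unit_fun_linear n a).

Definition unit_hmap : hmap unit_operad O := fun n a => @unit_fun n a.

Lemma unit_fun_out n a (u : unit_seq n a) : ~~ ((n == 1%N) && (a == 0)) -> unit_fun u = 0.
Proof.
by move=> h; rewrite /unit_fun hcomponent_out //= -negb_and [_ == n]eq_sym [_ == a]eq_sym.
Qed.

Definition unit_op_map : op_map unit_operad O.
Proof.
refine (@OpMap k unit_operad O unit_hmap _ _).
- by rewrite /unit_hmap /= /unit_fun coef_scalar /= scale1r hcomponentE.
- move=> p q r a b c e f i x y hi; rewrite /unit_hmap /=.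
  have [/andP[/eqP p1 /eqP a0]|hp] := boolP ((p == 1%N) && (a == 0)); last first.
    rewrite (unit_fun_out x hp) -tcompE // tcomp0l /unit_fun coef_unit_comp (coef_out x hp).
    by rewrite mul0r scale0r hcomponent_zero // /hzero.
  have [/andP[/eqP q1 /eqP b0]|hq] := boolP ((q == 1%N) && (b == 0)); last first.
    rewrite (unit_fun_out y hq) -tcompE // linear0 /unit_fun coef_unit_comp (coef_out y hq).
    by rewrite mulr0 scale0r hcomponent_zero // /hzero.
  subst p q a b; have hr : r = 1%N by move: e => -[].
  subst r c; rewrite /unit_fun coef_unit_comp !hcomponentE op_compZl // op_compZr //.
  by rewrite scalerA op_idr.
Defined.

Lemma unit_op_map_d : chain_map (X := dg_seq unit_dg_operad) (Y := dg_seq O) unit_op_map.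
Proof.
move=> n a c e u /=; rewrite linear0 /unit_hmap /= /unit_fun.
have [hn|ne] := eqVneq 1%N n; last by rewrite hcomponent_out ?linear0 //= ne.
have [hc|ne] := eqVneq 0 c; last by rewrite hcomponent_out ?linear0 //= ne orbT.
subst n; case: c / hc e u => e u.
by rewrite hcomponentE linearZ /= (derivation_id _ (@dg_leibniz k O)) scaler0.
Qed.

Definition unit_dg_map : dg_map unit_dg_operad O := @DGMap k unit_dg_operad O unit_op_map unit_op_map_d.

End UnitOperad.

Definition comp_dg_map (k : comPzRingType) (O P Q : dg_operad k) (g : dg_map P Q)
    (f : dg_map O P) : dg_map O Q.
Proof.
refine (@DGMap k O Q (comp_op_map g f) _).
by move=> n a c e x; rewrite /= (dm_d f) (dm_d g).
Defined.

Section Initial.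
Variables (k : comPzRingType) (O : dg_operad k).
Hypothesis O_init : is_initial O.

(** Initiality concerns DG-operads, so Q is given the zero differential. *)
Lemma initial_op_map (Q : operad k) : exists f : op_map O Q, True.
Proof. by have [f _] := O_init (zero_dg_operad Q); exists f. Qed.

(** By uniqueness the identity of O factors through the explicit operad k id. Hence two operad maps
    out of O agree even when no differential is preserved. *)
Lemma initial_scalar n a (x : O n a) : exists c : k, x = hcomponent n a (Helt (c *: op_id O)).
Proof.
have [f0 hf0] := O_init O; have [f _] := O_init (unit_dg_operad k).
exists (coef (f n a x)).
by rewrite [LHS](hf0 (id_dg_map O)) -(hf0 (comp_dg_map (unit_dg_map O) f)).
Qed.

Lemma initial_op_map_unique (Q : operad k) (f g : op_map O Q) n a (x : O n a) :
  f n a x = g n a x.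
Proof.
have [c ->] := initial_scalar x; rewrite -!hcomponent_happly; congr (hcomponent n a _).
by rewrite /happly /= !linearZ /= !om_id.
Qed.

End Initial.

(** * Maps out of the interval on one generator *)

Section GeneratorMaps.
Variables (k : comPzRingType) (n : nat).

Lemma gen_seq_span m a (u : gen_dgseq k n m a) :
  exists c : k, u = hcomponent m a (Helt (c *: gen_elt k n)).
Proof.
have [/andP[/eqP hm /eqP ha]|h] := boolP ((m == n) && (a == n%:Z - 2)); last first.
  exists 0; rewrite scale0r hcomponent_zero /hzero //.
  by move: u h; rewrite /= /gen_seq; case: (_ && _) => // u _; rewrite [u]thinmx0.
(* The coefficient is the unique entry of u; the index is cast because the dimension is the value of
   a boolean test, equal to 1 only by rewriting. *)
subst m a; exists ((u : 'rV_((n == n) && (n%:Z - 2 == n%:Z - 2))) 0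
   (cast_ord (esym (congr1 nat_of_bool (introT andP (conj (eqxx n) (eqxx _))))) ord0)).
rewrite hcomponentE; apply/rowP => i; rewrite !mxE mulr1; congr (u _ _); apply: val_inj.
by case: i => -[|i] //=; rewrite !eqxx.
Qed.

Variables (V : gseq k) (y0 y1 : V n (n%:Z - 2)) (ys : V n (n%:Z - 1)).

Definition total m a (u : gen_dgseq k n m a) : k :=
  \sum_i (u : 'rV[k]_((m == n) && (a == n%:Z - 2))) 0 i.

Lemma totalP m a c (u v : gen_dgseq k n m a) : total (c *: u + v) = c * total u + total v.
Proof. by rewrite /total mulr_sumr -big_split; apply: eq_bigr => i _; rewrite !mxE. Qed.

Lemma total_gen : total (gen_elt k n) = 1.
Proof.
by rewrite /total /gen_elt; under eq_bigr do rewrite mxE; rewrite sumr_const card_ord !eqxx.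
Qed.

Lemma total0 m a : total (0 : gen_dgseq k n m a) = 0.
Proof. by rewrite /total big1 // => i _; rewrite mxE. Qed.

Lemma total_dcast m a b (e : a = b) (u : gen_dgseq k n m a) : total (dcast e u) = total u.
Proof. by case: b / e. Qed.

Definition gen_map_fun m a (z : Defs.interval (gen_dgseq k n) m a) : V m a :=
  total z.1.1 *: hcomponent m a (Helt y0) + total z.1.2 *: hcomponent m a (Helt ys) +
  total z.2 *: hcomponent m a (Helt y1).

Fact gen_map_linear m a : linear (@gen_map_fun m a).
Proof.
move=> c x z; rewrite /gen_map_fun /= !totalP !scalerDl !scalerDr -!scalerA.
by rewrite [X in X + _ = _]addrACA [LHS]addrACA.
Qed.
HB.instance Definition _ m a :=
  GRing.isLinear.Build k (Defs.interval (gen_dgseq k n) m a) (V m a) *:%R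
    (@gen_map_fun m a) (@gen_map_linear m a).

Definition gen_map : hmap (Defs.interval (gen_dgseq k n)) V := fun m a => @gen_map_fun m a.

Lemma gen_map_i0 : gen_map _ _ (h_val (gen_i0 k n)) = y0.
Proof.
rewrite /gen_map /gen_i0 /= /gen_map_fun /= total_gen !total0 !scale0r !addr0 scale1r.
exact: hcomponentE.
Qed.

Lemma gen_map_i1 : gen_map _ _ (h_val (gen_i1 k n)) = y1.
Proof.
rewrite /gen_map /gen_i1 /= /gen_map_fun /= total_gen !total0 !scale0r !add0r scale1r.
exact: hcomponentE.
Qed.

Lemma gen_map_sigma : gen_map _ _ (h_val (gen_sigma k n)) = ys.
Proof.
rewrite /gen_map /gen_sigma /= /gen_map_fun /= total_dcast total_gen !total0 !scale0r.
by rewrite add0r addr0 scale1r; exact: hcomponentE.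
Qed.

Lemma gen_hmap_eq (f g : hmap (Defs.interval (gen_dgseq k n)) V) :
  f _ _ (h_val (gen_i0 k n)) = g _ _ (h_val (gen_i0 k n)) ->
  f _ _ (h_val (gen_i1 k n)) = g _ _ (h_val (gen_i1 k n)) ->
  f _ _ (h_val (gen_sigma k n)) = g _ _ (h_val (gen_sigma k n)) ->
  forall m a x, f m a x = g m a x.
Proof.
move=> h0 h1 hs m a x.
suff [hi0 hi1 his] : [/\ forall u, f m a (u, 0, 0) = g m a (u, 0, 0),
    forall u, f m a (0, 0, u) = g m a (0, 0, u)
  & forall u, f m a (0, u, 0) = g m a (0, u, 0)].
  case: x => [[u w] v].
  have -> : (u, w, v) = (u, 0, 0) + ((0, w, 0) + (0, 0, v)) :> Defs.interval (gen_dgseq k n) m a.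
    by congr (_, _, _); rewrite /= ?addr0 ?add0r.
  by rewrite !linearD /= hi0 hi1 his.
have dcastE m' b b' (e : b = b') (u : gen_dgseq k n m' b) :
    dcast e u = hcomponent m' b' (Helt u).
  by case: b' / e; rewrite hcomponentE.
split=> u; have [c ->] := gen_seq_span u.
- rewrite -[(_, 0, 0)]/(@int_i0 k (gen_dgseq k n) m a _) -!hcomponent_happly.
  congr (hcomponent m a _); rewrite /happly /= !linearZ /=; congr (Helt (_ *: _)).
  exact: h0.
- rewrite -[(0, 0, _)]/(@int_i1 k (gen_dgseq k n) m a _) -!hcomponent_happly.
  congr (hcomponent m a _); rewrite /happly /= !linearZ /=; congr (Helt (_ *: _)).
  exact: h1.
- have -> : ((0, hcomponent m (a - 1) (Helt (c *: gen_elt k n)), 0) :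
       Defs.interval (gen_dgseq k n) m a) = hcomponent m a (Helt (c *: h_val (gen_sigma k n))).
    have [hm|hm] := eqVneq n m; last by rewrite !hcomponent_out //= hm.
    have [ha|ha] := eqVneq (n%:Z - 1) a; last first.
      rewrite !hcomponent_out //=; rewrite ?ha ?orbT //; apply/orP; right.
      by apply: contraNneq ha => h; lia.
    subst m a; rewrite [in RHS]hcomponentE /= /int_sigma /= /int_sigma_fun.
    by congr (_, _, _); rewrite /= ?scaler0 // dcastE hcomponentZ.
  rewrite -!hcomponent_happly; congr (hcomponent m a _).
  by rewrite /happly /= !linearZ /=; congr (Helt (_ *: _)).
Qed.

End GeneratorMaps.

(** * Operad maps out of the union of the stages *)

Section ColimitMaps.
Variables (k : comPzRingType) (A : A_infinity k) (F : A_filtration A).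
Variable (I : A_cylinder F).
Notation stage n := (cy_stage I n).

Lemma stage1_op_map (Q : operad k) : exists f : op_map (stage 1) Q, True.
Proof. rewrite (cy_stage1 I); exact: (initial_op_map (fl_initial1 F)). Qed.

Lemma stage1_op_map_unique (Q : operad k) (f g : op_map (stage 1) Q) n a
  (x : stage 1 n a) : f n a x = g n a x.
Proof.
move: f g x; rewrite (cy_stage1 I) => f g x.
exact: (initial_op_map_unique (fl_initial1 F)).
Qed.

Lemma cylinder_op_map_unique (Q : operad k) (f g : op_map I Q) :
  (forall m, f _ _ (i0_mu I m.+2) = g _ _ (i0_mu I m.+2)) ->
  (forall m, f _ _ (i1_mu I m.+2) = g _ _ (i1_mu I m.+2)) ->
  (forall m, f _ _ (sigma_mu I m.+2) = g _ _ (sigma_mu I m.+2)) ->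
  forall n a (x : I n a), f n a x = g n a x.
Proof.
move=> h0 h1 hs.
have hstage m : forall n a (x : stage m.+1 n a),
    f n a (cy_in I m.+1 n a x) = g n a (cy_in I m.+1 n a x).
  elim: m => [|m IH] n a x.
    exact: (stage1_op_map_unique (comp_op_map f (cy_in I 1)) (comp_op_map g (cy_in I 1))).
  apply: (tc_unique (ic_coproduct (cy_step I m))
    (F := comp_op_map f (cy_in I m.+2)) (G := comp_op_map g (cy_in I m.+2))) => {n a x}.
    by move=> n a x; rewrite /= !cy_in_inc; exact: IH.
  have eq_gen (u : helt (Defs.interval (gen_dgseq k m.+2))) (w : helt I) :
      gen_val I u = w -> f _ _ (h_val w) = g _ _ (h_val w) ->
      f _ _ (cy_in I m.+2 _ _ (cy_gen I m _ _ (h_val u))) =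
      g _ _ (cy_in I m.+2 _ _ (cy_gen I m _ _ (h_val u))) by move=> <-.
  apply: (gen_hmap_eq (f := fun n a => GRing.Linear.clone _ _ _ _
     (f n a \o cy_in I m.+2 n a \o cy_gen I m n a) _)
   (g := fun n a => GRing.Linear.clone _ _ _ _
     (g n a \o cy_in I m.+2 n a \o cy_gen I m n a) _)) => /=.
  - exact: (eq_gen _ _ (gen_val_i0 I m) (h0 m)).
  - exact: (eq_gen _ _ (gen_val_i1 I m) (h1 m)).
  - exact: (eq_gen _ _ (gen_val_sigma I m) (hs m)).
move=> n a x; have [[|m] [y <-]] := cy_union x; last exact: hstage.
by rewrite -cy_in_inc; exact: hstage.
Qed.

Variables (Q : operad k) (fs : forall m, op_map (stage m.+1) Q).
Hypothesis fs_inc : forall m n a (x : stage m.+1 n a),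
  fs m.+1 n a (cy_inc I m.+1 n a x) = fs m n a x.

Lemma stage_lift i m n a (x : stage m.+1 n a) : exists y : stage (i + m).+1 n a,
  cy_in I (i + m).+1 n a y = cy_in I m.+1 n a x /\ fs (i + m) n a y = fs m n a x.
Proof.
elim: i => [|i [y [hy hy']]]; first by exists x.
exists (cy_inc I (i + m).+1 n a y); split.
  by rewrite -hy; exact: cy_in_inc.
by rewrite -hy'; exact: fs_inc.
Qed.

(** The union property is a mere existence statement, while a map out of the union is a function; a
    representative is therefore chosen by indefinite description. *)
Definition colim_rep n a (x : I n a) :
  {m & {y : stage m.+1 n a | cy_in I m.+1 n a y = x}}.
Proof.
have h : exists m, exists y : stage m.+1 n a, cy_in I m.+1 n a y = x.
  have [[|m] [y <-]] := cy_union x; last by exists m, y.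
  by exists 0%N, (cy_inc I 0 n a y); rewrite cy_in_inc.
have [m hm] := constructive_indefinite_description _ h.
by exists m; exact: (constructive_indefinite_description _ hm).
Qed.

Definition colim_fun n a (x : I n a) : Q n a :=
  fs (projT1 (colim_rep x)) n a (proj1_sig (projT2 (colim_rep x))).

(** Two representatives lift to a common stage, where they coincide by injectivity, so the choice is
    irrelevant. *)
Lemma colim_funE m n a (y : stage m.+1 n a) :
  colim_fun (cy_in I m.+1 n a y) = fs m n a y.
Proof.
rewrite /colim_fun; case: (colim_rep _) => m' [y' hy] /=.
have [z [hz <-]] := stage_lift m y'; have [w [hw <-]] := stage_lift m' y.
move: z w hz hw; rewrite addnC => z w hz hw; congr (fs _ n a _).
by apply: (@cy_in_inj _ _ _ I (m' + m).+1); rewrite hz hw hy.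
Qed.

Lemma colim_common n n' a a' (x : I n a) (x' : I n' a') :
  exists m, exists y : stage m.+1 n a, exists y' : stage m.+1 n' a',
  cy_in I m.+1 n a y = x /\ cy_in I m.+1 n' a' y' = x'.
Proof.
case: (colim_rep x) => m [y hy]; case: (colim_rep x') => m' [y' hy'].
have [z [hz _]] := stage_lift m' y.
have := stage_lift m y'; rewrite (addnC m m') => -[w [hw _]].
by exists (m' + m)%N, z, w; rewrite hz hw.
Qed.

Fact colim_linear n a : linear (@colim_fun n a).
Proof.
move=> u x x'; have [m [y [y' [<- <-]]]] := colim_common x x'.
by rewrite -linearP !colim_funE linearP.
Qed.
HB.instance Definition _ n a :=
  GRing.isLinear.Build k (I n a) (Q n a) *:%R (@colim_fun n a) (@colim_linear n a).

Lemma colim_id : colim_fun (op_id I) = op_id Q.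
Proof. by rewrite -(om_id (cy_in I 1)) colim_funE om_id. Qed.

Lemma colim_comp p q r a b c (e : (p + q = r.+1)%N) (f : a + b = c) i
    (x : I p a) (y : I q b) : (1 <= i <= p)%N ->
  colim_fun (op_comp e f i x y) = op_comp e f i (colim_fun x) (colim_fun y).
Proof.
move=> hi; have [m [x' [y' [<- <-]]]] := colim_common x y.
by rewrite -om_comp // !colim_funE om_comp.
Qed.

Definition colim_hmap : hmap I Q := fun n a => @colim_fun n a.

Definition colim_op_map : op_map I Q :=
  @OpMap k I Q colim_hmap colim_id colim_comp.

End ColimitMaps.

Section Freeness.
Variables (k : comPzRingType) (A : A_infinity k) (F : A_filtration A).
Variable (I : A_cylinder F).
Notation stage n := (cy_stage I n).

Lemma cylinder_op_map (Q : operad k) (y0 y1 : forall m, Q m (m%:Z - 2))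
    (ys : forall m, Q m (m%:Z - 1)) : exists f : op_map I Q, forall m,
  [/\ f _ _ (i0_mu I m.+2) = y0 m.+2, f _ _ (i1_mu I m.+2) = y1 m.+2
    & f _ _ (sigma_mu I m.+2) = ys m.+2].
Proof.
pose g m := gen_map (y0 m.+2) (y1 m.+2) (ys m.+2).
(* The extension is packed with its properties in a sigma type so that the recursion defining [fs]
   can use it. *)
have step m (f : op_map (stage m.+1) Q) : {f' : op_map (stage m.+2) Q |
    (forall n a (x : stage m.+1 n a), f' n a (cy_inc I m.+1 n a x) = f n a x) /\
    (forall n a x, f' n a (cy_gen I m n a x) = g m n a x)}.
  apply: constructive_indefinite_description.
  exact: (tc_exists (ic_coproduct (cy_step I m)) f (g m)).
have [f1 _] := stage1_op_map I Q.
pose fs := fix fs m : op_map (stage m.+1) Q :=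
  if m is m'.+1 then proj1_sig (step m' (fs m')) else f1.
have fs_inc m : forall n a (x : stage m.+1 n a),
    fs m.+1 n a (cy_inc I m.+1 n a x) = fs m n a x.
  by have [] := proj2_sig (step m (fs m)).
have fs_gen m (u : helt (Defs.interval (gen_dgseq k m.+2))) (w : helt I) (y : Q (h_ar w) (h_deg w)) :
    gen_val I u = w -> Helt (g m _ _ (h_val u)) = Helt y ->
    colim_op_map fs_inc _ _ (h_val w) = y.
  move=> hw; subst w => hy.
  have := colim_funE fs_inc (cy_gen I m _ _ (h_val u)) (m := m.+1).
  have [_ hg] := proj2_sig (step m (fs m)); rewrite [fs m.+1 _ _ _]hg => e.
  apply: etrans e _; move/(congr1 (hcomponent (h_ar u) (h_deg u))): hy.
  by rewrite !hcomponentE.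
exists (colim_op_map fs_inc) => m; split.
- by apply: (fs_gen m _ (Helt _) (y0 m.+2) (gen_val_i0 I m)); rewrite gen_map_i0.
- by apply: (fs_gen m _ (Helt _) (y1 m.+2) (gen_val_i1 I m)); rewrite gen_map_i1.
- by apply: (fs_gen m _ (Helt _) (ys m.+2) (gen_val_sigma I m)); rewrite gen_map_sigma.
Qed.

Lemma cylinder_free :
  freely_generated (fun g => 2 <= cyl_gen_arity g)%N (@cyl_gen_elt k A F I).
Proof.
split=> [Q y|Q f g h].
  have [f hf] := cylinder_op_map (fun m => y (Gen_i0 m)) (fun m => y (Gen_i1 m))
    (fun m => y (Gen_sigma m)).
  by exists f; case=> -[|[|m]] // _; have [] := hf m.
apply: cylinder_op_map_unique => m.
- exact: (h (Gen_i0 m.+2)).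
- exact: (h (Gen_i1 m.+2)).
- exact: (h (Gen_sigma m.+2)).
Qed.

End Freeness.

(** * Uniqueness of the differential *)

(** A derivation D of degree -1 is the same thing as a section
    [x |-> x + epsilon D x] of the operad [O + epsilon O], where epsilon has degree 1
    and square zero. *)
Section DualNumbers.
Variables (k : comPzRingType) (O : operad k).

Definition dual_seq : gseq k := fun n a => (O n a * O n (a - 1))%type.

Lemma deg_pred_l (a b c : int) : a + b = c -> (a - 1) + b = c - 1.
Proof. by move=> <-; rewrite addrAC. Qed.

Lemma deg_pred_r (a b c : int) : a + b = c -> a + (b - 1) = c - 1.
Proof. by move=> <-; rewrite addrA. Qed.

(** The second component is the coefficient of epsilon; the sign arises from moving epsilon past
    x. *)
Definition dual_comp (p q r : nat) (a b c : int) (e : (p + q = r.+1)%N) (f : a + b = c)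
    (i : nat) (x : dual_seq p a) (y : dual_seq q b) : dual_seq r c :=
  (op_comp e f i x.1 y.1,
   op_comp e (deg_pred_l f) i x.2 y.1 + sgn k a *: op_comp e (deg_pred_r f) i x.1 y.2).

Definition dual_operad : operad k.
Proof.
refine (@Operad k dual_seq (op_id O, 0) dual_comp _ _ _ _ _ _).
- move=> p q r a b c e f i u x x' y hi; congr pair; rewrite /= ?op_comp_linl //.
  by rewrite !scalerDr !scalerA [sgn _ _ * u]mulrC addrACA.
- move=> p q r a b c e f i u x y y' hi; congr pair; rewrite /= ?op_comp_linr //.
  by rewrite !scalerDr !scalerA [sgn _ _ * u]mulrC addrACA.
- move=> p q s qs pq r a b c bc ab abc e1 f1 e2 f2 e3 f3 e4 f4 i j x y z hi hj.
  have hij : (1 <= i + j - 1 <= pq)%N by lia.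
  congr pair; rewrite /=; first exact: op_assoc.
  rewrite -!tcompE // !linearD !linearZ /= tcompDl tcompZl.
  rewrite (@tcomp_assoc _ _ p q s _ pq _ _ _ _ _ _ _ _ _ (deg_pred_l f3) (deg_pred_l f4)) //.
  rewrite (@tcomp_assoc _ _ p q s _ pq _ _ _ _ _ _ _ _ _ (deg_pred_r f3) (deg_pred_l f4)) //.
  rewrite (@tcomp_assoc _ _ p q s _ pq _ _ _ _ _ _ _ _ _ f3 (deg_pred_r f4)) //.
  by rewrite !scalerA addrA -[in sgn k ab]f3 sgnD [sgn k b * _]mulrC.
- move=> p q s pq ps r a b c ab ac abc e1 f1 e2 f2 e3 f3 e4 f4 i j x y z hj hi.
  have h1 : (1 <= j <= pq)%N by lia.
  have h2 : (1 <= i + s - 1 <= ps)%N by lia.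
  have h3 : (1 <= i <= p)%N by lia.
  have h4 : (1 <= j <= p)%N by lia.
  congr pair; rewrite /=; first exact: op_exch.
  rewrite -!tcompE // !tcompDl !tcompZl.
  rewrite (@tcomp_exch _ _ p q s pq ps _ _ _ _ _ _ _ (deg_pred_l f1) (deg_pred_l f2)
    (deg_pred_l f3) (deg_pred_l f4)) //.
  rewrite (@tcomp_exch _ _ p q s pq ps _ _ _ _ _ _ _ (deg_pred_r f1) (deg_pred_l f2) f3 (deg_pred_r f4)) //.
  rewrite (@tcomp_exch _ _ p q s pq ps _ _ _ _ _ _ _ f1 (deg_pred_r f2) (deg_pred_r f3) (deg_pred_l f4)) //.
  rewrite !scalerDr !scalerA -!addrA; congr (_ + _); rewrite addrC; congr (_ *: _ + _ *: _).
    by rewrite -!sgnD -f1; apply: eq_sgn; rewrite mulrBr mulr1; lia.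
  by rewrite -!sgnD -f3; apply: eq_sgn; rewrite mulrBl mul1r; lia.
- move=> n a e f x; rewrite /dual_comp /= sgn0 scale1r !op_idl.
  by rewrite -tcompE // tcomp0l add0r; case: x.
- move=> n a e f i x hi; rewrite /dual_comp /= !op_idr //.
  by rewrite -[X in _ + _ *: X]tcompE // linear0 scaler0 addr0; case: x.
Defined.

Variable D : hdown O O.
Hypothesis D_leibniz : leibniz D.

Definition dual_fun n a (x : O n a) : dual_seq n a := (x, D n (esym (subrK 1 a)) x).

Fact dual_fun_linear n a : linear (@dual_fun n a).
Proof. by move=> u x y; rewrite /dual_fun linearP. Qed.
HB.instance Definition _ n a :=
  GRing.isLinear.Build k (O n a) (dual_seq n a) *:%R (@dual_fun n a) (@dual_fun_linear n a).

Definition dual_hmap : hmap O dual_operad := fun n a => @dual_fun n a.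

Definition dual_op_map : op_map O dual_operad.
Proof.
refine (@OpMap k O dual_operad dual_hmap _ _).
- by rewrite /dual_hmap /= /dual_fun derivation_id.
- move=> p q r a b c e f i x y hi; rewrite /dual_hmap /= /dual_fun /dual_comp /=.
  by rewrite (D_leibniz e (esym (subrK 1 a)) (esym (subrK 1 b)) (esym (subrK 1 c)) f
    (deg_pred_l f) (deg_pred_r f)).
Defined.

End DualNumbers.

(** The sections defined by D and D' are operad maps, so it suffices to compare them on the free
    generators. *)
Lemma cylinder_differential_unique (k : comPzRingType) (A : A_infinity k)
    (F : A_filtration A) (I : A_cylinder F) (D D' : hdown I I) :
  cylinder_differential D -> cylinder_differential D' ->
  forall n (a c : int) (e : c = a + 1) (x : I n c), D n a c e x = D' n a c e x.
Proof.
move=> [hl h0 h1 hs] [hl' h0' h1' hs'] n a c e x.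
suff h : forall n c (x : I n c), dual_op_map hl n c x = dual_op_map hl' n c x.
  have ha : a = c - 1 by rewrite e addrK.
  subst a; rewrite (eq_irrelevance e (esym (subrK 1 c))).
  by case: (h n c x).
apply: cylinder_op_map_unique => m.
- by rewrite /= /dual_hmap /= /dual_fun /i0_mu h0 h0'.
- by rewrite /= /dual_hmap /= /dual_fun /i1_mu h1 h1'.
- rewrite /= /dual_hmap /= /dual_fun; congr pair.
  have : m.+2%:Z - 1 - 1 = m.+2%:Z - 2 by lia.
  move: (m.+2%:Z - 1 - 1) (esym _) => b f hb; subst b.
  by rewrite hs ?hs'.
Qed.

Theorem theorem2p2 (k : comPzRingType) (A : A_infinity k) (F : A_filtration A)
    (I : A_cylinder F) :
  freely_generated (fun g => 2 <= cyl_gen_arity g)%N (@cyl_gen_elt k A F I) /\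
  cylinder_differential (I := I) (dg_d I) /\
  (forall D : hdown I I, cylinder_differential D ->
     forall n (a c : int) (e : c = a + 1) (x : I n c), D n a c e x = dg_d I n e x).
Proof.
have hd : cylinder_differential (I := I) (dg_d I).
  split; [exact: dg_leibniz | | | exact: sigma_formula_cylinder] => n a c e x.
  - by rewrite [RHS](dm_d (pc_i0 I)).
  - by rewrite [RHS](dm_d (pc_i1 I)).
split; [exact: cylinder_free | split=> // D hD; exact: cylinder_differential_unique].
Qed.
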